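(* Let $d\in\mathbb N$, let $\mathcal H$ be a complex Hilbert space, and let $\mathsf T=(T_1,\dots,T_d)$ be a $d$-tuple of bounded linear operators on $\mathcal H$. The following statements are equivalent: (a) $\mathsf T$ is Toeplitz-contractive; (b) for all positive integers $m$ and all $m\times m$ complex matrices $A_0,A_1,\dots,A_d$, $$\left\|1_{\mathcal H}\otimes A_0+\sum_{k=1}^d T_k\otimes A_k\right\|\le \max_{z\in\mathbb C,\,|z|=1}\left\|A_0+\sum_{k=1}^d z^kA_k\right\|;$$ (c) there exist a Hilbert space $\mathcal K$ containing $\mathcal H$ as a subspace and a unitary operator $U$ on $\mathcal K$ such that $U^k$ is a dilation of $T_k$, for each $k=1,\dots,d$. If $\mathcal H$ is separable, then (a)-(c) are also equivalent to: (d) for every $\varepsilon>0$ there is an isometry $V_\varepsilon:\mathcal H\to\ell^2(\mathbb Z)$ such that $\|T_k-V_\varepsilon^*W^kV_\varepsilon\|<\varepsilon$ for each $k=1,\dots,d$, where $W$ denotes the bilateral shift operator on $\ell^2(\mathbb Z)$. Moreover, if $\mathcal H$ has finite dimension and the equivalent conditions (a)-(d) hold, then the Hilbert space $\mathcal K$ in (c) can be chosen to have finite dimension.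
   Context: A $d$-tuple $\mathsf T=(T_1,\dots,T_d)$ of bounded operators on $\mathcal H$ is Toeplitz-contractive if the $(d+1)\times(d+1)$ Toeplitz operator matrix $\mathcal T$, whose $(i,j)$ entry is $1_{\mathcal H}$ if $i=j$, $T_{i-j}$ if $i>j$, and $T_{j-i}^*$ if $i<j$, is a positive (i.e. positive semidefinite) operator on $\bigoplus_1^{d+1}\mathcal H$. If $\mathcal K$ contains $\mathcal H$ as a subspace, a bounded operator $S$ on $\mathcal K$ is a dilation of a bounded operator $T$ on $\mathcal H$ if $T\xi=P_{\mathcal H}S\xi$ for all $\xi\in\mathcal H$, where $P_{\mathcal H}$ is the orthogonal projection of $\mathcal K$ onto $\mathcal H$. The bilateral shift $W$ on $\ell^2(\mathbb Z)$ is the unitary with $We_n=e_{n+1}$ for the canonical orthonormal basis $(e_n)_{n\in\mathbb Z}$. The operators in (b) act on $\mathcal H\otimes\mathbb C^m$, and norms are operator norms. *)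

(* Defs.v *)
From HB Require Import structures.
From mathcomp Require Import all_boot all_order all_algebra.
From mathcomp Require Import complex ring lra.
From mathcomp Require Import mathcomp_extra boolp classical_sets functions.
From mathcomp Require Import cardinality reals topology normedtype sequences.
Set Implicit Arguments.
Unset Strict Implicit.
Unset Printing Implicit Defensive.
Import Order.TTheory GRing.Theory Num.Theory.
Import numFieldNormedType.Exports.
Local Open Scope classical_set_scope.
Local Open Scope ring_scope.

(* Following the convention of [{dot _ for _}], inner products are linear in
   the first argument and conjugate-linear in the second one. *)
HB.mixin Record CompleteNormedModule_isHilbert (R : realType) V
    & CompleteNormedModule R[i] V := {
  inner : {dot V for @Num.conj R[i]} ;
  inner_normE : forall x : V, inner x x = `|x| ^+ 2
}.

#[short(type="hilbertType")]
HB.structure Definition Hilbert (R : realType) :=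
  {V of CompleteNormedModule R[i] V & CompleteNormedModule_isHilbert R V}.

Section dot_norm.
Variables (C : numClosedFieldType) (V : lmodType C).
Variable f : {dot V for @Num.conj C}.

Lemma dot_CauchySchwarz (u v : V) : `|f u v| ^+ 2 <= f u u * f v v.
Proof.
have [->|v0] := eqVneq v 0; first by rewrite !linear0r normr0 expr0n/= mulr0.
have vv : 0 < f v v by rewrite dnorm_gt0.
pose a := f u v / f v v.
have : 0 <= f (u - a *: v) (u - a *: v) by exact: dnorm_ge0.
rewrite dnormB dnormZ linearZr_LR/=.
have fvvR : (f v v)^* = f v v by apply/CrealP/ger0_real/ltW.
have -> : a^* * f u v = `|f u v| ^+ 2 / f v v.
  by rewrite /a rmorphM/= fmorphV/= fvvR normCK mulrAC [X in X / _]mulrC.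
have -> : (`|f u v| ^+ 2 / f v v)^* = `|f u v| ^+ 2 / f v v.
  by apply/CrealP; rewrite ger0_real// divr_ge0 ?exprn_ge0// ltW.
have -> : `|a| ^+ 2 * f v v = `|f u v| ^+ 2 / f v v.
  rewrite /a normrM normfV (ger0_norm (ltW vv)) exprMn -mulrA; congr (_ * _).
  by rewrite expr2 -mulrA mulVf ?gt_eqF// mulr1.
by rewrite opprD addrA addrK subr_ge0 ler_pdivrMr.
Qed.

Lemma dot_triangle (u v : V) :
  sqrtC (f (u + v) (u + v)) <= sqrtC (f u u) + sqrtC (f v v).
Proof.
have s0 w : 0 <= sqrtC (f w w) by rewrite sqrtC_ge0 dnorm_ge0.
rewrite -[leRHS]sqrCK ?addr_ge0//.
rewrite ler_sqrtC ?nnegrE ?dnorm_ge0 ?exprn_ge0 ?addr_ge0//.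
rewrite dnormD sqrrD !sqrtCK [leRHS]addrAC lerD2l.
have -> : f u v + (f u v)^* = 'Re (f u v) *+ 2.
  by rewrite ReE -[RHS]mulr_natr divfK// pnatr_eq0.
rewrite lerMn2r/=.
apply: le_trans (leif_Re_Creal _) _.
rewrite -(@ler_pXn2r _ 2)// ?nnegrE ?mulr_ge0// exprMn !sqrtCK.
exact: dot_CauchySchwarz.
Qed.

End dot_norm.

(* A complex vector space with an inner product for which Cauchy sequences
   converge is a Hilbert space. *)
HB.factory Record Lmodule_isHilbert (R : realType) V & GRing.Lmodule R[i] V := {
  dot : {dot V for @Num.conj R[i]} ;
  dot_complete : forall u : nat -> V,
    (forall e : R, 0 < e -> exists N, forall m n, (N <= m)%N -> (N <= n)%N ->
       complex.Re (dot (u m - u n) (u m - u n)) < e) ->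
    exists l, forall e : R, 0 < e -> exists N, forall n, (N <= n)%N ->
       complex.Re (dot (u n - l) (u n - l)) < e
}.

HB.builders Context R V & Lmodule_isHilbert R V.

Let nrm (x : V) : R[i] := sqrtC (dot x x).

Let nrmZ (l : R[i]) (x : V) : nrm (l *: x) = `|l| * nrm x.
Proof.
by rewrite /nrm dnormZ sqrtCM ?nnegrE ?exprn_ge0 ?dnorm_ge0// sqrCK.
Qed.

Let nrm0_eq0 (x : V) : nrm x = 0 -> x = 0.
Proof. by move=> /eqP; rewrite sqrtC_eq0 dnorm_eq0 => /eqP. Qed.

HB.instance Definition _ := Lmodule_isNormed.Build R[i] V
  (dot_triangle dot) nrmZ nrm0_eq0.

Let nrmE (x : V) : dot x x = `|x| ^+ 2.
Proof. by rewrite -[LHS]sqrtCK. Qed.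

Let gt0_real (e : R[i]) : 0 < e -> e = (complex.Re e)%:C%C /\ 0 < complex.Re e.
Proof. by case: e => a b; rewrite ltcE/= => /andP[/eqP -> ->]. Qed.

Let lt_sqrt (x : V) (e : R) : 0 < e ->
  (complex.Re (dot x x) < e ^+ 2) = (`|x| < e%:C%C).
Proof.
move=> e0; rewrite nrmE -[RHS](@ltr_pXn2r _ 2)// ?nnegrE ?ler0c ?(ltW e0)//.
have /complex_realP[r ->] : `|x| \is Num.real by exact: normr_real.
by rewrite -!rmorphXn/= ltcR.
Qed.

Let complete (F : set_system V) : ProperFilter F -> cauchy F -> cvg F.
Proof.
move=> FF /cauchyP cF.
have /choice[u uF] : forall n, exists x, F (ball x (n.+1%:R^-1 : R)%:C%C).
  by move=> n; apply: cF; rewrite ltcR invr_gt0.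
have small (e : R) : 0 < e -> exists N, forall n, (N <= n)%N -> n.+1%:R^-1 < e.
  move=> e0; exists (Num.truncn e^-1) => n Nn.
  rewrite invf_plt ?posrE//.
  by apply: lt_le_trans (truncnS_gt _) _; rewrite ler_nat ltnS.
have [] := @dot_complete u.
  move=> e e0.
  have d0 : 0 < Num.sqrt e / 2 by rewrite divr_gt0 ?sqrtr_gt0.
  have [N HN] := small _ d0; exists N => m n Nm Nn.
  rewrite -[e]sqr_sqrtr ?ltW// lt_sqrt ?sqrtr_gt0//.
  have [z [mz nz]] := filter_ex (filterI (uF m) (uF n)).
  rewrite -(subrKA z) [Num.sqrt e]splitr rmorphD/=.
  apply: le_lt_trans (ler_normD _ _) _; apply: ltrD.
    by move: mz; rewrite -ball_normE/= => /lt_trans; apply; rewrite ltcR HN.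
  move: nz; rewrite -ball_normE/= distrC => /lt_trans; apply.
  by rewrite ltcR HN.
move=> l ul; apply/cvg_ex; exists l.
apply/fcvgrPdist_lt => e /gt0_real[eE r0].
have {eE r0}[r [-> e0]] : exists r : R, e = r%:C%C /\ 0 < r by exists (complex.Re e).
have r2 : 0 < r / 2 by rewrite divr_gt0.
have [N1 HN1] := small _ r2.
have [|N2 HN2] := ul ((r / 2) ^+ 2); first by rewrite exprn_gt0.
pose n := maxn N1 N2.
apply: filterS (uF n) => y; rewrite -ball_normE/= => ny.
rewrite -(subrKA (u n)) [r]splitr rmorphD/=.
apply: le_lt_trans (ler_normD _ _) _; apply: ltrD.
  by rewrite distrC -lt_sqrt// HN2// leq_maxr.
by apply: lt_trans ny _; rewrite ltcR HN1// leq_maxl.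
Qed.

HB.instance Definition _ := Uniform_isComplete.Build V complete.
HB.instance Definition _ := CompleteNormedModule_isHilbert.Build R V nrmE.
HB.end.

Section hilbert_theory.
Variables (R : realType) (H : hilbertType R).
Implicit Types x y z : H.

Lemma innerC x y : inner y x = (inner x y)^*.
Proof. by rewrite hermC/= mul1r. Qed.

Lemma inner_CauchySchwarz x y : `|inner x y| <= `|x| * `|y|.
Proof.
rewrite -(@ler_pXn2r _ 2)// ?nnegrE ?mulr_ge0// exprMn -!inner_normE.
exact: dot_CauchySchwarz.
Qed.

Lemma lt_inner_sqr x (e : R) : 0 < e ->
  (complex.Re (inner x x) < e ^+ 2) = (`|x| < e%:C%C).
Proof.
move=> e0; rewrite inner_normE -[RHS](@ltr_pXn2r _ 2)// ?nnegrE ?ler0c ?(ltW e0)//.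
have /complex_realP[r ->] : `|x| \is Num.real by exact: normr_real.
by rewrite -!rmorphXn/= ltcR.
Qed.

Lemma inner_complete (u : nat -> H) :
    (forall e : R, 0 < e -> exists N, forall m n, (N <= m)%N -> (N <= n)%N ->
       complex.Re (inner (u m - u n) (u m - u n)) < e) ->
    exists l, forall e : R, 0 < e -> exists N, forall n, (N <= n)%N ->
       complex.Re (inner (u n - l) (u n - l)) < e.
Proof.
move=> cu.
have /cvg_ex[/= l ul] : cvg (u @ \oo).
  apply/cauchy_cvgP/cauchyP => e e0.
  have {e0}[r [-> r0]] : exists r : R, e = r%:C%C /\ 0 < r.
    by case: e e0 => a b; rewrite ltcE/= => /andP[/eqP -> ?]; exists a.
  have [|N HN] := cu (r ^+ 2); first by rewrite exprn_gt0.
  exists (u N); exists N => // n /= Nn.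
  by rewrite -ball_normE/= -lt_inner_sqr// HN.
exists l => e e0.
have s0 : 0 < Num.sqrt e by rewrite sqrtr_gt0.
have /cvgrPdist_lt/(_ (Num.sqrt e)%:C%C) := ul.
rewrite ltcR => /(_ s0)[N _ HN]; exists N => n Nn.
rewrite -[e]sqr_sqrtr ?(ltW e0)// lt_inner_sqr// distrC.
exact: HN.
Qed.

End hilbert_theory.

Section hpow.
Variable R : realType.

(* The orthogonal direct sum of n copies of H. *)
Definition hpow (n : nat) (H : hilbertType R) : Type := {ffun 'I_n -> H}.

Variables (n : nat) (H : hilbertType R).

HB.instance Definition _ := GRing.Lmodule.copy (hpow n H) {ffun 'I_n -> H}.

Definition hpow_dot (x y : hpow n H) : R[i] := \sum_(i < n) inner (x i) (y i).

Let hpow_dot_bilinear :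
  bilinear_for *%R (@Num.conj R[i] \; *%R) hpow_dot.
Proof.
split=> [z a x y|z a x y] /=; rewrite /hpow_dot.
  rewrite mulr_sumr -big_split/=; apply: eq_bigr => i _.
  by rewrite !ffunE linearDl/= linearZl_LR.
rewrite mulr_sumr -big_split/=; apply: eq_bigr => i _.
by rewrite !ffunE linearDr/= linearZr_LR.
Qed.

HB.instance Definition _ := bilinear_isBilinear.Build R[i] (hpow n H) (hpow n H)
  R[i] *%R (@Num.conj R[i] \; *%R) hpow_dot hpow_dot_bilinear.

Let hpow_dot_hermitian (x y : hpow n H) :
  hpow_dot x y = (-1) ^+ false * Num.conj (hpow_dot y x).
Proof.
rewrite expr0 mul1r /hpow_dot rmorph_sum; apply: eq_bigr => i _.
exact: innerC.
Qed.

HB.instance Definition _ := isHermitianSesquilinear.Build R[i] (hpow n H) false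
  (@Num.conj R[i]) hpow_dot hpow_dot_hermitian.

Let hpow_dot_gt0 (x : hpow n H) : x != 0 -> 0 < hpow_dot x x.
Proof.
have ge0 (i : 'I_n) : true -> 0 <= inner (x i) (x i) by move=> _; exact: dnorm_ge0.
move=> x0; rewrite lt_def (sumr_ge0 _ ge0) andbT.
apply: contra x0; rewrite psumr_eq0//.
move=> /allP/= h; apply/eqP/ffunP => i; rewrite ffunE.
have := h i; rewrite mem_index_enum => /(_ isT).
by rewrite dnorm_eq0 => /eqP.
Qed.

HB.instance Definition _ := isDotProduct.Build R[i] (hpow n H) hpow_dot hpow_dot_gt0.

Let hpow_complete (u : nat -> hpow n H) :
    (forall e : R, 0 < e -> exists N, forall m k, (N <= m)%N -> (N <= k)%N ->
       complex.Re (hpow_dot (u m - u k) (u m - u k)) < e) ->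
    exists l, forall e : R, 0 < e -> exists N, forall k, (N <= k)%N ->
       complex.Re (hpow_dot (u k - l) (u k - l)) < e.
Proof.
have dotE (x : hpow n H) : complex.Re (hpow_dot x x) =
    \sum_(i < n) complex.Re (inner (x i) (x i)).
  by rewrite /hpow_dot raddf_sum.
have ge0 (x : H) : 0 <= complex.Re (inner x x).
  by have := dnorm_ge0 inner x; rewrite lecE => /andP[].
move=> cu.
have /choice[l lP] : forall i : 'I_n, exists li : H, forall e : R, 0 < e ->
    exists N, forall k, (N <= k)%N ->
    complex.Re (inner (u k i - li) (u k i - li)) < e.
  move=> i; apply: inner_complete => e /cu[N HN].
  exists N => m k Nm Nk; apply: le_lt_trans (HN _ _ Nm Nk).
  rewrite dotE (bigD1 i)//= !ffunE lerDl sumr_ge0//.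
exists [ffun i => l i] => e e0.
have en : 0 < e / n.+1%:R by rewrite divr_gt0.
have /choice[N NP] : forall i : 'I_n, exists N, forall k, (N <= k)%N ->
    complex.Re (inner (u k i - l i) (u k i - l i)) < e / n.+1%:R.
  by move=> i; exact: lP.
exists (\max_(i < n) N i)%N => k Nk; rewrite dotE.
apply: (@le_lt_trans _ _ (\sum_(i < n) e / n.+1%:R)).
  apply: ler_sum => i _; rewrite !ffunE; apply/ltW/NP.
  by apply: leq_trans Nk; exact: leq_bigmax.
rewrite sumr_const card_ord -[ltLHS]mulr_natr mulrAC ltr_pdivrMr//.
by rewrite ltr_pM2l// ltr_nat.
Qed.

HB.instance Definition _ := Lmodule_isHilbert.Build R (hpow n H) hpow_complete.

End hpow.

Section rnorm.
Variable R : realType.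

(* Norms over R[i] are R[i]-valued; [rnorm] is the same norm with values in R. *)
Definition rnorm (V : normedZmodType R[i]) (x : V) : R := complex.Re `|x|.

Lemma rnormE (V : normedZmodType R[i]) (x : V) : `|x| = (rnorm x)%:C%C.
Proof. by rewrite /rnorm RRe_real// normr_real. Qed.

Lemma rnorm_ge0 (V : normedZmodType R[i]) (x : V) : 0 <= rnorm x.
Proof. by rewrite -ler0c -rnormE. Qed.

Lemma sqr_rnorm (z : R[i]) :
  rnorm z ^+ 2 = complex.Re z ^+ 2 + complex.Im z ^+ 2.
Proof. by case: z => a b; rewrite /rnorm/= sqr_sqrtr// addr_ge0 ?sqr_ge0. Qed.

Lemma norm_Re_rnorm (z : R[i]) : `|complex.Re z| <= rnorm z.
Proof.
by rewrite -(@ler_pXn2r _ 2)// ?nnegrE ?rnorm_ge0// sqr_rnorm real_normK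
  ?num_real// lerDl sqr_ge0.
Qed.

Lemma norm_Im_rnorm (z : R[i]) : `|complex.Im z| <= rnorm z.
Proof.
by rewrite -(@ler_pXn2r _ 2)// ?nnegrE ?rnorm_ge0// sqr_rnorm real_normK
  ?num_real// lerDr sqr_ge0.
Qed.

Lemma rnormM (z w : R[i]) : rnorm (z * w) = rnorm z * rnorm w.
Proof. by apply/complexI; rewrite rmorphM/= -!rnormE normrM. Qed.

Lemma rnorm_conj (z : R[i]) : rnorm z^* = rnorm z.
Proof. by apply/complexI; rewrite -!rnormE norm_conjC. Qed.

Lemma ler_rnormD (V : normedZmodType R[i]) (x y : V) :
  rnorm (x + y) <= rnorm x + rnorm y.
Proof. by rewrite -lecR rmorphD/= -!rnormE ler_normD. Qed.

End rnorm.

Section sumZ.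
Variable R : realType.
Implicit Types (u v : int -> R) (f g : int -> R[i]).

(* The two-sided series sum_(n in Z) u n, terms n and -(n+1) being grouped. *)
Definition seriesZ u : R ^nat := series (fun k => u (Posz k) + u (Negz k)).

Definition sumZ u : R := limn (seriesZ u).

Definition csumZ f : R[i] :=
  (sumZ (fun n => complex.Re (f n)) +i* sumZ (fun n => complex.Im (f n)))%C.

Lemma cvg_seriesZ_le u v : (forall n, `|u n| <= v n) ->
  cvgn (seriesZ v) -> cvgn (seriesZ u).
Proof.
move=> uv cv; apply: normed_cvg; apply: series_le_cvg cv => //= n.
  by rewrite addr_ge0// (le_trans _ (uv _)).
by apply: le_trans (ler_normD _ _) _; exact: lerD.
Qed.

Lemma seriesZD u v : seriesZ (u \+ v) = seriesZ u \+ seriesZ v.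
Proof.
apply/funext => n; rewrite /seriesZ/series/= -big_split/=.
by apply: eq_bigr => i _; rewrite addrACA.
Qed.

Lemma seriesZZ a u : seriesZ (fun n => a * u n) = (fun n => a * seriesZ u n).
Proof.
apply/funext => n; rewrite /seriesZ/series/= mulr_sumr.
by apply: eq_bigr => i _; rewrite mulrDr.
Qed.

Lemma seriesZ_ge0 u n : (forall k, 0 <= u k) -> 0 <= seriesZ u n.
Proof. by move=> u0; apply: sumr_ge0 => i _; rewrite addr_ge0. Qed.

Lemma seriesZ_le u v n : (forall k, u k <= v k) -> seriesZ u n <= seriesZ v n.
Proof. by move=> uv; apply: ler_sum => i _; rewrite lerD. Qed.

Lemma seriesZ_ndecr u : (forall k, 0 <= u k) -> nondecreasing_seq (seriesZ u).
Proof.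
by move=> u0; apply: nondecreasing_series => n _ _; rewrite addr_ge0.
Qed.

Lemma sumZ_ub u n : (forall k, 0 <= u k) -> cvgn (seriesZ u) ->
  seriesZ u n <= sumZ u.
Proof. by move=> u0 cu; apply: nondecreasing_cvgn_le => //; exact: seriesZ_ndecr. Qed.

Lemma sumZ_bounded u (M : R) : (forall k, 0 <= u k) ->
  (forall n, seriesZ u n <= M) -> cvgn (seriesZ u) /\ sumZ u <= M.
Proof.
move=> u0 uM.
have cu : cvgn (seriesZ u).
  apply: nondecreasing_is_cvgn; first exact: seriesZ_ndecr.
  by exists M => _ [n _ <-].
by split => //; apply: limr_le => //; apply: nearW.
Qed.

Lemma sumZ_term u n : (forall k, 0 <= u k) -> cvgn (seriesZ u) ->
  u n <= sumZ u.
Proof.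
move=> u0 cu.
suff [k uk] : exists k, u n <= seriesZ u k by exact: le_trans uk (sumZ_ub _ _ _).
have [k [kn|kn]] : exists k, n = Posz k \/ n = Negz k.
- by case: n => k; exists k; [left|right].
- exists k.+1; rewrite /seriesZ seriesSr/= kn addrCA.
  by rewrite lerDl addr_ge0// sumr_ge0// => i _; rewrite addr_ge0.
- exists k.+1; rewrite /seriesZ seriesSr/= kn addrA addrC.
  by rewrite lerDl addr_ge0// sumr_ge0// => i _; rewrite addr_ge0.
Qed.

Lemma sumZD u v : cvgn (seriesZ u) -> cvgn (seriesZ v) ->
  sumZ (u \+ v) = sumZ u + sumZ v.
Proof.
by move=> cu cv; rewrite /sumZ seriesZD; apply/cvg_lim => //; exact: cvgD.
Qed.

Lemma sumZZ a u : cvgn (seriesZ u) -> sumZ (fun n => a * u n) = a * sumZ u.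
Proof.
by move=> cu; rewrite /sumZ seriesZZ; apply/cvg_lim => //; exact: cvgMl_tmp.
Qed.

Lemma cvg_seriesZD u v : cvgn (seriesZ u) -> cvgn (seriesZ v) ->
  cvgn (seriesZ (u \+ v)).
Proof. by move=> cu cv; rewrite seriesZD; exact: is_cvgD. Qed.

Lemma cvg_seriesZZ a u : cvgn (seriesZ u) -> cvgn (seriesZ (fun n => a * u n)).
Proof.
move=> cu; rewrite seriesZZ; apply/cvg_ex; exists (a * sumZ u).
exact: cvgMl_tmp.
Qed.

Definition csummableZ f :=
  cvgn (seriesZ (fun n => complex.Re (f n))) /\
  cvgn (seriesZ (fun n => complex.Im (f n))).

Lemma csumZD f g : csummableZ f -> csummableZ g ->
  csumZ (f \+ g) = csumZ f + csumZ g.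
Proof.
move=> [rf if_] [rg ig]; rewrite /csumZ.
transitivity ((sumZ (fun n => complex.Re (f n)) + sumZ (fun n => complex.Re (g n)))
  +i* (sumZ (fun n => complex.Im (f n)) + sumZ (fun n => complex.Im (g n))))%C => //.
by rewrite -!sumZD//; congr (sumZ _ +i* sumZ _)%C; apply/funext => n /=; rewrite raddfD.
Qed.

Lemma csumZZ (a : R[i]) f : csummableZ f -> csumZ (fun n => a * f n) = a * csumZ f.
Proof.
case: a => a b [rf if_]; rewrite /csumZ.
have -> : (fun n => complex.Re ((a +i* b)%C * f n)) =
    (fun n => a * complex.Re (f n)) \+ (fun n => - b * complex.Im (f n)).
  by apply/funext => n /=; case: (f n) => c d /=; rewrite mulNr.
have -> : (fun n => complex.Im ((a +i* b)%C * f n)) =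
    (fun n => a * complex.Im (f n)) \+ (fun n => b * complex.Re (f n)).
  by apply/funext => n /=; case: (f n) => c d.
rewrite !sumZD ?sumZZ//; try exact: cvg_seriesZZ.
by rewrite mulNr.
Qed.

Lemma csumZ_conj f : csummableZ f -> csumZ (fun n => (f n)^*) = (csumZ f)^*.
Proof.
move=> [rf if_]; rewrite /csumZ.
have -> : (fun n => complex.Re (f n)^*) = (fun n => complex.Re (f n)).
  by apply/funext => n /=; case: (f n).
have -> : (fun n => complex.Im (f n)^*) = (fun n => -1 * complex.Im (f n)).
  by apply/funext => n /=; case: (f n) => a b; rewrite mulN1r.
by rewrite sumZZ// mulN1r.
Qed.

End sumZ.

Section l2Z.
Variable R : realType.

Definition sq_summable : {pred (int -> R[i])} :=
  fun f => `[< cvgn (seriesZ (fun n => rnorm (f n) ^+ 2)) >].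

Record l2Z := L2Z { l2Z_fun :> int -> R[i] ; _ : l2Z_fun \in sq_summable }.

HB.instance Definition _ := [isSub for l2Z_fun].
HB.instance Definition _ := [Choice of l2Z by <:].

Let sq_summable_submod : GRing.subsemimod_closed sq_summable.
Proof.
split; first split.
- apply/asboolP; rewrite (_ : (fun n => _) = fun=> 0).
    rewrite /seriesZ (_ : series _ = fun=> 0); first exact: is_cvg_cst.
    by apply/funext => n; rewrite /series/= big1// => i _; rewrite addr0.
  by apply/funext => n; rewrite sqr_rnorm/= expr0n/= addr0.
- move=> f g /asboolP cf /asboolP cg; apply/asboolP.
  apply: (@cvg_seriesZ_le _ _ ((fun n => 2 * rnorm (f n) ^+ 2) \+
                              (fun n => 2 * rnorm (g n) ^+ 2))).
    move=> n /=; rewrite ger0_norm ?sqr_ge0//.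
    apply: (@le_trans _ _ ((rnorm (f n) + rnorm (g n)) ^+ 2)).
      by rewrite ler_pXn2r ?nnegrE ?addr_ge0 ?rnorm_ge0// ler_rnormD.
    rewrite -subr_ge0 (_ : _ - _ = (rnorm (f n) - rnorm (g n)) ^+ 2) ?sqr_ge0//.
    by ring.
  by apply: cvg_seriesZD; apply: cvg_seriesZZ.
- move=> a f /asboolP cf; apply/asboolP.
  rewrite (_ : (fun n => _) = fun n => rnorm a ^+ 2 * rnorm (f n) ^+ 2).
    exact: cvg_seriesZZ.
  by apply/funext => n; rewrite -exprMn -rnormM.
Qed.

HB.instance Definition _ := GRing.isSubmodClosed.Build R[i] (int -> R[i])
  sq_summable sq_summable_submod.
HB.instance Definition _ := [SubChoice_isSubLmodule of l2Z by <:].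

Lemma l2ZP (f : l2Z) : cvgn (seriesZ (fun n => rnorm (f n) ^+ 2)).
Proof. by case: f => f /= /asboolP. Qed.

Arguments l2ZP : clear implicits.

Definition l2Z_dot (f g : l2Z) : R[i] := csumZ (fun n => f n * (g n)^*).

Let csummable_dot (f g : l2Z) : csummableZ (fun n => f n * (g n)^*).
Proof.
have le n : rnorm (f n * (g n)^*) <=
    rnorm (f n) ^+ 2 + rnorm (g n) ^+ 2.
  rewrite rnormM rnorm_conj; set a := rnorm _; set b := rnorm _.
  have [a0 b0] : 0 <= a /\ 0 <= b by rewrite !rnorm_ge0.
  have [ab|/ltW ba] := leP a b.
    by rewrite -[leLHS]add0r lerD ?sqr_ge0// expr2 ler_wpM2r.
  by rewrite -[leLHS]addr0 lerD ?sqr_ge0// expr2 ler_wpM2l.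
have cv : cvgn (seriesZ ((fun n => rnorm (f n) ^+ 2) \+
                        (fun n => rnorm (g n) ^+ 2))).
  by apply: cvg_seriesZD; exact: l2ZP.
split; apply: cvg_seriesZ_le cv => n /=; apply: le_trans (le n).
  exact: norm_Re_rnorm.
exact: norm_Im_rnorm.
Qed.

Let l2Z_dot_bilinear : bilinear_for *%R (@Num.conj R[i] \; *%R) l2Z_dot.
Proof.
have linl (g : l2Z) : GRing.linear_for *%R (l2Z_dot ^~ g).
  move=> a f h /=; rewrite /l2Z_dot -csumZZ// -csumZD//.
  - by congr csumZ; apply/funext => n /=; rewrite mulrDl mulrA.
  - case: (csummable_dot (a *: f) g) => H1 H2.
    rewrite (_ : (fun n => _) = fun n => (a *: f : l2Z) n * (g n)^*)//.
    by apply/funext => n /=; rewrite mulrA.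
split=> [//|f a g h /=].
have conjE (u v : l2Z) : l2Z_dot u v = (l2Z_dot v u)^*.
  rewrite /l2Z_dot -csumZ_conj//; congr csumZ; apply/funext => n.
  by rewrite rmorphM/= conjCK mulrC.
by rewrite conjE linl rmorphD/= rmorphM/= -!conjE.
Qed.

HB.instance Definition _ := bilinear_isBilinear.Build R[i] l2Z l2Z
  R[i] *%R (@Num.conj R[i] \; *%R) l2Z_dot l2Z_dot_bilinear.

Let l2Z_dot_hermitian (f g : l2Z) :
  l2Z_dot f g = (-1) ^+ false * Num.conj (l2Z_dot g f).
Proof.
rewrite expr0 mul1r /l2Z_dot -csumZ_conj//; congr csumZ; apply/funext => n.
by rewrite rmorphM/= conjCK mulrC.
Qed.

HB.instance Definition _ := isHermitianSesquilinear.Build R[i] l2Z false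
  (@Num.conj R[i]) l2Z_dot l2Z_dot_hermitian.

Let l2Z_dotE (f : l2Z) :
  l2Z_dot f f = (sumZ (fun n => rnorm (f n) ^+ 2))%:C%C.
Proof.
rewrite /l2Z_dot /csumZ; congr (_ +i* _)%C.
  congr sumZ; apply/funext => n.
  by rewrite -normCK rnormE -rmorphXn.
rewrite (_ : (fun n => _) = fun n => 0 * (rnorm (f n) ^+ 2)).
  by rewrite sumZZ ?mul0r//; exact: l2ZP.
by apply/funext => n; rewrite -normCK rnormE -rmorphXn/= mul0r.
Qed.

Let l2Z_dot_gt0 (f : l2Z) : f != 0 -> 0 < l2Z_dot f f.
Proof.
move=> f0; rewrite l2Z_dotE ltcR.
have [n fn0] : exists n, f n != 0.
  apply: contrapT => /forallNP f0n; move/eqP : f0; apply; apply/val_inj/funext => n /=.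
  by apply/eqP/negPn/negP/f0n.
have := sumZ_term n (fun k => sqr_ge0 (rnorm (f k))) (l2ZP f).
apply: lt_le_trans; by rewrite exprn_gt0// -ltcR -rnormE normr_gt0.
Qed.

HB.instance Definition _ := isDotProduct.Build R[i] l2Z l2Z_dot l2Z_dot_gt0.

Let l2Z_complete (u : nat -> l2Z) :
    (forall e : R, 0 < e -> exists N, forall m k, (N <= m)%N -> (N <= k)%N ->
       complex.Re (l2Z_dot (u m - u k) (u m - u k)) < e) ->
    exists l, forall e : R, 0 < e -> exists N, forall k, (N <= k)%N ->
       complex.Re (l2Z_dot (u k - l) (u k - l)) < e.
Proof.
move=> cu0.
have cu e : 0 < e -> exists N, forall m k, (N <= m)%N -> (N <= k)%N ->
    sumZ (fun n => rnorm ((u m - u k) n) ^+ 2) < e.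
  by move=> /cu0[N HN]; exists N => m k Nm Nk; have := HN _ _ Nm Nk; rewrite l2Z_dotE.
have term m k n : rnorm (u m n - u k n) ^+ 2 <=
    sumZ (fun n => rnorm ((u m - u k) n) ^+ 2).
  exact: (sumZ_term n (fun n => sqr_ge0 (rnorm ((u m - u k) n))) (l2ZP (u m - u k))).
have cvgcoord (p : R[i] -> R) (n : int) :
    (forall x y, p (x - y) = p x - p y) ->
    (forall x, `|p x| <= rnorm x) ->
    cvgn (fun k => p (u k n)).
  move=> pB pn; apply/cauchy_cvgP/cauchyP => e e0.
  have [|N HN] := cu (e ^+ 2); first by rewrite exprn_gt0.
  exists (p (u N n)), N => // k /= Nk; rewrite -ball_normE/= -pB.
  apply: le_lt_trans (pn _) _.
  rewrite -(@ltr_pXn2r _ 2)// ?nnegrE ?rnorm_ge0 ?(ltW e0)//.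
  exact: le_lt_trans (term _ _ _) (HN _ _ _ _).
pose l n : R[i] := (limn (fun k => complex.Re (u k n)) +i*
                    limn (fun k => complex.Im (u k n)))%C.
have cRe n : cvgn (fun k => complex.Re (u k n)).
  by apply: cvgcoord => [x y|x]; [rewrite raddfB|exact: norm_Re_rnorm].
have cIm n : cvgn (fun k => complex.Im (u k n)).
  by apply: cvgcoord => [x y|x]; [rewrite raddfB|exact: norm_Im_rnorm].
have csq m n : rnorm (u m n - u k n) ^+ 2 @[k --> \oo] --> rnorm (u m n - l n) ^+ 2.
  rewrite sqr_rnorm; under eq_fun do rewrite sqr_rnorm !raddfB/= !expr2.
  rewrite !raddfB/= !expr2.
  by apply: cvgD; apply: cvgM; apply: cvgB => //; exact: cvg_cst.
have bound (e : R) (e0 : 0 < e) : exists N, forall m, (N <= m)%N ->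
    forall K, seriesZ (fun n => rnorm (u m n - l n) ^+ 2) K <= e.
  have [N HN] := cu _ e0; exists N => m Nm K.
  have cK : seriesZ (fun n => rnorm (u m n - u k n) ^+ 2) K @[k --> \oo] -->
            seriesZ (fun n => rnorm (u m n - l n) ^+ 2) K.
    elim: K => [|K IH].
      rewrite /seriesZ /series/=; under eq_fun do rewrite big_geq//.
      by rewrite big_geq//; exact: cvg_cst.
    rewrite /seriesZ; under eq_fun do rewrite seriesSr; rewrite seriesSr.
    by apply: cvgD => //; apply: cvgD; exact: csq.
  rewrite -(cvg_lim _ cK)//; apply: limr_le; first by apply/cvg_ex; eexists; exact: cK.
  exists N => // k /= Nk.
  apply: le_trans (ltW (HN _ _ Nm Nk)).
  exact: (sumZ_ub _ (fun k => sqr_ge0 _) (l2ZP (u m - u k))).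
have sql m : (exists e, forall K, seriesZ (fun n => rnorm (u m n - l n) ^+ 2) K <= e) ->
    ((u m : int -> R[i]) - l) \in sq_summable.
  by move=> [e He]; apply/asboolP; apply: (sumZ_bounded _ He).1 => k; exact: sqr_ge0.
have lP : l \in sq_summable.
  have [N /(_ _ (leqnn N)) HN] := bound 1 ltr01.
  rewrite -[l](subKr (u N : int -> R[i])).
  by rewrite rpredB ?(valP (u N))//; apply: sql; exists 1.
exists (L2Z lP) => e e0.
have e20 : 0 < e / 2 by rewrite divr_gt0.
have [N HN] := bound _ e20; exists N => k Nk.
rewrite l2Z_dotE/=.
have [_] := @sumZ_bounded _ (fun n => rnorm (u k n - l n) ^+ 2) (e / 2)
  (fun k => sqr_ge0 _) (HN k Nk).
move=> /le_lt_trans; apply.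
by rewrite ltr_pdivrMr// ltr_pMr// ltr1n.
Qed.

HB.instance Definition _ := Lmodule_isHilbert.Build R l2Z l2Z_complete.

End l2Z.

Arguments l2ZP {R} f.

Section riesz.
Variables (R : realType) (V : hilbertType R).
Implicit Types x y z h : V.

Let p x y : R := complex.Re (inner x y).

Let pC x y : p x y = p y x.
Proof. by rewrite /p innerC; case: (inner y x). Qed.

Let pDl x y z : p (x + y) z = p x z + p y z.
Proof. by rewrite /p linearDl/= raddfD. Qed.

Let pZl (t : R) x z : p (t%:C%C *: x) z = t * p x z.
Proof.
by rewrite /p linearZl_LR/=; case: (inner x z) => a b /=; rewrite mul0r subr0.
Qed.

Let p_ge0 x : 0 <= p x x.
Proof. by have := dnorm_ge0 (@inner R V) x; rewrite lecE => /andP[]. Qed.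

Let pE x : p x x = rnorm x ^+ 2.
Proof. by rewrite /p inner_normE rnormE -rmorphXn. Qed.

Lemma riesz (g : V -> R[i]) (M : R) :
  (forall a x y, g (a *: x + y) = a * g x + g y) ->
  (forall x, rnorm (g x) <= M * rnorm x) ->
  exists z, forall x, g x = inner x z.
Proof.
move=> glin gM.
pose q x : R := complex.Re (g x).
have qD x y : q (x + y) = q x + q y.
  by rewrite /q -[x]scale1r glin mul1r scale1r raddfD.
have g0 : g 0 = 0.
  by have := glin (-1) 0 0; rewrite scaler0 addr0 mulN1r addNr.
have gZ a x : g (a *: x) = a * g x by rewrite -[a *: x]addr0 glin g0 addr0.
have qZ (t : R) x : q (t%:C%C *: x) = t * q x.
  by rewrite /q gZ; case: (g x) => a b /=; rewrite mul0r subr0.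
pose phi x := p x x - 2 * q x.
have phi_lb x : - M ^+ 2 <= phi x.
  have : q x <= M * rnorm x.
    by apply: le_trans (gM x); apply: le_trans (ler_norm _) (norm_Re_rnorm _).
  rewrite /phi pE => ?; have := sqr_ge0 (rnorm x - M); nra.
pose m := inf (range phi).
have hi : has_inf (range phi).
  by split; [exists (phi 0), 0|exists (- M ^+ 2) => _ [x _ <-]].
have m_le x : m <= phi x by apply: ge_inf; [case: hi|exists x].
have /choice[u uP] : forall n, exists x, phi x < m + n.+1%:R^-1.
  move=> n; have [|_ [x _ <-] ?] := @inf_adherent _ (range phi) n.+1%:R^-1 _ hi.
    by rewrite invr_gt0.
  by exists x.
have small (e : R) : 0 < e -> exists N, forall n, (N <= n)%N -> n.+1%:R^-1 < e.
  move=> e0; exists (Num.truncn e^-1) => n Nn.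
  rewrite invf_plt ?posrE//.
  by apply: lt_le_trans (truncnS_gt _) _; rewrite ler_nat ltnS.
have [] := @inner_complete _ _ u.
  move=> e e0; have [|N HN] := small (e / 4); first by lra.
  exists N => k n Nk Nn; rewrite -/(p _ _).
  pose w := (2^-1 : R)%:C%C *: (u k + u n).
  have : p (u k - u n) (u k - u n) = 2 * phi (u k) + 2 * phi (u n) - 4 * phi w.
    have NE x : - x = (-1 : R)%:C%C *: x by rewrite rmorphN1 scaleN1r.
    rewrite /phi /w qZ qD NE !(pDl, pZl) !(pC _ (_ + _)) !(pC _ (_ *: _)).
    rewrite !(pDl, pZl) (pC (u n) (u k)); lra.
  move: (uP k) (uP n) (m_le w) (HN _ Nk) (HN _ Nn).
  move: (k.+1%:R^-1) (n.+1%:R^-1) (phi (u k)) (phi (u n)) (phi w) => a b c d f0.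
  move=> h1 h2 h3 h4 h5 ->. lra.
move=> z uz; exists z.
have key h : p h z = q h.
  have var t : 0 <= t ^+ 2 * p h h + 2 * t * (p h z - q h).
    apply/ler_addgt0Pr => e e0.
    pose r := 2 * `|t| * rnorm h + 1.
    have r0 : 0 < r.
      by rewrite ltr_wpDl// !mulr_ge0// rnorm_ge0.
    have [|N1 HN1] := small (e / 2); first by lra.
    have [|N2 HN2] := uz ((e / (2 * r)) ^+ 2).
      by rewrite exprn_gt0// divr_gt0// mulr_gt0.
    pose n := maxn N1 N2.
    have e1 := HN1 n (leq_maxl _ _).
    have e2 := HN2 n (leq_maxr _ _).
    have : phi (u n) - n.+1%:R^-1 <= phi (u n + t%:C%C *: h).
      by apply: le_trans (m_le _); rewrite lerBlDr ltW.
    have -> : phi (u n + t%:C%C *: h) =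
        phi (u n) + t ^+ 2 * p h h + 2 * t * (p h (u n) - q h).
      rewrite /phi qD qZ !(pDl, pZl) !(pC _ (_ + _)).
      by rewrite !(pDl, pZl) (pC (u n) h); ring.
    have : 2 * t * (p h (u n) - p h z) <= e / 2.
      have -> : p h (u n) - p h z = p h (u n - z).
        by rewrite /p linearBr/= raddfB.
      have ple : `|p h (u n - z)| <= rnorm h * rnorm (u n - z).
        apply: le_trans (norm_Re_rnorm _) _.
        by rewrite -lecR rmorphM/= -!rnormE inner_CauchySchwarz.
      have un : rnorm (u n - z) <= e / (2 * r).
        rewrite -(@ler_pXn2r _ 2)// ?nnegrE ?rnorm_ge0//.
          by rewrite -pE; exact: ltW.
        by rewrite divr_ge0 ?mulr_ge0 ?(ltW r0) ?(ltW e0).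
      apply: le_trans (ler_norm _) _; rewrite !normrM ger0_norm//.
      apply: (@le_trans _ _ (2 * `|t| * (rnorm h * (e / (2 * r))))).
        rewrite ler_wpM2l ?mulr_ge0//; apply: le_trans ple _.
        by rewrite ler_wpM2l ?rnorm_ge0.
      have -> : 2 * `|t| * (rnorm h * (e / (2 * r))) =
          (2 * `|t| * rnorm h / r) * (e / 2) by field; rewrite gt_eqF.
      rewrite -[leRHS]mul1r ler_wpM2r//; first by rewrite divr_ge0// ltW.
      by rewrite ler_pdivrMr// mul1r /r lerDl.
    move: e1 {e2}; rewrite !mulrBr.
    move: (n.+1%:R^-1) (t ^+ 2 * p h h) (phi (u n)) => k A f0.
    by move: (2 * t * p h (u n)) (2 * t * p h z) (2 * t * q h) => B C D; lra.
  pose c := p h z - q h; apply/eqP; rewrite -subr_eq0 -/c.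
  apply/eqP; set s := p h h + 1.
  have s0 : 0 < s by rewrite ltr_wpDl ?p_ge0.
  have := var (- c / s); rewrite -/c.
  have -> : (- c / s) ^+ 2 * p h h + 2 * (- c / s) * c =
      - (c ^+ 2 * (s + 1) / s ^+ 2).
    have -> : p h h = s - 1 by rewrite /s addrK.
    by field; rewrite gt_eqF.
  have s1 : 0 < s + 1 by exact: (addr_gt0 s0 ltr01).
  rewrite oppr_ge0 pmulr_lle0 ?invr_gt0 ?exprn_gt0// pmulr_lle0// => c2.
  by apply/eqP; rewrite -sqrf_eq0 eq_le c2 sqr_ge0.
move=> x; rewrite [LHS]complexE [RHS]complexE.
have i_key := key ('i%C *: x).
move: i_key (key x); rewrite /p /q gZ linearZl_LR/=.
case: (g x) (inner x z) => a b [c d] /=; rewrite !mul0r !mul1r !sub0r => /oppr_inj -> ->.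
by [].
Qed.

End riesz.

Section operators.
Variable R : realType.

Definition bounded_op (V W : hilbertType R) (f : V -> W) :=
  bounded_near f (nbhs (0 : V)).

(* The adjoint is obtained by choice; [adjointP] (from the Riesz representation
   theorem) shows that it is the Hilbert space adjoint of any bounded operator. *)
Definition adjoint (V W : hilbertType R) (f : V -> W) (y : W) : V :=
  get [set z | forall x, inner (f x) y = inner x z].

Lemma adjointP (V W : hilbertType R) (f : {linear V -> W}) :
  bounded_op f -> forall x y, inner (f x) y = inner x (adjoint f y).
Proof.
move=> /linear_boundedP fb x y; move: x; apply: (@getPex _
  [set z | forall x, inner (f x) y = inner x z]).
have [N [N0 fN]] : exists N : R, 0 <= N /\ forall x, rnorm (f x) <= N * rnorm x.
  have [r [r0 fr]] := pinfty_ex_gt0 fb.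
  exists (complex.Re r).
  have rE : r = (complex.Re r)%:C%C by rewrite RRe_real// gtr0_real.
  split; first by rewrite -lecR -rE ltW.
  by move=> x; rewrite -lecR rmorphM/= -!rnormE -rE fr.
apply: (@riesz _ _ _ (N * rnorm y)).
  by move=> a u v; rewrite linearP linearDl/= linearZl_LR.
move=> x; have := inner_CauchySchwarz (f x) y.
rewrite !rnormE -rmorphM/= lecR => /le_trans; apply.
by rewrite mulrAC ler_wpM2r ?rnorm_ge0.
Qed.

(* Orthogonal projection onto M, again by choice; it is identified with
   [J \o adjoint J] by [orthproj_range] when M is the range of an isometric
   embedding J. *)
Definition orthproj (V : hilbertType R) (M : set V) (x : V) : V :=
  get [set y | M y /\ forall z, M z -> inner (x - y) z = 0].

Lemma orthproj_range (V W : hilbertType R) (J : {linear V -> W}) :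
  isometry inner inner J -> orthproj (range J) =1 J \o adjoint J.
Proof.
move=> Jiso x.
have Jb : bounded_op J.
  apply/linear_boundedP; apply: filterS (nbhs_pinfty_ge (@real1 _)) => r r1 y.
  have -> : `|J y| = `|y|.
    by apply/eqP; rewrite -(@eqrXn2 _ 2)// -!inner_normE Jiso.
  by rewrite ler_peMl.
pose P := [set y | range J y /\ forall z, range J z -> inner (x - y) z = 0].
have PJ : P (J (adjoint J x)).
  split; first by exists (adjoint J x).
  move=> _ [z _ <-]; rewrite linearBl/= Jiso innerC adjointP//.
  by rewrite -innerC subrr.
have [[y _ yE] yP] : P (get P) by apply: getI PJ.
have [_ xP] := PJ.
rewrite /orthproj -/P -yE/=; apply/eqP; rewrite -subr_eq0 -(dnorm_eq0 (@inner R W)).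
rewrite -linearB.
have {1}-> : J (y - adjoint J x) = (x - J (adjoint J x)) - (x - get P).
  by rewrite -yE opprB [RHS]addrC subrKA linearB.
rewrite linearBl/=; apply/eqP.
by rewrite xP ?yP ?subrr//; exists (y - adjoint J x).
Qed.

End operators.

Section shift.
Variable R : realType.

Let predZ (u : int -> R) := fun n : int => u (n - 1).

Let seriesZ_pred u K :
  seriesZ (predZ u) K.+1 = seriesZ u K.+1 + u (Negz K.+1) - u (Posz K).
Proof.
have NP k : Negz k - 1 = Negz k.+1 by rewrite !NegzE -opprD -PoszD addn1.
have PP k : Posz k.+1 - 1 = Posz k by rewrite -addn1 PoszD addrK.
elim: K => [|K IH].
  by rewrite /seriesZ !seriesSr/= /series/= !big_geq// !add0r /predZ NP sub0r
     (_ : - 1%:Z = Negz 0)//; ring.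
rewrite /seriesZ seriesSr -/(seriesZ _ _) IH [in RHS]seriesSr -/(seriesZ _ _).
by rewrite /predZ NP PP; ring.
Qed.

Let shift_subproof (f : l2Z R) : (fun n : int => f (n - 1)) \in @sq_summable R.
Proof.
pose u n := rnorm (f n) ^+ 2.
have u0 n : 0 <= u n by exact: sqr_ge0.
have cu : cvgn (seriesZ u) := l2ZP f.
apply/asboolP; apply: (@sumZ_bounded _ (predZ u) (sumZ u + sumZ u) _ _).1.
  by move=> k; exact: sqr_ge0.
case=> [|K]; first by rewrite /seriesZ /series/= big_geq// addr_ge0// (le_trans (u0 0)) ?sumZ_term.
rewrite seriesZ_pred -addrA lerD ?sumZ_ub// lerBlDr.
by rewrite (le_trans (sumZ_term (Negz K.+1) u0 cu))// lerDl.
Qed.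

Definition bilateral_shift (f : l2Z R) : l2Z R := L2Z (shift_subproof f).

Let bilateral_shift_linear : linear bilateral_shift.
Proof. by move=> a f g; apply/val_inj/funext. Qed.

HB.instance Definition _ := GRing.isLinear.Build R[i] (l2Z R) (l2Z R) _
  bilateral_shift bilateral_shift_linear.

End shift.

Section l2Z_basis.
Variable R : realType.

Let delta (n k : int) : R[i] := (k == n)%:R.

Let seriesZ_delta n K : seriesZ (fun k => rnorm (delta n k) ^+ 2) K <= 1.
Proof.
have dE k : rnorm (delta n k) ^+ 2 = (k == n)%:R.
  by rewrite /delta sqr_rnorm; case: eqP => _ /=; rewrite !expr0n/= ?expr1n addr0.
rewrite (_ : (fun k => _) = fun k => (k == n)%:R : R); last exact/funext.
suff -> : seriesZ (fun k => (k == n)%:R : R) K =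
    (match n with Posz j | Negz j => j < K end)%N%:R.
  by case: n {dE} => j; case: (_ < _)%N; rewrite ?ler01.
elim: K => [|K]; first by rewrite /seriesZ /series/= big_geq//; case: n {dE}.
rewrite /seriesZ seriesSr/= => ->; case: n {dE} => j.
  rewrite addr0 eqz_nat ltnS [in RHS]leq_eqVlt [j == K]eq_sym.
  by have [->|] := eqVneq K j; rewrite ?ltnn ?add0r ?addr0.
rewrite add0r ltnS [in RHS]leq_eqVlt [j == K]eq_sym.
have -> : (Negz K == Negz j) = (K == j) by [].
by have [->|] := eqVneq K j; rewrite ?ltnn ?add0r ?addr0.
Qed.

Let delta_subproof n : delta n \in @sq_summable R.
Proof.
apply/asboolP; apply: (sumZ_bounded _ (seriesZ_delta n)).1 => k.
exact: sqr_ge0.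
Qed.

Definition l2Z_basis n : l2Z R := L2Z (delta_subproof n).

Lemma bilateral_shift_basis n :
  bilateral_shift (l2Z_basis n) = l2Z_basis (n + 1).
Proof. by apply/val_inj/funext => k /=; rewrite /delta subr_eq. Qed.

End l2Z_basis.

Section operator_notions.
Variable R : realType.

(* The set below is nonempty, and bounded when f is a bounded operator. *)
Definition opnorm (V W : hilbertType R) (f : V -> W) : R :=
  sup [set rnorm (f x) | x in [set x | rnorm x <= 1]].

Definition positive_op (V : hilbertType R) (f : V -> V) :=
  forall x, 0 <= inner (f x) x.

Definition unitary (V : hilbertType R) (U : V -> V) :=
  [/\ bounded_op U, cancel U (adjoint U) & cancel (adjoint U) U].

Definition isometric_embedding (V W : hilbertType R) (J : V -> W) :=
  isometry (@inner R W) (@inner R V) J.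

(* [V] is regarded as a subspace of [W] through the isometric embedding [J]. *)
Definition dilation (V W : hilbertType R) (J : V -> W) (S : W -> W) (f : V -> V) :=
  forall x, J (f x) = orthproj (range J) (S (J x)).

Definition separable (V : hilbertType R) :=
  exists2 D : set V, countable D & dense D.

Definition finite_dim (V : hilbertType R) :=
  exists n (b : 'I_n -> V), forall x, exists c : 'I_n -> R[i],
    x = \sum_(i < n) c i *: b i.

(* The library norm on matrices is the maximum of the entries, hence the explicit
   Euclidean norm on C^m and its operator norm. *)
Definition euclid_norm m (v : 'cV[R[i]]_m) : R :=
  Num.sqrt (\sum_(i < m) rnorm (v i 0) ^+ 2).

Definition mxopnorm m (A : 'M[R[i]]_m) : R :=
  sup [set euclid_norm (A *m v) | v in [set v | euclid_norm v <= 1]].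

Definition is_max (E : set R) (M : R) := E M /\ ubound E M.

End operator_notions.

Section tensor.
Variables (R : realType) (H : hilbertType R) (m : nat).

(* [H (x) C^m] is realised as the [m]-fold orthogonal sum [hpow m H]. *)
Definition tensor (x : H) (v : 'cV[R[i]]_m) : hpow m H :=
  [ffun i => v i 0 *: x].

Definition tensor_op (f : H -> H) (A : 'M[R[i]]_m) (x : hpow m H) : hpow m H :=
  [ffun i => \sum_(j < m) A i j *: f (x j)].

Lemma inner_tensor x y v w :
  inner (tensor x v) (tensor y w) = inner x y * (\sum_i v i 0 * (w i 0)^*).
Proof.
rewrite mulr_sumr; apply: eq_bigr => i _.
by rewrite !ffunE linearZl_LR linearZr_LR/= mulrA mulrC.
Qed.

Lemma tensor_op_tensor (f : {linear H -> H}) A x v :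
  tensor_op f A (tensor x v) = tensor (f x) (A *m v).
Proof.
apply/ffunP => i; rewrite !ffunE mxE scaler_suml.
by apply: eq_bigr => j _; rewrite ffunE linearZ/= scalerA.
Qed.

End tensor.

Section toeplitz.
Variables (R : realType) (H : hilbertType R) (d : nat).
Implicit Type T : 'I_d -> {linear H -> H}.

(* A [d]-tuple (T_1, ..., T_d) is indexed by ['I_d]: [T k] is T_(k+1).
   [toeplitz_coef T k] is T_k for 1 <= k <= d, and the identity for k = 0. *)
Definition toeplitz_coef T (k : 'I_d.+1) : H -> H :=
  if unlift ord0 k is Some l then T l else id.

Definition toeplitz_entry T (i j : 'I_d.+1) : H -> H :=
  if (j <= i)%N then toeplitz_coef T (inord (i - j))
  else adjoint (toeplitz_coef T (inord (j - i))).

Definition toeplitz_op T (x : hpow d.+1 H) : hpow d.+1 H :=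
  [ffun i => \sum_(j < d.+1) toeplitz_entry T i j (x j)].

Definition toeplitz_contractive T := positive_op (toeplitz_op T).

End toeplitz.

(* Main.v *)
Require Import Defs.
From HB Require Import structures.
From mathcomp Require Import all_boot all_order all_algebra.
From mathcomp Require Import cyclic cyclotomic complex zify ring lra.
From mathcomp Require separable.
From mathcomp Require Import mathcomp_extra boolp classical_sets functions.
From mathcomp Require Import cardinality reals topology normedtype sequences.
From mathcomp Require Import function_spaces derive realfun.
Set Implicit Arguments.
Unset Strict Implicit.
Unset Printing Implicit Defensive.
Import Order.TTheory GRing.Theory Num.Theory.
Import numFieldNormedType.Exports.
Local Open Scope classical_set_scope.
Local Open Scope ring_scope.

(* For (a) => (c), let A be a square root of the Toeplitz matrix on the (d+1)-fold sum
   of H.  As the matrix is constant along diagonals, A e_(i+1) x |-> A e_i x is isometric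
   on the span of the block columns, and it extends to a unitary U on the twofold sum of
   H^(d+1); with J x = (A e_d x, 0) one gets J* U^k J = T_k, in finite dimension when H is
   finite-dimensional.  Conversely a dilation gives
   <T x, x> = |sum_i U^(d-i) J x_i|^2 >= 0, and only the isometry of U matters, so that
   (d) => (a) follows in the same way by a limit.

   For (b) and (d), a discrete Fourier transform along finite orbits replaces U, up to
   factors 1 - k/L, by a diagonal unitary with roots of unity on the diagonal.  This
   reduces (b) to the norms of the matrices A_0 + sum z^k A_k, and (d) to approximating a
   diagonal unitary by compressions of the shift, with approximate eigenvectors of W
   supported in disjoint blocks.

   For (b) => (a), let S be the shift matrix and F(T) = 1/2 + sum_k T_k (x) S^k, so that
   the Toeplitz matrix is F(T) + F(T)*.  At a scalar z of modulus 1 it is positive, so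
   |t - F(z)|^2 <= t^2 + C^2 for t >= 0; by (b) the same holds for T, and t -> oo gives
   F(T) + F(T)* >= 0. *)

(** The conditions are handled through the forms [<T_k x, y> = <U^k J x, J y>]. Two obstacles shape
    the proof. An isometry between subspaces of an infinite-dimensional space need not extend to a
    unitary of that space, as the orthogonal complements of domain and range may have different
    dimensions; doubling the space gives room for an extension and preserves finite dimension.
    Secondly, the spectral theorem for [U] is replaced by a count on finitely many vectors
    [U^n J x]: a stretch of [L] indices moved by [k] overlaps itself in [L - k] places, whence the
    factor [1 - k/L], and the Fourier transform turns the move into multiplication by roots of
    unity. The same count governs the blocks of length [N] on which the shift acts almost as a
    scalar. In (b) => (a) the decisive identity is [|(t - F) x|^2 = t^2 |x|^2 - 2 t Re <F x, x> + |F
    x|^2]. At the scalars [z] the middle term has the right sign and [C] is a bound for [F(z)]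
    uniform in [z]; for [T] the last term is dropped, and only the middle one grows with [t] once
    [t^2 |x|^2] cancels. *)

Section inner_product.
Variables (R : realType) (H : hilbertType R).
Implicit Types (x y z : H) (a : R[i]).

Lemma innerDl x y z : inner (x + y) z = inner x z + inner y z.
Proof. by rewrite linearDl. Qed.

Lemma innerDr x y z : inner x (y + z) = inner x y + inner x z.
Proof. by rewrite linearDr. Qed.

Lemma innerZl a x y : inner (a *: x) y = a * inner x y.
Proof. by rewrite linearZl_LR. Qed.

Lemma innerZr a x y : inner x (a *: y) = a^* * inner x y.
Proof. by rewrite linearZr_LR. Qed.

Lemma inner0l x : inner 0 x = 0.
Proof. by rewrite linear0l. Qed.

Lemma inner0r x : inner x 0 = 0.
Proof. by rewrite linear0r. Qed.

Lemma innerNl x y : inner (- x) y = - inner x y.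
Proof. by rewrite linearNl. Qed.

Lemma innerNr x y : inner x (- y) = - inner x y.
Proof. by rewrite linearNr. Qed.

Lemma innerBl x y z : inner (x - y) z = inner x z - inner y z.
Proof. by rewrite innerDl innerNl. Qed.

Lemma innerBr x y z : inner x (y - z) = inner x y - inner x z.
Proof. by rewrite innerDr innerNr. Qed.

Lemma inner_suml (I : Type) (r : seq I) (P : pred I) (F : I -> H) y :
  inner (\sum_(i <- r | P i) F i) y = \sum_(i <- r | P i) inner (F i) y.
Proof.
by elim/big_rec2: _ => [|i u v _ <-]; rewrite ?inner0l// innerDl.
Qed.

Lemma inner_sumr (I : Type) (r : seq I) (P : pred I) (F : I -> H) y :
  inner y (\sum_(i <- r | P i) F i) = \sum_(i <- r | P i) inner y (F i).
Proof.
by elim/big_rec2: _ => [|i u v _ <-]; rewrite ?inner0r// innerDr.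
Qed.

Lemma inner_rnorm x : inner x x = (rnorm x ^+ 2)%:C%C.
Proof. by rewrite inner_normE rnormE rmorphXn. Qed.

Lemma Re_inner_rnorm x : complex.Re (inner x x) = rnorm x ^+ 2.
Proof. by rewrite inner_rnorm. Qed.

Lemma inner_inj x y : (forall z, inner x z = inner y z) -> x = y.
Proof.
move=> xy; apply/eqP; rewrite -subr_eq0 -(dnorm_eq0 (@inner R H)).
by rewrite [X in X == 0]innerBl xy subrr.
Qed.

Lemma rnorm_inner x y : rnorm (inner x y) <= rnorm x * rnorm y.
Proof. by rewrite -lecR rmorphM/= -!rnormE inner_CauchySchwarz. Qed.

Lemma Re_innerC x y : complex.Re (inner y x) = complex.Re (inner x y).
Proof. by rewrite innerC; case: (inner x y). Qed.

Lemma rnormD_sqr x y : rnorm (x + y) ^+ 2 =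
  rnorm x ^+ 2 + rnorm y ^+ 2 + 2 * complex.Re (inner x y).
Proof.
rewrite -!Re_inner_rnorm !innerDl !innerDr !raddfD/= (Re_innerC x y).
by move: (complex.Re _) (complex.Re _) (complex.Re _) => a b c; ring.
Qed.

End inner_product.

Section rnorm_theory.
Variable R : realType.

Lemma rnormZ (V : normedModType R[i]) a (x : V) : rnorm (a *: x) = rnorm a * rnorm x.
Proof. by apply/complexI; rewrite rmorphM/= -!rnormE normrZ. Qed.

Variable V : normedZmodType R[i].
Implicit Types x y : V.

Lemma rnorm0 : rnorm (0 : V) = 0.
Proof. by rewrite /rnorm normr0. Qed.

Lemma rnormN x : rnorm (- x) = rnorm x.
Proof. by rewrite /rnorm normrN. Qed.

Lemma rnorm_distC x y : rnorm (x - y) = rnorm (y - x).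
Proof. by rewrite -rnormN opprB. Qed.

Lemma rnorm_eq0 x : (rnorm x == 0) = (x == 0).
Proof. by rewrite -(inj_eq (@complexI R)) -rnormE normr_eq0. Qed.

Lemma ler_rnorm_sum (I : Type) (r : seq I) (P : pred I) (F : I -> V) :
  rnorm (\sum_(i <- r | P i) F i) <= \sum_(i <- r | P i) rnorm (F i).
Proof.
elim/big_rec2: _ => [|i u v _ h]; first by rewrite rnorm0.
by apply: le_trans (ler_rnormD _ _) _; rewrite lerD2l.
Qed.

Lemma ler_rnormB x y : rnorm (x - y) <= rnorm x + rnorm y.
Proof. by rewrite -(rnormN y) ler_rnormD. Qed.

End rnorm_theory.

Section rnorm_complex.
Variable R : realType.
Implicit Types (a b : R[i]) (t : R).

Lemma rnorm_real t : rnorm (t%:C%C : R[i]) = `|t|.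
Proof.
apply/eqP; rewrite -(@eqrXn2 _ 2)// ?rnorm_ge0// real_normK ?num_real//.
by rewrite sqr_rnorm/= expr0n addr0.
Qed.

Lemma rnormX a n : rnorm (a ^+ n) = rnorm a ^+ n.
Proof. by apply/complexI; rewrite rmorphXn/= -!rnormE normrX. Qed.

Lemma conjC_real t : (t%:C%C : R[i])^* = t%:C%C.
Proof. by apply/CrealP; rewrite complex_real. Qed.

Lemma Re_realM t a : complex.Re (t%:C%C * a) = t * complex.Re a.
Proof. by case: a => u v /=; rewrite mul0r subr0. Qed.

End rnorm_complex.

(** * Bounded operators, limits and finite direct sums *)

Section bounded_operators.
Variables (R : realType) (V W : hilbertType R).

Lemma bounded_opP (f : {linear V -> W}) :
  bounded_op f <-> exists2 c : R, 0 <= c & forall x, rnorm (f x) <= c * rnorm x.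
Proof.
split=> [/linear_boundedP fb|[c c0 fc]].
  have [r [r0 fr]] := pinfty_ex_gt0 fb.
  have rE : r = (complex.Re r)%:C%C by rewrite RRe_real// gtr0_real.
  exists (complex.Re r); first by rewrite -lecR -rE ltW.
  by move=> x; rewrite -lecR rmorphM/= -!rnormE -rE fr.
apply/linear_boundedP.
apply: filterS (nbhs_pinfty_ge (_ : c%:C%C \is Num.real)).
  move=> r cr x; apply: le_trans (_ : c%:C%C * `|x| <= _).
    by rewrite !rnormE -rmorphM/= lecR.
  by rewrite ler_wpM2r.
by rewrite complex_real.
Qed.

Lemma le_opnorm (f : {linear V -> W}) x :
  bounded_op f -> rnorm (f x) <= opnorm f * rnorm x.
Proof.
move=> /bounded_opP[c c0 fc].
have ub : has_ubound [set rnorm (f x) | x in [set x : V | rnorm x <= 1]].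
  by exists c => _ [y /= y1 <-]; apply: le_trans (fc y) _; rewrite ler_piMr.
have [->|x0] := eqVneq x 0; first by rewrite linear0 !rnorm0 mulr0.
have xn : 0 < rnorm x by rewrite lt_def rnorm_eq0 x0 rnorm_ge0.
rewrite -ler_pdivrMr//; apply: ub_le_sup => //.
exists ((rnorm x)^-1%:C%C *: x).
  by rewrite /= rnormZ rnorm_real ger0_norm ?invr_ge0 ?rnorm_ge0// mulVf// gt_eqF.
by rewrite linearZ/= rnormZ rnorm_real ger0_norm ?invr_ge0 ?rnorm_ge0// mulrC.
Qed.

Lemma opnorm_le (f : {linear V -> W}) (c : R) : 0 <= c ->
  (forall x, rnorm (f x) <= c * rnorm x) -> opnorm f <= c.
Proof.
move=> c0 fc; apply: ge_sup.
  by exists (rnorm (f 0)), 0 => //=; rewrite rnorm0.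
by move=> _ [y /= y1 <-]; apply: le_trans (fc y) _; rewrite ler_piMr.
Qed.

Lemma isometric_rnorm (J : {linear V -> W}) x :
  isometric_embedding J -> rnorm (J x) = rnorm x.
Proof.
move=> Ji; apply/eqP; rewrite -(@eqrXn2 _ 2) ?rnorm_ge0//.
by rewrite -!Re_inner_rnorm Ji.
Qed.

Lemma isometric_bounded (J : {linear V -> W}) :
  isometric_embedding J -> bounded_op J.
Proof.
move=> Ji; apply/bounded_opP; exists 1 => // x.
by rewrite mul1r isometric_rnorm.
Qed.

End bounded_operators.

Section hilbert_limits.
Variables (R : realType).

Lemma cvgn_rnormP (V : normedModType R[i]) (u : nat -> V) (l : V) :
  u @ \oo --> l <->
  forall e : R, 0 < e -> exists N, forall n, (N <= n)%N -> rnorm (u n - l) < e.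
Proof.
split=> [/cvgrPdist_lt ul e e0|ul].
  have [|N _ HN] := ul e%:C%C; first by rewrite ltcR.
  by exists N => n Nn; have := HN n Nn; rewrite /= distrC rnormE ltcR.
apply/cvgrPdist_lt => e e0.
have [r [-> r0]] : exists r : R, e = r%:C%C /\ 0 < r.
  by case: e e0 => a b; rewrite ltcE/= => /andP[/eqP -> ?]; exists a.
by have [N HN] := ul _ r0; exists N => // n /= Nn; rewrite distrC rnormE ltcR HN.
Qed.

Lemma cvgn_rnorm (V : normedModType R[i]) (u : nat -> V) (l : V) :
  u @ \oo --> l -> rnorm (u n) @[n --> \oo] --> rnorm l.
Proof.
move=> /cvgn_rnormP ul; apply/cvgrPdist_lt => e /ul[N HN]; exists N => // n /= Nn.
apply: le_lt_trans (HN _ Nn).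
have := ler_rnormD (u n - l) l; have := ler_rnormD (l - u n) (u n).
rewrite !subrK (rnorm_distC l) ler_norml.
by move: (rnorm _) (rnorm _) (rnorm _) => a b c; lra.
Qed.

Lemma cvgn_inner (H : hilbertType R) (u v : nat -> H) (x y : H) :
  u @ \oo --> x -> v @ \oo --> y -> inner (u n) (v n) @[n --> \oo] --> inner x y.
Proof.
move=> ux vy; apply/cvgn_rnormP => e e0.
have /cvgrPdist_lt : (rnorm (u n - x) * rnorm (v n) + rnorm x * rnorm (v n - y))
    @[n --> \oo] --> (rnorm (x - x) * rnorm y + rnorm x * rnorm (y - y)).
  apply: cvgD; apply: cvgM; try exact: cvg_cst.
  - by apply: (@cvgn_rnorm H (fun n => u n - x)); apply: cvgB => //; exact: cvg_cst.
  - exact: (@cvgn_rnorm H v).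
  - by apply: (@cvgn_rnorm H (fun n => v n - y)); apply: cvgB => //; exact: cvg_cst.
move=> /(_ e e0)[N _ HN]; exists N => n Nn; have := HN n Nn.
rewrite /= !subrr !rnorm0 mul0r mulr0 addr0 sub0r normrN.
apply: le_lt_trans; apply: le_trans (ler_norm _).
have -> : inner (u n) (v n) - inner x y = inner (u n - x) (v n) + inner x (v n - y).
  by rewrite innerBl innerBr addrA subrK.
by apply: le_trans (ler_rnormD _ _) _; apply: lerD; exact: rnorm_inner.
Qed.

Lemma cvgn_bounded_op (V W : hilbertType R) (f : {linear V -> W}) (u : nat -> V) l :
  bounded_op f -> u @ \oo --> l -> f (u n) @[n --> \oo] --> f l.
Proof.
move=> /bounded_opP[c c0 fc] /cvgn_rnormP ul; apply/cvgn_rnormP => e e0.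
have c1 : 0 < c + 1 by rewrite ltr_wpDl.
have [|N HN] := ul (e / (c + 1)); first by rewrite divr_gt0.
exists N => n Nn; rewrite -linearB; apply: le_lt_trans (fc _) _.
apply: (@le_lt_trans _ _ ((c + 1) * rnorm (u n - l))).
  by rewrite ler_wpM2r ?rnorm_ge0// lerDl.
by rewrite mulrC -ltr_pdivlMr// HN.
Qed.

Lemma cvgn_unique (V : normedModType R[i]) (u : nat -> V) (x y : V) :
  u @ \oo --> x -> u @ \oo --> y -> x = y.
Proof. by move=> ux uy; apply: (cvg_unique _ ux uy); exact: norm_hausdorff. Qed.

(** The domination is by squares because Pythagoras gives exactly this for partial sums of
    orthogonal series, as in [v_cvg]. *)
Lemma cvgn_dominated (H : hilbertType R) (u : nat -> H) (s : nat -> R) :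
  cvgn s -> (forall m n, (m <= n)%N -> rnorm (u n - u m) ^+ 2 <= s n - s m) ->
  exists l : H, u @ \oo --> l.
Proof.
move=> cs us.
have [] := @inner_complete _ _ u.
  move=> e e0.
  have e2 : 0 < e / 2 by rewrite divr_gt0.
  move: (cs) => /cvg_ex[l /cvgrPdist_lt/(_ _ e2)[N _ HN]].
  exists N => m n; wlog mn : m n / (m <= n)%N.
    move=> h Nm Nn; have [mn|/ltnW nm] := leqP m n; first exact: h.
    by rewrite Re_inner_rnorm rnorm_distC -Re_inner_rnorm; exact: h.
  move=> Nm Nn; rewrite Re_inner_rnorm rnorm_distC; apply: le_lt_trans (us _ _ mn) _.
  have := HN _ Nm; have := HN _ Nn => /=.
  by rewrite !ltr_norml; lra.
move=> l ul; exists l; apply/cvgn_rnormP => e e0.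
have [|N HN] := ul (e ^+ 2); first by rewrite exprn_gt0.
exists N => n Nn; have := HN n Nn; rewrite Re_inner_rnorm.
by rewrite ltr_pXn2r ?nnegrE ?rnorm_ge0// ltW.
Qed.

End hilbert_limits.

Section hpow_theory.
Variables (R : realType) (H : hilbertType R) (n : nat).
Implicit Types x y : hpow n H.

Lemma inner_hpow x y : inner x y = \sum_(i < n) inner (x i) (y i).
Proof. by []. Qed.

Lemma rnorm_hpow x : rnorm x ^+ 2 = \sum_(i < n) rnorm (x i) ^+ 2.
Proof.
rewrite -Re_inner_rnorm inner_hpow raddf_sum.
by apply: eq_bigr => i _; rewrite -Re_inner_rnorm.
Qed.

Lemma le_rnorm_coord x i : rnorm (x i) <= rnorm x.
Proof.
rewrite -(@ler_pXn2r _ 2)// ?nnegrE ?rnorm_ge0// rnorm_hpow (bigD1 i)//=.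
by rewrite lerDl sumr_ge0// => j _; rewrite sqr_ge0.
Qed.

Lemma hpowD x y i : (x + y) i = x i + y i.
Proof. by rewrite ffunE. Qed.

Lemma hpowZ (a : R[i]) x i : (a *: x) i = a *: x i.
Proof. by rewrite ffunE. Qed.

Lemma hpow_sum (I : Type) (r : seq I) (P : pred I) (F : I -> hpow n H) i :
  (\sum_(k <- r | P k) F k) i = \sum_(k <- r | P k) F k i.
Proof. by elim/big_rec2: _ => [|k u v _ <-]; rewrite ffunE. Qed.

Lemma ler_rnorm_hpow x : rnorm x <= \sum_(i < n) rnorm (x i).
Proof.
have s0 : 0 <= \sum_(i < n) rnorm (x i) by rewrite sumr_ge0// => i _; exact: rnorm_ge0.
rewrite -(@ler_pXn2r _ 2)// ?nnegrE ?rnorm_ge0// rnorm_hpow expr2 mulr_suml.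
apply: ler_sum => i _; rewrite expr2 ler_wpM2l ?rnorm_ge0// (bigD1 i)//=.
by rewrite lerDl sumr_ge0// => j _; exact: rnorm_ge0.
Qed.

End hpow_theory.

Section linear_of.
Variables (R : realType) (V W : hilbertType R) (f : V -> W) (fL : linear f).

(** The dummy [let] keeps the proof of linearity as a parameter, so that a canonical linear
    structure can be attached to the function. *)
Definition linear_of : V -> W := let _ := fL in f.

Let linear_of_linear : linear linear_of. Proof. exact: fL. Qed.

HB.instance Definition _ := GRing.isLinear.Build R[i] V W _ linear_of linear_of_linear.

End linear_of.

(** * Square roots of positive operators *)

Section positive_operators.
Variables (R : realType) (H : hilbertType R) (f : {linear H -> H}).

(** Polarisation: the form is real at [x], [y], [x + y] and [x + i y], which fixes the imaginary and
    real parts of [<f x, y> - <x, f y>]. *)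
Lemma positive_op_selfadjoint : positive_op f ->
  forall x y, inner (f x) y = inner x (f y).
Proof.
move=> fp x y; rewrite [RHS]innerC.
have im z : complex.Im (inner (f z) z) = 0.
  by have := fp z; rewrite lecE => /andP[/eqP].
have := im (x + y); have := im (x + 'i%C *: y).
rewrite !(linearD f) (linearZ_LR f) !innerDl !innerDr !innerZl !innerZr !raddfD/=.
have [ix iy] := (im x, im y).
move: ix iy; case: (inner (f x) x) => a b /= ->.
case: (inner (f y) y) => c e /= ->.
case: (inner (f x) y) => p q; case: (inner (f y) x) => r s /=.
by move=> h1 h2; congr (_ +i* _)%C; lra.
Qed.

(** This is [f^2 <= c f]. Expand positivity at [x - f x / c] and bound [<f (f x), f x>] by
    [c |f x|^2]. *)
Lemma positive_op_sqr (c : R) : positive_op f -> 0 < c ->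
  (forall x, rnorm (f x) <= c * rnorm x) ->
  forall x, rnorm (f x) ^+ 2 <= c * complex.Re (inner (f x) x).
Proof.
move=> fp c0 fc x.
have fsa := positive_op_selfadjoint fp.
have := fp (x - (c^-1)%:C%C *: f x); rewrite lecE => /andP[_].
rewrite (linearB f) (linearZ_LR f) innerBl !innerBr !innerZl !innerZr.
rewrite (fsa (f x) x) conjC_real !raddfB/= !Re_realM Re_inner_rnorm.
have : complex.Re (inner (f (f x)) (f x)) <= c * rnorm (f x) ^+ 2.
  apply: le_trans (ler_norm _) _; apply: le_trans (norm_Re_rnorm _) _.
  by apply: le_trans (rnorm_inner _ _) _; rewrite expr2 mulrA ler_wpM2r ?rnorm_ge0.
move: (complex.Re _) (rnorm _ ^+ 2) => v w h.
have : c^-1 * (c^-1 * v) <= c^-1 * w by rewrite ler_pM2l ?invr_gt0// ler_pdivrMl.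
by move: (complex.Re _) => u h1 h2; rewrite -ler_pdivrMl//; lra.
Qed.

End positive_operators.

Section square_root.
Variables (R : realType) (H : hilbertType R) (B : {linear H -> H}).
Hypotheses (B_le1 : forall x, rnorm (B x) <= rnorm x)
  (B_sa : forall x y, inner (B x) y = inner x (B y)).

(* For Y = 1 - sqrt (1 - B), the fixed point equation is Y = (B + Y ^ 2) / 2. *)
Fixpoint sqrt_iter n (x : H) : H :=
  if n is k.+1 then (2^-1)%:C%C *: (B x + sqrt_iter k (sqrt_iter k x)) else 0.

(* The same recursion in the extremal scalar case B = 1. *)
Fixpoint sqrt_bound n : R :=
  if n is k.+1 then 2^-1 * (1 + sqrt_bound k ^+ 2) else 0.

Lemma sqrt_bound_itv n : 0 <= sqrt_bound n <= 1.
Proof.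
elim: n => [|n /andP[a0 a1]] /=; first by rewrite lexx ler01.
by apply/andP; split; nra.
Qed.

Lemma sqrt_iter_linear n : linear (sqrt_iter n).
Proof.
elim: n => [|n IH] a x y /=; first by rewrite scaler0 addr0.
by rewrite !IH linearP !scalerDr !scalerA [_ * a]mulrC -!addrA; congr +%R;
  rewrite addrCA.
Qed.

Lemma sqrt_iterB n x y : sqrt_iter n (x - y) = sqrt_iter n x - sqrt_iter n y.
Proof. by rewrite -scaleN1r addrC sqrt_iter_linear scaleN1r addrC. Qed.

Lemma sqrt_iter_le n x : rnorm (sqrt_iter n x) <= sqrt_bound n * rnorm x.
Proof.
elim: n x => [|n IH] x /=; first by rewrite rnorm0 mul0r.
have /andP[a0 a1] := sqrt_bound_itv n.
rewrite rnormZ rnorm_real ger0_norm ?invr_ge0// -mulrA ler_pM2l ?invr_gt0//.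
apply: le_trans (ler_rnormD _ _) _; rewrite mulrDl mul1r lerD//.
apply: le_trans (IH _) _; rewrite expr2 -mulrA ler_wpM2l//.
Qed.

Lemma sqrt_iter_le1 n x : rnorm (sqrt_iter n x) <= rnorm x.
Proof.
apply: le_trans (sqrt_iter_le _ _) _; have /andP[a0 a1] := sqrt_bound_itv n.
by rewrite ler_piMl ?rnorm_ge0.
Qed.

(** Write [Y_n] for the iterates. [Y_(n+1)^2 - Y_n^2 = Y_(n+1) (Y_(n+1) - Y_n) + (Y_(n+1) - Y_n)
    Y_n], and the scalar bounds satisfy the same identity, so they majorise the operator
    increments. *)
Lemma sqrt_iter_step n x : rnorm (sqrt_iter n.+1 x - sqrt_iter n x) <=
  (sqrt_bound n.+1 - sqrt_bound n) * rnorm x.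
Proof.
elim: n x => [|n IH] x.
  rewrite /= subr0 addr0 subr0 expr0n/= addr0 mulr1 rnormZ rnorm_real.
  by rewrite ger0_norm ?invr_ge0// ler_pM2l ?invr_gt0.
have -> : sqrt_iter n.+2 x - sqrt_iter n.+1 x = (2^-1)%:C%C *:
    (sqrt_iter n.+1 (sqrt_iter n.+1 x - sqrt_iter n x) +
     (sqrt_iter n.+1 (sqrt_iter n x) - sqrt_iter n (sqrt_iter n x))).
  rewrite sqrt_iterB addrA subrK.
  rewrite {1}[sqrt_iter n.+2]/= -/sqrt_iter {2}[sqrt_iter n.+1]/= -scalerBr.
  by congr (_ *: _); rewrite opprD addrACA subrr add0r.
set a := sqrt_bound n; set b := sqrt_bound n.+1.
have -> : sqrt_bound n.+2 - b = 2^-1 * (b * (b - a) + (b - a) * a).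
  have bE : b = 2^-1 * (1 + a ^+ 2) by [].
  have -> : sqrt_bound n.+2 = 2^-1 * (1 + b ^+ 2) by [].
  by move: bE; move: a b => a b; lra.
rewrite rnormZ rnorm_real ger0_norm ?invr_ge0// -[leRHS]mulrA ler_pM2l ?invr_gt0//.
apply: le_trans (ler_rnormD _ _) _; rewrite mulrDl lerD//.
  apply: le_trans (sqrt_iter_le _ _) _; rewrite -mulrA ler_wpM2l// ?IH//.
  by have /andP[] := sqrt_bound_itv n.+1.
have ba : 0 <= b - a by rewrite /b /= -/a; have := sqr_ge0 (a - 1); nra.
apply: le_trans (IH _) _; rewrite -mulrA ler_wpM2l//; exact: sqrt_iter_le.
Qed.

Lemma sqrt_bound_ndecr m n : (m <= n)%N -> sqrt_bound m <= sqrt_bound n.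
Proof.
move=> /subnK <-; elim: (n - m)%N => // k IH; rewrite addSn; apply: le_trans IH _.
by move: (_ + _)%N => j /=; have := sqr_ge0 (sqrt_bound j - 1); nra.
Qed.

Lemma sqrt_iter_dist m n x : (m <= n)%N -> rnorm (sqrt_iter n x - sqrt_iter m x) <=
  (sqrt_bound n - sqrt_bound m) * rnorm x.
Proof.
move=> /subnK <-; elim: (n - m)%N => [|k IH]; first by rewrite !subrr rnorm0 mul0r.
rewrite addSn; move: (k + m)%N IH => j IH.
rewrite -(subrK (sqrt_iter j x) (sqrt_iter j.+1 x)) -addrA.
rewrite -(subrK (sqrt_bound j) (sqrt_bound j.+1)) -[_ - _ + _ - _]addrA mulrDl.
by apply: le_trans (ler_rnormD _ _) _; apply: lerD => //; exact: sqrt_iter_step.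
Qed.

Lemma sqrt_iter_sa n x y : inner (sqrt_iter n x) y = inner x (sqrt_iter n y).
Proof.
elim: n x y => [|n IH] x y /=; first by rewrite inner0l inner0r.
by rewrite innerZl innerZr conjC_real innerDl innerDr B_sa !IH.
Qed.

Lemma sqrt_iter_cvg x : exists l : H, sqrt_iter n x @[n --> \oo] --> l.
Proof.
(* The squared estimate follows from [(b - a)^2 <= b - a] for [0 <= a <= b <= 1]. *)
apply: (@cvgn_dominated _ _ _ (fun n => rnorm x ^+ 2 * sqrt_bound n)).
  apply: is_cvgM; first exact: is_cvg_cst.
  apply: nondecreasing_is_cvgn; first by move=> m n; exact: sqrt_bound_ndecr.
  by exists 1 => _ [n _ <-]; have /andP[] := sqrt_bound_itv n.
move=> m n mn; rewrite -mulrBr.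
have ab := sqrt_bound_ndecr mn.
have /andP[a0 _] := sqrt_bound_itv m; have /andP[_ b1] := sqrt_bound_itv n.
apply: (@le_trans _ _ (((sqrt_bound n - sqrt_bound m) * rnorm x) ^+ 2)).
  rewrite ler_pXn2r ?nnegrE ?rnorm_ge0 ?mulr_ge0 ?rnorm_ge0 ?subr_ge0//.
  exact: sqrt_iter_dist.
rewrite exprMn mulrC ler_wpM2l ?sqr_ge0//.
by move: ab a0 b1; move: (sqrt_bound n) (sqrt_bound m) => a b; nra.
Qed.

Lemma sqrt_fixpoint : exists Y : {linear H -> H},
  [/\ forall x, rnorm (Y x) <= rnorm x,
      forall x y, inner (Y x) y = inner x (Y y) &
      forall x, Y x = (2^-1)%:C%C *: (B x + Y (Y x))].
Proof.
have [Y Ylim] := choice sqrt_iter_cvg.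
have Ylin : linear Y.
  move=> a x y; apply: (cvgn_unique (Ylim _)).
  rewrite (_ : (fun n => _) = (fun n => a *: sqrt_iter n x + sqrt_iter n y)).
    by apply: cvgD => //; apply: cvgZ => //; exact: cvg_cst.
  by apply/funext => n; rewrite sqrt_iter_linear.
have Yle x : rnorm (Y x) <= rnorm x.
  have := cvgn_rnorm (Ylim x) => cv.
  rewrite -(cvg_lim _ cv)//; apply: limr_le; first by apply/cvg_ex; eexists; exact: cv.
  by apply: nearW => n; exact: sqrt_iter_le1.
exists (linear_of Ylin); split => //.
- move=> x y; apply: (@cvgn_unique _ _ (fun n => inner (sqrt_iter n x) y)).
    by apply: cvgn_inner => //; exact: cvg_cst.
  rewrite (_ : (fun n => _) = (fun n => inner x (sqrt_iter n y))).
    by apply: cvgn_inner => //; exact: cvg_cst.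
  by apply/funext => n; rewrite sqrt_iter_sa.
- move=> x; rewrite /linear_of; apply: (@cvgn_unique _ _ (fun n => sqrt_iter n.+1 x)).
    by have := Ylim x; rewrite -(cvg_shiftS (fun n => sqrt_iter n x)).
  apply: cvgZ; first exact: cvg_cst.
  apply: cvgD; first exact: cvg_cst.
  (* Pointwise limits pass to the composite because the iterates are contractions: the error is at
     most [|Y_n x - Y x| + |Y_n (Y x) - Y (Y x)|]. *)
  apply/cvgn_rnormP => e e0; have e2 : 0 < e / 2 by rewrite divr_gt0.
  have /cvgn_rnormP/(_ _ e2)[N1 HN1] := Ylim x.
  have /cvgn_rnormP/(_ _ e2)[N2 HN2] := Ylim (Y x).
  exists (maxn N1 N2) => n; rewrite geq_max => /andP[n1 n2].
  change (rnorm (sqrt_iter n (sqrt_iter n x) - Y (Y x)) < e).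
  rewrite -(subrK (sqrt_iter n (Y x)) (sqrt_iter n (sqrt_iter n x))) -addrA.
  apply: le_lt_trans (ler_rnormD _ _) _; rewrite [e]splitr; apply: ltrD; last exact: HN2.
  by rewrite -sqrt_iterB; apply: le_lt_trans (sqrt_iter_le1 _ _) (HN1 _ n1).
Qed.

End square_root.

(** For [B = 1 - f / c] the fixed point [Y] satisfies [(1 - Y)^2 = 1 - B = f / c], so the
    self-adjoint operator [A = sqrt c (1 - Y)] has square [f]. That [B] is a contraction is
    [positive_op_sqr]. *)
Lemma positive_op_factor (R : realType) (H : hilbertType R) (f : {linear H -> H}) :
  bounded_op f -> positive_op f ->
  exists A : {linear H -> H}, forall x y, inner (A x) (A y) = inner (f x) y.
Proof.
move=> /bounded_opP[c0 c0_ge0 fc0] fp; pose c := c0 + 1.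
have c_gt0 : 0 < c by rewrite ltr_wpDl.
have fc x : rnorm (f x) <= c * rnorm x.
  by apply: le_trans (fc0 x) _; rewrite ler_wpM2r ?rnorm_ge0// lerDl.
have fsa := positive_op_selfadjoint fp.
pose B0 x := x - (c^-1)%:C%C *: f x.
have Blin : linear B0.
  move=> a x y; rewrite /B0 (linearP f) !scalerDr !scalerN opprD addrACA !scalerA.
  by rewrite [_ * a]mulrC.
have [] := @sqrt_fixpoint _ _ (linear_of Blin).
- move=> x; rewrite /linear_of/= /B0 -(@ler_pXn2r _ 2)// ?nnegrE ?rnorm_ge0//.
  rewrite rnormD_sqr rnormN innerNr innerZr conjC_real raddfN/= Re_realM.
  rewrite rnormZ rnorm_real ger0_norm ?invr_ge0 ?(ltW c_gt0)//.
  have -> : complex.Re (inner x (f x)) = complex.Re (inner (f x) x) by rewrite fsa.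
  have := positive_op_sqr fp c_gt0 fc x.
  have : 0 <= complex.Re (inner (f x) x) by have := fp x; rewrite lecE => /andP[].
  rewrite exprMn; move: (complex.Re _) (rnorm (f x) ^+ 2) => u w u0 uw.
  have : c^-1 ^+ 2 * w <= c^-1 * u.
    by rewrite expr2 -mulrA ler_pM2l ?invr_gt0// ler_pdivrMl.
  have : 0 <= c^-1 * u by rewrite mulr_ge0// invr_ge0 ltW.
  by move: (c^-1 ^+ 2 * w) (c^-1 * u) (rnorm x ^+ 2) => p q r; lra.
- by move=> x y; rewrite /linear_of/= /B0 innerBl innerBr innerZl innerZr conjC_real fsa.
move=> Y [Yle Ysa Yfix].
pose s := Num.sqrt c.
pose A0 x := s%:C%C *: (x - Y x).
have Alin : linear A0.
  move=> a x y; rewrite /A0 (linearP Y) opprD addrACA -scalerBr scalerDr !scalerA.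
  by rewrite [_ * a]mulrC.
exists (linear_of Alin) => x y; rewrite /linear_of/= /A0 innerZl innerZr conjC_real.
have -> : inner (x - Y x) (y - Y y) = inner ((x - Y x) - (Y x - Y (Y x))) y.
  by rewrite -!linearB/= innerBr -Ysa -innerBl linearB.
have -> : (x - Y x) - (Y x - Y (Y x)) = (c^-1)%:C%C *: f x.
  have h : Y x + Y x = B0 x + Y (Y x).
    rewrite -[Y x]scale1r -scalerDl [Y x in LHS]Yfix scalerA.
    rewrite (_ : (1 + 1) * _ = 1) ?scale1r//.
    by rewrite fmorphV/= rmorph_nat -[1 + 1]/(2%:R) mulfV ?pnatr_eq0.
  rewrite opprB [Y (Y x) - _]addrC addrA -(addrA x) -opprD h opprD addrA subrK.
  by rewrite /B0 opprB addrCA subrr addr0.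
rewrite innerZl mulrA mulrA -rmorphM -rmorphM/= -expr2 sqr_sqrtr ?(ltW c_gt0)//.
by rewrite mulfV ?gt_eqF// mul1r.
Qed.

(** * Orthogonal projections and adjoints *)

Section orthogonal_projection.
Variables (R : realType) (H : hilbertType R) (M : set H).
Hypotheses (M0 : M 0) (MP : forall a x y, M x -> M y -> M (a *: x + y)).

(** The projection maps into limits of sequences of [M]; a minimising sequence for the distance to
    [M] has its limit here by construction. *)
Let seq_closure : set H := [set l | exists2 u : nat -> H,
  (forall n, M (u n)) & u @ \oo --> l].

Let is_proj x l := seq_closure l /\ forall m, M m -> inner (x - l) m = 0.

Let closureP a x y : seq_closure x -> seq_closure y -> seq_closure (a *: x + y).
Proof.
move=> [u uM ux] [v vM vy]; exists (fun n => a *: u n + v n); first by move=> n; exact: MP.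
by apply: cvgD => //; apply: cvgZ => //; exact: cvg_cst.
Qed.

Let closure_ortho x l c : is_proj x l -> seq_closure c -> inner (x - l) c = 0.
Proof.
move=> [_ xl] [u uM uc]; apply: (@cvgn_unique _ _ (fun n => inner (x - l) (u n))).
  by apply: cvgn_inner => //; exact: cvg_cst.
by rewrite (_ : (fun n => _) = fun=> 0); [exact: cvg_cst|apply/funext => n; exact: xl].
Qed.

Let MZ a x : M x -> M (a *: x).
Proof. by move=> Mx; rewrite -[_ *: _]addr0; exact: MP. Qed.

Let minimal_ortho (h : H) : (forall m, M m -> rnorm h ^+ 2 <= rnorm (h - m) ^+ 2) ->
  forall m, M m -> inner h m = 0.
Proof.
move=> hmin.
suff re0 m : M m -> complex.Re (inner h m) = 0.
  move=> m Mm; have := re0 _ Mm; have := re0 _ (MZ 'i%C Mm).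
  rewrite innerZr; case: (inner h m) => a b /= h1 h2.
  by apply/eqP; rewrite eq_complex /=; apply/andP; split; apply/eqP; lra.
move=> Mm; set p := complex.Re _.
(* The best step is [p / |m|^2]; the added 1 avoids a division by zero and still decreases the
   distance strictly unless [p = 0]. *)
pose s := p / (rnorm m ^+ 2 + 1).
have := hmin _ (MZ s%:C%C Mm).
rewrite rnormD_sqr rnormN rnormZ innerNr innerZr conjC_real raddfN/= Re_realM -/p.
rewrite rnorm_real exprMn real_normK ?num_real// /s.
have := sqr_ge0 (rnorm m); move: (rnorm m ^+ 2) (rnorm h ^+ 2) => q r q0.
have q1 : 0 < q + 1 by rewrite ltr_wpDl.
rewrite -subr_ge0.
have -> : r + (p / (q + 1)) ^+ 2 * q + 2 * - (p / (q + 1) * p) - r =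
    - (p ^+ 2 * (q + 2) / (q + 1) ^+ 2) by field; rewrite gt_eqF.
rewrite oppr_ge0 pmulr_lle0 ?invr_gt0 ?exprn_gt0// pmulr_lle0 ?ltr_wpDl// => p2.
by apply/eqP; rewrite -sqrf_eq0 eq_le p2 sqr_ge0.
Qed.

Let proj_ex x : exists l, is_proj x l.
Proof.
pose E := [set rnorm (x - m) ^+ 2 | m in M].
have hi : has_inf E.
  by split; [exists (rnorm (x - 0) ^+ 2), 0|exists 0 => _ [m _ <-]; exact: sqr_ge0].
pose d := inf E.
have d_le m : M m -> d <= rnorm (x - m) ^+ 2.
  by move=> Mm; apply: ge_inf; [case: hi|exists m].
have /choice[u uP] : forall n, exists m, M m /\ rnorm (x - m) ^+ 2 < d + n.+1%:R^-1.
  move=> n; have [|_ [m Mm <-] ?] := @inf_adherent _ E n.+1%:R^-1 _ hi.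
    by rewrite invr_gt0.
  by exists m.
have uM n : M (u n) by case: (uP n).
have small (e : R) : 0 < e -> exists N, forall n, (N <= n)%N -> n.+1%:R^-1 < e.
  move=> e0; exists (Num.truncn e^-1) => n Nn.
  rewrite invf_plt ?posrE//.
  by apply: lt_le_trans (truncnS_gt _) _; rewrite ler_nat ltnS.
have [] := @inner_complete _ _ u.
  move=> e e0; have [|N HN] := small (e / 4); first by rewrite divr_gt0.
  exists N => k n Nk Nn; rewrite Re_inner_rnorm.
  have Mw : M ((2^-1)%:C%C *: (u k + u n)).
    by apply: MZ; rewrite -[u k]scale1r; exact: MP.
  (* Parallelogram law: the midpoint of [u k] and [u n] lies in [M], so its distance to [x] is
     bounded below by the infimum. *)
  have : rnorm (u k - u n) ^+ 2 + 4 * rnorm (x - (2^-1)%:C%C *: (u k + u n)) ^+ 2 =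
      2 * rnorm (x - u k) ^+ 2 + 2 * rnorm (x - u n) ^+ 2.
    set a := x - u k; set b := x - u n.
    have -> : u k - u n = b - a by rewrite /a /b opprB [RHS]addrC subrKA.
    have -> : x - (2^-1)%:C%C *: (u k + u n) = (2^-1)%:C%C *: (a + b).
      rewrite /a /b addrACA -opprD scalerBr -(mulr2n x).
      rewrite -[x *+ 2](@scaler_nat R[i] H) scalerA.
      by rewrite fmorphV/= rmorph_nat mulVf ?scale1r// pnatr_eq0.
    clearbody a b; rewrite rnormZ rnorm_real exprMn !rnormD_sqr rnormN innerNr raddfN/=.
    rewrite ger0_norm ?invr_ge0//.
    by rewrite (Re_innerC a b); move: (_ ^+ 2) (_ ^+ 2) (complex.Re _) => p q r; field.
  have [_ ] := uP k; have [_ ] := uP n.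
  have := d_le _ Mw; have := HN _ Nk; have := HN _ Nn.
  by move: (n.+1%:R^-1) (k.+1%:R^-1) (_ ^+ 2) (_ ^+ 2) (_ ^+ 2) (_ ^+ 2) => *; lra.
move=> l ul0; have ul : u @ \oo --> l.
  apply/cvgn_rnormP => e e0; have [|N HN] := ul0 (e ^+ 2); first by rewrite exprn_gt0.
  exists N => n Nn; have := HN n Nn; rewrite Re_inner_rnorm.
  by rewrite ltr_pXn2r ?nnegrE ?rnorm_ge0// ltW.
exists l; split; first by exists u.
have dist (m : H) : rnorm (x - (u n + m)) ^+ 2 @[n --> \oo] --> rnorm (x - (l + m)) ^+ 2.
  rewrite expr2; under eq_fun do rewrite expr2.
  by apply: cvgM; apply: (@cvgn_rnorm _ _ (fun n => x - (u n + m)));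
    apply: cvgB; (try exact: cvg_cst); apply: cvgD => //; exact: cvg_cst.
(* [l] may lie outside [M], but [u n + m] lies in [M], so the lower bound survives in the limit and
   [l] is minimal among its translates by [M]. *)
have dl m : M m -> d <= rnorm (x - (l + m)) ^+ 2.
  move=> Mm; rewrite -(cvg_lim _ (dist m))//.
  apply: limr_ge; first by apply/cvg_ex; eexists; exact: dist.
  by apply: nearW => n; apply: d_le; rewrite -[u n]scale1r; exact: MP.
have ld : rnorm (x - l) ^+ 2 <= d.
  have c0 := dist 0; rewrite addr0 in c0.
  have d1 : d + harmonic n @[n --> \oo] --> d + 0.
    by apply: cvgD; [exact: cvg_cst|exact: cvg_harmonic].
  rewrite -[leRHS]addr0; apply: ler_cvg_to c0 d1 _.
  by apply: nearW => n; rewrite addr0 ltW//; case: (uP n).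
apply: minimal_ortho => m Mm; apply: le_trans ld _.
by have := dl _ Mm; rewrite opprD addrA.
Qed.

Let proj_uniq x l l' : is_proj x l -> is_proj x l' -> l = l'.
Proof.
move=> xl xl'; apply/eqP; rewrite -subr_eq0 -(dnorm_eq0 (@inner R H)).
have cll : seq_closure (l - l').
  by rewrite -scaleN1r addrC; apply: closureP; [case: xl'|case: xl].
have {1}-> : l - l' = (x - l') - (x - l) by rewrite opprB [RHS]addrC subrKA.
by rewrite [X in X == 0]innerBl !closure_ortho// subrr.
Qed.

Lemma projection_exists : exists Q : {linear H -> H},
  [/\ forall x y, inner (Q x) y = inner x (Q y),
      forall x, Q (Q x) = Q x,
      forall x, M x -> Q x = x &
      forall x, (forall y, M y -> inner x y = 0) -> Q x = 0].
Proof.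
have [Q QP] := choice proj_ex.
have Qlin : linear Q.
  move=> a x y; apply: (proj_uniq (QP _)); have [[cx ox] [cy oy]] := (QP x, QP y).
  split; first exact: closureP.
  move=> m Mm; rewrite opprD addrACA -scalerBr innerDl innerZl ox// oy//.
  by rewrite mulr0 addr0.
have cst l : M l -> seq_closure l by move=> Ml; exists (fun=> l) => //; exact: cvg_cst.
exists (linear_of Qlin); split; rewrite /linear_of/=.
- move=> x y; transitivity (inner (Q x) (Q y)).
    apply/eqP; rewrite -subr_eq0 -innerBr innerC (closure_ortho (QP y)) ?conjC0//.
    by case: (QP x).
  by apply/esym/eqP; rewrite -subr_eq0 -innerBl (closure_ortho (QP x))//; case: (QP y).
- move=> x; apply: (proj_uniq (QP _)); split; first by case: (QP x).
  by move=> m _; rewrite subrr inner0l.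
- move=> x Mx; apply: (proj_uniq (QP _)); split; first exact: cst.
  by move=> m _; rewrite subrr inner0l.
- move=> x ox; apply: (proj_uniq (QP _)); split; first exact: cst.
  by move=> m Mm; rewrite subr0 ox.
Qed.

End orthogonal_projection.

Section adjoint_theory.
Variables (R : realType) (V W : hilbertType R).

Lemma adjointE (f : {linear V -> W}) (g : W -> V) : bounded_op f ->
  (forall x y, inner (f x) y = inner x (g y)) -> adjoint f =1 g.
Proof.
move=> fb fg y; apply: inner_inj => z.
by rewrite innerC -adjointP// fg -innerC.
Qed.

End adjoint_theory.

Lemma unitaryP (R : realType) (V : hilbertType R) (U : {linear V -> V}) (U' : V -> V) :
  (forall x y, inner (U x) y = inner x (U' y)) -> cancel U U' -> cancel U' U ->
  unitary U.
Proof.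
move=> UU' UK U'K.
have Ub : bounded_op U.
  by apply: isometric_bounded => x y; have := UU' x (U y); rewrite UK.
have aE := adjointE Ub UU'.
by split=> // x; rewrite aE.
Qed.

(** * Extension of a partial isometry to a unitary *)

Section isometry_extension.
Variables (R : realType) (E K : hilbertType R) (X Y : {linear E -> K}).
Hypothesis XY : forall x y, inner (X x) (X y) = inner (Y x) (Y y).

Definition hpair (a b : K) : hpow 2 K := [ffun i => if i == 0 then a else b].

Lemma inner_hpair a b c e : inner (hpair a b) (hpair c e) = inner a c + inner b e.
Proof. by rewrite inner_hpow big_ord_recl big_ord1 !ffunE. Qed.

Lemma hpairP (z : hpow 2 K) : z = hpair (z 0) (z 1).
Proof.
apply/ffunP => i; rewrite ffunE; case: eqP => [->//|/eqP i0]; congr (z _).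
by apply/val_inj; case: i i0 => -[|[|]].
Qed.

Lemma hpair_linear c a b a' b' :
  c *: hpair a b + hpair a' b' = hpair (c *: a + a') (c *: b + b').
Proof. by apply/ffunP => i; rewrite !ffunE; case: eqP. Qed.

(* With Q the projection onto the closure of the vectors (Y x, X x), the symmetry
   2 Q - 1 maps (Y x, 0) to (0, X x), since (Y x, - X x) is orthogonal to them. *)
Lemma unitary_extension : exists U : {linear hpow 2 K -> hpow 2 K},
  unitary U /\ forall x, U (hpair (Y x) 0) = hpair (X x) 0.
Proof.
pose M := [set hpair (Y x) (X x) | x in setT].
have M0 : M 0.
  by exists 0 => //; rewrite !linear0; apply/ffunP => i; rewrite !ffunE; case: eqP.
have [|Q [Qsa QQ QM Qo]] := projection_exists M0.
  by move=> a _ _ [x _ <-] [y _ <-]; exists (a *: x + y) => //; rewrite hpair_linear !linearP.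
pose F z := Q z + Q z - z.
have Fsa z w : inner (F z) w = inner z (F w).
  by rewrite /F innerBl innerBr innerDl innerDr Qsa.
have FF z : F (F z) = z.
  by rewrite /F linearB linearD/= !QQ addrK opprB addrCA subrr addr0.
have FYX x : F (hpair (Y x) 0) = hpair 0 (X x).
  have oYX : Q (hpair (Y x) (- X x)) = 0.
    apply: Qo => _ [y _ <-]; rewrite inner_hpair innerNl XY subrr//.
  (* [F] fixes [(Y x, X x)] and negates [(Y x, - X x)]; their sum is [2 (Y x, 0)] and their
     difference [2 (0, X x)]. *)
  have : F (hpair (Y x) (X x) + hpair (Y x) (- X x)) = hpair (Y x) (X x) - hpair (Y x) (- X x).
    rewrite /F linearD/= oYX addr0 QM; last by exists x.
    by rewrite opprD addrA addrK.
  have two w : w + w = (2%:R : R[i]) *: w by rewrite -mulr2n scaler_nat.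
  have -> : hpair (Y x) (X x) + hpair (Y x) (- X x) = 2%:R *: hpair (Y x) 0.
    rewrite -two -[LHS]scale1r; apply/ffunP => i; rewrite !ffunE scale1r.
    by case: eqP => // _; rewrite subrr addr0.
  have -> : hpair (Y x) (X x) - hpair (Y x) (- X x) = 2%:R *: hpair 0 (X x).
    rewrite -two; apply/ffunP => i; rewrite !ffunE.
    by case: eqP => _; rewrite ?subrr ?addr0// opprK.
  have FZ (a : R[i]) z : F (a *: z) = a *: F z by rewrite /F linearZ/= !scalerBr scalerDr.
  by rewrite FZ => /scalerI; apply; rewrite pnatr_eq0.
have Flin : linear F.
  move=> a z w; rewrite /F linearP [a *: Q z + Q w + _]addrACA opprD [LHS]addrACA.
  by rewrite -scalerDr -scalerBr.
(* Exchanging the summands brings [X x] back to the coordinate where [Y x] stood, so that the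
   resulting unitary can be iterated. *)
pose swap (z : hpow 2 K) := hpair (z 1) (z 0).
have swapK z : swap (swap z) = z by rewrite [RHS]hpairP /swap !ffunE.
have swapsa z w : inner (swap z) w = inner z (swap w).
  by rewrite (hpairP z) (hpairP w) /swap !ffunE/= !inner_hpair addrC.
pose U0 z := swap (F z).
have Ulin : linear U0.
  by move=> a z w; rewrite /U0 Flin /swap hpair_linear !ffunE.
exists (linear_of Ulin); split; rewrite /linear_of.
  apply: (@unitaryP _ _ _ (F \o swap)) => z /=.
  - by move=> w; rewrite /= /U0 swapsa Fsa.
  - by change (F (swap (swap (F z))) = z); rewrite swapK FF.
  - by change (swap (F (F (swap z))) = z); rewrite FF swapK.
by move=> x; change (swap (F (hpair (Y x) 0)) = hpair (X x) 0); rewrite FYX /swap !ffunE.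
Qed.

End isometry_extension.

(** * Dilations in weak form *)

Section dilations.
Variables (R : realType) (V W : hilbertType R).

Lemma inner_adjointl (f : {linear V -> W}) x y : bounded_op f ->
  inner (adjoint f y) x = inner y (f x).
Proof. by move=> fb; rewrite innerC -adjointP// -innerC. Qed.

(** Since the projection onto the range of [J] is [J] composed with its adjoint, it can be
    eliminated in favour of inner products. *)
Lemma dilationP (J : {linear V -> W}) (S : W -> W) (f : V -> V) :
  isometric_embedding J ->
  dilation J S f <-> forall x y, inner (f x) y = inner (S (J x)) (J y).
Proof.
move=> Ji; have Jb := isometric_bounded Ji.
split=> [fS x y|fS x].
  have := fS x; rewrite (orthproj_range Ji)/= => JE.
  by rewrite -(Ji (f x) y) JE -(inner_adjointl _ _ Jb) Ji.
rewrite (orthproj_range Ji)/=; congr (J _); apply: inner_inj => y.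
by rewrite inner_adjointl.
Qed.

Lemma adjoint_linear (f : {linear V -> W}) : bounded_op f -> linear (adjoint f).
Proof.
move=> fb a x y; apply: inner_inj => z.
by rewrite innerDl innerZl !inner_adjointl// innerDl innerZl.
Qed.

Lemma adjoint_le (f : {linear V -> W}) c : 0 <= c ->
  (forall x, rnorm (f x) <= c * rnorm x) ->
  forall y, rnorm (adjoint f y) <= c * rnorm y.
Proof.
move=> c0 fc y.
have fb : bounded_op f by apply/bounded_opP; exists c.
have [->|n0] := eqVneq (rnorm (adjoint f y)) 0; first by rewrite mulr_ge0 ?rnorm_ge0.
rewrite -(@ler_pM2r _ (rnorm (adjoint f y))); last by rewrite lt_def n0 rnorm_ge0.
rewrite -expr2 -Re_inner_rnorm inner_adjointl// mulrAC.
apply: le_trans (ler_norm _) _; apply: le_trans (norm_Re_rnorm _) _.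
apply: le_trans (rnorm_inner _ _) _; rewrite mulrC ler_wpM2r ?rnorm_ge0//.
Qed.

Lemma isometric_inner (J : {linear V -> W}) x y :
  isometric_embedding J -> inner (J x) (J y) = inner x y.
Proof. by move=> Ji; exact: Ji. Qed.

End dilations.

Lemma sumr_const_ord (R : pzRingType) n (a : R) : \sum_(i < n) a = n%:R * a.
Proof. by rewrite sumr_const card_ord mulr_natl. Qed.

(** * The Toeplitz operator matrix; dilations give positivity *)

Section toeplitz_theory.
Variables (R : realType) (H : hilbertType R) (d : nat) (T : 'I_d -> {linear H -> H}).
Hypothesis T_bounded : forall k, bounded_op (T k).

Lemma toeplitz_coefP k : exists2 f : {linear H -> H}, bounded_op f &
  toeplitz_coef T k = f.
Proof.
rewrite /toeplitz_coef; case: unliftP => [j _|_]; first by exists (T j).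
exists (idfun : {linear H -> H}) => //.
by apply/bounded_opP; exists 1 => // x; rewrite mul1r.
Qed.

Lemma inner_toeplitz_entry i j x y : inner (toeplitz_entry T i j x) y =
  if (j <= i)%N then inner (toeplitz_coef T (inord (i - j)) x) y
  else inner x (toeplitz_coef T (inord (j - i)) y).
Proof.
rewrite /toeplitz_entry; case: ifP => // _.
by have [f fb ->] := toeplitz_coefP (inord (j - i)); rewrite inner_adjointl.
Qed.

Lemma inner_toeplitz_op x y : inner (toeplitz_op T x) y =
  \sum_(i < d.+1) \sum_(j < d.+1) inner (toeplitz_entry T i j (x j)) (y i).
Proof.
rewrite inner_hpow; apply: eq_bigr => i _.
by rewrite /toeplitz_op ffunE inner_suml.
Qed.

Lemma toeplitz_op_linear : linear (toeplitz_op T).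
Proof.
move=> a x y; apply/inner_inj => z; rewrite innerDl innerZl !inner_toeplitz_op.
rewrite mulr_sumr -big_split/=; apply: eq_bigr => i _.
rewrite mulr_sumr -big_split/=; apply: eq_bigr => j _.
rewrite !inner_toeplitz_entry hpowD hpowZ; case: ifP => _; last first.
  by rewrite innerDl innerZl.
by have [f _ ->] := toeplitz_coefP (inord (i - j)); rewrite linearP innerDl innerZl.
Qed.

Lemma toeplitz_op_bounded : bounded_op (linear_of toeplitz_op_linear).
Proof.
have [c c0 cT] : exists2 c : R, 0 <= c &
    forall k x, rnorm (toeplitz_coef T k x) <= c * rnorm x.
  have /choice[c cP] : forall k : 'I_d.+1, exists c : R, 0 <= c /\
      forall x, rnorm (toeplitz_coef T k x) <= c * rnorm x.
    by move=> k; have [f /bounded_opP[c ? ?] ->] := toeplitz_coefP k; exists c.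
  exists (\sum_k c k); first by apply: sumr_ge0 => k _; case: (cP k).
  move=> k x; have [_ /(_ x) /le_trans] := cP k; apply.
  rewrite ler_wpM2r ?rnorm_ge0// (bigD1 k)//= lerDl sumr_ge0// => i _.
  by case: (cP i).
have cE i j x : rnorm (toeplitz_entry T i j x) <= c * rnorm x.
  rewrite /toeplitz_entry; case: ifP => // _.
  have := cT (inord (j - i)); have [f fb ->] := toeplitz_coefP (inord (j - i)).
  by move=> fc; exact: adjoint_le.
have dc : 0 <= d.+1%:R * (d.+1%:R * c) by rewrite !mulr_ge0.
apply/bounded_opP; exists (d.+1%:R * (d.+1%:R * c)) => // x.
rewrite /linear_of; apply: le_trans (ler_rnorm_hpow _) _.
rewrite -mulrA -sumr_const_ord.
apply: ler_sum => i _; rewrite ffunE.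
apply: le_trans (ler_rnorm_sum _ _ _) _.
rewrite -mulrA -sumr_const_ord.
apply: ler_sum => j _; apply: le_trans (cE _ _ _) _.
by rewrite ler_wpM2l// le_rnorm_coord.
Qed.

Lemma toeplitz_coef0 : toeplitz_coef T ord0 = id.
Proof. by rewrite /toeplitz_coef unlift_none. Qed.

Lemma toeplitz_coefS (k : 'I_d) : toeplitz_coef T (inord k.+1) = T k.
Proof.
rewrite /toeplitz_coef (_ : inord k.+1 = lift ord0 k) ?liftK//.
by apply/val_inj; rewrite /= inordK// ltnS.
Qed.

(** For [j <= i] the isometry cancels [U^(d-i)] from [<U^(d-j) J x_j, U^(d-i) J x_i>] and leaves the
    entry [T_(i-j)]; the exponents [d - i] keep all powers nonnegative. Besides unitary dilations,
    this serves the compressions in (d) and the scalar tuples [(z, ..., z^d)]. *)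
Lemma toeplitz_contractive_isometry (K : hilbertType R) (J : {linear H -> K})
    (U : {linear K -> K}) : isometric_embedding J -> isometric_embedding U ->
  (forall k x y, inner (T k x) y = inner (iter k.+1 U (J x)) (J y)) ->
  toeplitz_contractive T.
Proof.
move=> Ji Ui TU x; pose v := \sum_(i < d.+1) iter (d - i) U (J (x i)).
have Uiter n a b : inner (iter n U a) (iter n U b) = inner a b.
  by elim: n => //= n IH; rewrite isometric_inner.
have coefU (k : nat) a b : (k <= d)%N ->
    inner (toeplitz_coef T (inord k) a) b = inner (iter k U (J a)) (J b).
  case: k => [_|k kd]; last first.
    by rewrite (_ : k = Ordinal kd)// toeplitz_coefS TU.
  rewrite (_ : inord 0 = ord0) ?toeplitz_coef0 ?isometric_inner//.
  by apply/val_inj; rewrite /= inordK.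
suff -> : inner (toeplitz_op T x) x = inner v v by exact: dnorm_ge0.
rewrite inner_toeplitz_op /v inner_sumr; apply: eq_bigr => i _.
rewrite inner_suml; apply: eq_bigr => j _; rewrite inner_toeplitz_entry.
have [ilt jlt] := (ltn_ord i, ltn_ord j); rewrite !ltnS in ilt jlt.
case: leqP => ij.
  rewrite coefU; last by apply: leq_trans ilt; exact: leq_subr.
  by rewrite (_ : d - j = d - i + (i - j))%N ?iterD ?Uiter//; lia.
rewrite innerC coefU; last by apply: leq_trans jlt; exact: leq_subr.
by rewrite -innerC (_ : d - i = d - j + (j - i))%N ?iterD ?Uiter//; lia.
Qed.

End toeplitz_theory.

(** Positivity is a closed condition: replacing every [T_k] within [e] moves the quadratic form at
    [x] by at most [e C], with [C] depending on [x] only. *)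
Lemma toeplitz_contractive_approx (R : realType) (H : hilbertType R) (d : nat)
    (T : 'I_d -> {linear H -> H}) : (forall k, bounded_op (T k)) ->
  (forall e : R, 0 < e -> exists S : 'I_d -> {linear H -> H},
    [/\ forall k, bounded_op (S k), toeplitz_contractive S &
        forall k x, rnorm (T k x - S k x) <= e * rnorm x]) ->
  toeplitz_contractive T.
Proof.
move=> Tb TS x; pose C := \sum_(i < d.+1) \sum_(j < d.+1) rnorm (x j) * rnorm (x i).
have C0 : 0 <= C.
  by do 2![apply: sumr_ge0 => ? _]; rewrite mulr_ge0 ?rnorm_ge0.
have key (e : R) : 0 < e -> exists w : R[i], 0 <= w /\
    rnorm (inner (toeplitz_op T x) x - w) <= e * C.
  move=> e0; have [S [Sb Sc TSe]] := TS _ e0.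
  exists (inner (toeplitz_op S x) x); split; first exact: Sc.
  rewrite !inner_toeplitz_op// -sumrB; apply: le_trans (ler_rnorm_sum _ _ _) _.
  rewrite mulr_sumr; apply: ler_sum => i _.
  rewrite -sumrB; apply: le_trans (ler_rnorm_sum _ _ _) _.
  rewrite mulr_sumr; apply: ler_sum => j _.
  have coefB k z : rnorm (toeplitz_coef T k z - toeplitz_coef S k z) <= e * rnorm z.
    rewrite /toeplitz_coef; case: (unlift ord0 k) => [l|]; first exact: TSe.
    by rewrite subrr rnorm0 mulr_ge0 ?rnorm_ge0// ltW.
  rewrite !inner_toeplitz_entry//; case: ifP => _.
    rewrite -innerBl; apply: le_trans (rnorm_inner _ _) _.
    by rewrite mulrA ler_wpM2r ?rnorm_ge0.
  rewrite -innerBr; apply: le_trans (rnorm_inner _ _) _.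
  by rewrite mulrCA ler_wpM2l ?rnorm_ge0.
move: (inner _ _) key => z key.
have {}key (e : R) : 0 < e -> exists w : R[i], 0 <= w /\ rnorm (z - w) <= e.
  move=> e0; have [|w [w0 zw]] := key (e / (C + 1)).
    by rewrite divr_gt0// ltr_wpDl.
  exists w; split=> //; apply: le_trans zw _.
  by rewrite -mulrA ler_piMr ?(ltW e0)// mulrC ler_pdivrMr ?ltr_wpDl// mul1r lerDl.
rewrite lecE; apply/andP; split.
  rewrite -normr_le0; apply/ler_addgt0Pr => e e0.
  have [w [w0 zw]] := key e e0; rewrite add0r; apply: le_trans zw.
  apply: le_trans (norm_Im_rnorm _); move: w0; rewrite lecE => /andP[/eqP w0 _].
  by rewrite raddfB/= w0 subr0.
apply/ler_addgt0Pr => e e0; have [w [w0 zw]] := key e e0.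
have := le_trans (norm_Re_rnorm _) zw; rewrite raddfB/= ler_norml => /andP[].
by move: w0; rewrite lecE => /andP[_ /=]; lra.
Qed.

Section finite_dimension.
Variables (R : realType) (H : hilbertType R).

Lemma finite_dim_hpow n : finite_dim H -> finite_dim (hpow n H).
Proof.
move=> [m [b bP]].
exists #|{: 'I_n * 'I_m}|, (fun p => let: (i, k) := enum_val p in
  [ffun j => if j == i then b k else 0] : hpow n H) => x.
have /choice[c cP] : forall i, exists c : 'I_m -> R[i], x i = \sum_(k < m) c k *: b k.
  by move=> i; exact: bP.
exists (fun p => let: (i, k) := enum_val p in c i k).
pose F (p : 'I_n * 'I_m) : hpow n H :=
  c p.1 p.2 *: [ffun j => if j == p.1 then b p.2 else 0].
transitivity (\sum_p F p); last first.
  rewrite (reindex_onto enum_val enum_rank) => [|p _]; last by rewrite enum_rankK.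
  by under eq_bigl do rewrite enum_valK eqxx; apply: eq_bigr => p _; rewrite /F;
    case: (enum_val p).
rewrite -(pair_bigA _ (fun i k => F (i, k)))/=; apply/ffunP => j.
rewrite hpow_sum (bigD1 j)//= [X in _ + X]big1 ?addr0.
  by rewrite hpow_sum cP; apply: eq_bigr => k _; rewrite hpowZ ffunE eqxx.
move=> i /negPf ij; rewrite hpow_sum big1// => k _.
by rewrite hpowZ ffunE eq_sym ij scaler0.
Qed.

End finite_dimension.

(** * From positivity to a unitary dilation *)

Section toeplitz_dilation.
Variables (R : realType) (H : hilbertType R) (d : nat) (T : 'I_d -> {linear H -> H}).
Hypothesis T_bounded : forall k, bounded_op (T k).

(** The position is a natural number, so that one index makes sense among [d] and among [d.+1]
    summands without casts. *)
Definition hsingle n (i : nat) (x : H) : hpow n H :=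
  [ffun j : 'I_n => if j == i :> nat then x else 0].

Lemma hsingle_linear n i : linear (hsingle n i).
Proof.
move=> a x y; apply/ffunP => j; rewrite !ffunE; case: eqP => // _.
by rewrite scaler0 addr0.
Qed.

Lemma toeplitz_op_hsingle (i j : 'I_d.+1) x y :
  inner (toeplitz_op T (hsingle d.+1 j x)) (hsingle d.+1 i y) =
  inner (toeplitz_entry T i j x) y.
Proof.
rewrite inner_toeplitz_op// (bigD1 i)//= [X in _ + X]big1 ?addr0; last first.
  move=> k /negPf ki; rewrite big1// => l _; rewrite [X in inner _ X]ffunE.
  by rewrite (inj_eq val_inj) ki inner0r.
rewrite (bigD1 j)//= big1 ?addr0; first by rewrite !ffunE !eqxx.
move=> k /negPf kj; rewrite [X in toeplitz_entry _ _ _ X]ffunE (inj_eq val_inj) kj.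
by rewrite inner_toeplitz_entry//; case: ifP => _; rewrite ?inner0l//;
  have [f _ ->] := toeplitz_coefP T_bounded (inord (i - k)); rewrite linear0 inner0l.
Qed.

Let shift_up (x : hpow d H) : hpow d.+1 H :=
  [ffun j => if unlift ord0 j is Some k then x k else 0].

Let shift_down (x : hpow d H) : hpow d.+1 H :=
  [ffun j => if unlift ord_max j is Some k then x k else 0].

(** The zero padding leaves two [d] by [d] corners of the matrix, which agree because the entries
    [(i, j)] and [(i+1, j+1)] do. *)
Let toeplitz_shift x y : inner (toeplitz_op T (shift_down x)) (shift_down y) =
  inner (toeplitz_op T (shift_up x)) (shift_up y).
Proof.
have e0 i j : toeplitz_entry T i j 0 = 0.
  apply: inner_inj => z; rewrite inner_toeplitz_entry// !inner0l.
  by case: ifP => // _; have [f _ ->] := toeplitz_coefP T_bounded (inord (i - j));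
    rewrite linear0 inner0l.
rewrite !inner_toeplitz_op// big_ord_recr [RHS]big_ord_recl/=.
have -> : \sum_(j < d.+1) inner (toeplitz_entry T ord_max j (shift_down x j))
    (shift_down y ord_max) = 0.
  by rewrite big1// => j _; rewrite [shift_down y _]ffunE unlift_none inner0r.
have -> : \sum_(j < d.+1) inner (toeplitz_entry T ord0 j (shift_up x j))
    (shift_up y ord0) = 0.
  by rewrite big1// => j _; rewrite [shift_up y _]ffunE unlift_none inner0r.
have widE (k : 'I_d) : widen_ord (leqnSn d) k = lift ord_max k.
  by apply/val_inj; rewrite /= /bump leqNgt ltn_ord.
rewrite addr0 add0r; apply: eq_bigr => i _.
rewrite big_ord_recr [RHS]big_ord_recl/=.
rewrite [shift_down x ord_max]ffunE [shift_up x ord0]ffunE !unlift_none !e0.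
rewrite !inner0l addr0 add0r; apply: eq_bigr => j _.
rewrite !widE ![shift_down _ _]ffunE ![shift_up _ _]ffunE !liftK.
rewrite (inner_toeplitz_entry T_bounded) [RHS](inner_toeplitz_entry T_bounded).
have vS (k : 'I_d) : lift ord0 k = k.+1 :> nat by [].
have vW (k : 'I_d) : lift ord_max k = k :> nat by rewrite -widE.
by rewrite !vS !vW ltnS !subSS.
Qed.

Lemma toeplitz_unitary_dilation : toeplitz_contractive T ->
  exists (J : {linear H -> hpow 2 (hpow d.+1 H)})
    (U : {linear hpow 2 (hpow d.+1 H) -> hpow 2 (hpow d.+1 H)}),
    [/\ isometric_embedding J, unitary U &
     forall k x y, inner (T k x) y = inner (iter k.+1 U (J x)) (J y)].
Proof.
move=> Tc.
have [A AP] := positive_op_factor (toeplitz_op_bounded T_bounded) Tc.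
have up_lin : linear (fun x => A (shift_up x)).
  move=> a x y /=; rewrite -linearP; congr (A _); apply/ffunP => j.
  by rewrite !ffunE; case: unlift => [k|]; rewrite ?ffunE// scaler0 addr0.
have down_lin : linear (fun x => A (shift_down x)).
  move=> a x y /=; rewrite -linearP; congr (A _); apply/ffunP => j.
  by rewrite !ffunE; case: unlift => [k|]; rewrite ?ffunE// scaler0 addr0.
have [|U [Uu UE]] := @unitary_extension _ _ _ (linear_of down_lin) (linear_of up_lin).
  by move=> x y; rewrite /linear_of/= !AP; exact: toeplitz_shift.
have Jlin : linear (fun x : H => hpair (A (hsingle d.+1 d x)) 0).
  by move=> a x y /=; rewrite hpair_linear scaler0 addr0 -linearP hsingle_linear.
have iterU k x : (k <= d)%N ->
    iter k U (linear_of Jlin x) = hpair (A (hsingle d.+1 (d - k) x)) 0.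
  elim: k => [|k IH] kd; first by rewrite subn0.
  rewrite iterS IH ?(ltnW kd)//.
  (* [U] replaces [shift_up] by [shift_down], so it lowers the position by one. *)
  have -> : hsingle d.+1 (d - k) x = shift_up (hsingle d (d - k.+1) x).
    apply/ffunP => j; rewrite !ffunE; case: unliftP => [l ->|->] /=.
      by rewrite ffunE /bump/= add1n -(subnSK kd) eqSS.
    by rewrite -(subnSK kd).
  rewrite (UE (hsingle d (d - k.+1) x)) /linear_of; congr (hpair (A _) 0).
  apply/ffunP => j; rewrite !ffunE; case: unliftP => [l ->|->] /=.
    by rewrite ffunE /bump leqNgt ltn_ord.
  by case: eqP => // dE; have := leq_subr k d; lia.
exists (linear_of Jlin), U; split => //.
- move=> x y; rewrite /linear_of/= inner_hpair inner0l addr0 AP.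
  rewrite (toeplitz_op_hsingle ord_max ord_max) inner_toeplitz_entry// leqnn subnn.
  by rewrite (_ : inord 0 = ord0) ?toeplitz_coef0//; apply/val_inj; rewrite /= inordK.
- move=> k x y; rewrite iterU// /linear_of inner_hpair inner0l addr0 AP.
  (* The inner product is the entry in row [d], column [d - (k+1)], hence on the diagonal of
     [T k]. *)
  have kd : (d - k.+1 < d.+1)%N by rewrite ltnS leq_subr.
  rewrite (toeplitz_op_hsingle ord_max (Ordinal kd)) inner_toeplitz_entry//= leq_subr.
  by rewrite subKn// toeplitz_coefS.
Qed.

End toeplitz_dilation.

(** * Gram-Schmidt and orthonormal expansions *)

Section gram_schmidt.
Variables (R : realType) (H : hilbertType R).

(* Zero vectors are allowed, so that finite-dimensional spaces are covered too. *)
Definition orthosystem (f : nat -> H) :=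
  (forall i j, i != j -> inner (f i) (f j) = 0) /\
  (forall i, f i = 0 \/ inner (f i) (f i) = 1).

Definition orthosum (f : nat -> H) n x := \sum_(i < n) inner x (f i) *: f i.

Section orthosum_theory.
Variable f : nat -> H.
Hypothesis fP : orthosystem f.

Lemma inner_orthosum n x y :
  inner (orthosum f n x) y = \sum_(i < n) inner x (f i) * inner (f i) y.
Proof. by rewrite inner_suml; apply: eq_bigr => i _; rewrite innerZl. Qed.

Lemma inner_orthosumf n x i : (i < n)%N -> inner (orthosum f n x) (f i) = inner x (f i).
Proof.
move=> lt_in; rewrite inner_orthosum (bigD1 (Ordinal lt_in))//= big1 ?addr0; last first.
  move=> j /negPf ji; rewrite (fP.1 j i) ?mulr0//.
  by apply/negP => /eqP E; move: ji; rewrite -val_eqE/= E eqxx.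
by have [_ /(_ i)[->|->]] := fP; rewrite ?inner0r ?mulr1// mul0r.
Qed.

Lemma orthosumB n x y : orthosum f n (x - y) = orthosum f n x - orthosum f n y.
Proof.
by rewrite /orthosum -sumrB; apply: eq_bigr => i _; rewrite innerBl scalerBl.
Qed.

Lemma inner_orthosum_proj n x y :
  inner (orthosum f n x) (orthosum f n y) = inner (orthosum f n x) y.
Proof.
rewrite !inner_orthosum; apply: eq_bigr => i _; congr (_ * _).
by rewrite innerC inner_orthosumf// -innerC.
Qed.

Lemma rnorm_orthosum n x :
  rnorm (orthosum f n x) ^+ 2 = \sum_(i < n) rnorm (inner x (f i)) ^+ 2.
Proof.
rewrite -Re_inner_rnorm inner_orthosum_proj inner_orthosum raddf_sum.
by apply: eq_bigr => i _; rewrite [inner (f i) x]innerC -normCK rnormE -rmorphXn.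
Qed.

Lemma bessel n x :
  rnorm (x - orthosum f n x) ^+ 2 + rnorm (orthosum f n x) ^+ 2 = rnorm x ^+ 2.
Proof.
rewrite rnormD_sqr rnormN innerNr raddfN/= Re_innerC.
rewrite -inner_orthosum_proj Re_inner_rnorm.
by move: (_ ^+ 2) (_ ^+ 2) => a b; ring.
Qed.

Lemma orthosum_dist_le n x : rnorm (x - orthosum f n x) <= rnorm x.
Proof.
rewrite -(@ler_pXn2r _ 2)// ?nnegrE ?rnorm_ge0// -(bessel n x).
by rewrite lerDl sqr_ge0.
Qed.

End orthosum_theory.

Variable u : nat -> H.

Let normalize (v : H) : H := (rnorm v)^-1%:C%C *: v.

(** Each step needs all previous vectors, so the recursion carries them in a list; [gs_vectorE] then
    returns to [orthosum]. *)
Fixpoint gs_seq n : seq H := if n is k.+1 then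
    rcons (gs_seq k) (normalize (u k - \sum_(g <- gs_seq k) inner (u k) g *: g))
  else [::].

Definition gs_vector n := normalize (u n - \sum_(g <- gs_seq n) inner (u n) g *: g).

Lemma gs_vectorE n : gs_vector n = normalize (u n - orthosum gs_vector n (u n)).
Proof.
suff sE (F : H -> H) : \sum_(g <- gs_seq n) F g = \sum_(i < n) F (gs_vector i).
  by rewrite {1}/gs_vector sE.
elim: n => [|n IH]; first by rewrite big_nil big_ord0.
by rewrite /= big_rcons/= IH big_ord_recr/= addrC.
Qed.

Lemma gs_vector_norm n : gs_vector n = 0 \/ inner (gs_vector n) (gs_vector n) = 1.
Proof.
rewrite gs_vectorE /normalize; set v := _ - _.
have [->|v0] := eqVneq v 0; first by left; rewrite scaler0.
right; rewrite inner_rnorm rnormZ rnorm_real ger0_norm ?invr_ge0 ?rnorm_ge0//.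
by rewrite mulVf ?expr1n// rnorm_eq0.
Qed.

Lemma gs_vector_ortho i j : (i < j)%N -> inner (gs_vector j) (gs_vector i) = 0.
Proof.
elim/ltn_ind: j i => j IH i lt_ij; rewrite (gs_vectorE j) /normalize innerZl innerBl.
rewrite inner_orthosum (bigD1 (Ordinal lt_ij))//= big1 ?addr0; last first.
  move=> k ki; have [lt_ki|] := ltnP k i.
    by rewrite [inner (gs_vector k) _]innerC IH ?conjC0 ?mulr0.
  rewrite leq_eqVlt => /orP[/eqP ik|lt_ik]; last by rewrite IH ?mulr0// ltn_ord.
  by case/eqP: ki; apply/val_inj; rewrite /= ik.
have [->|->] := gs_vector_norm i; first by rewrite !inner0r mulr0 subr0 mulr0.
by rewrite mulr1 subrr mulr0.
Qed.

Lemma gs_orthosystem : orthosystem gs_vector.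
Proof.
split=> [i j|]; last exact: gs_vector_norm.
rewrite neq_ltn => /orP[|] lt_ij; last exact: gs_vector_ortho.
by rewrite innerC gs_vector_ortho// conjC0.
Qed.

(** Step [n] is set up so that [u n] lies in the span of the first [n + 1] vectors; all later ones
    are orthogonal to it. *)
Lemma gs_vector_span n m : (n < m)%N -> orthosum gs_vector m (u n) = u n.
Proof.
have fP := gs_orthosystem.
have spanS : orthosum gs_vector n.+1 (u n) = u n.
  rewrite /orthosum big_ord_recr/= -/(orthosum _ _ _).
  set v := u n - orthosum gs_vector n (u n).
  have gE : gs_vector n = (rnorm v)^-1%:C%C *: v by rewrite gs_vectorE.
  have -> : inner (u n) (gs_vector n) = inner v (gs_vector n).
    rewrite innerBl inner_orthosum big1 ?subr0// => i _.
    by rewrite (fP.1 i n) ?mulr0// neq_ltn ltn_ord.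
  rewrite gE innerZr conjC_real scalerA inner_rnorm -!rmorphM/=.
  have [v0|v0] := eqVneq (rnorm v) 0.
    move/eqP: v0; rewrite rnorm_eq0 => /eqP v0; rewrite v0 scaler0 addr0.
    by apply/esym/eqP; rewrite -subr_eq0 -/v v0.
  rewrite (_ : _ * _ = 1) ?scale1r; first by rewrite addrC subrK.
  by field.
move=> /subnK <-; elim: (m - n.+1)%N => [|k IH]; first exact: spanS.
rewrite addSn /orthosum big_ord_recr/= -/(orthosum _ _ _) IH.
rewrite -{2}spanS inner_orthosum big1 ?scale0r ?addr0// => i _.
by rewrite (fP.1 i) ?mulr0// neq_ltn (leq_trans (ltn_ord i)) ?leq_addl.
Qed.

End gram_schmidt.

(** On a dense sequence the partial sums are eventually exact, and [x - orthosum f m x] depends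
    contractively on [x]. *)
Lemma separable_parseval (R : realType) (H : hilbertType R) : separable H ->
  exists2 f : nat -> H, orthosystem f &
    forall x, orthosum f n x @[n --> \oo] --> x.
Proof.
move=> [D Dc Dd].
have [x0 [_ Dx0]] : D `&` setT !=set0.
  by rewrite setIC; apply: Dd; [exists 0|exact: openT].
have [u uD] : exists u : nat -> H, forall x, D x -> exists n, u n = x.
  move: Dc => /pfcard_geP[D0|[g]]; first by exists (fun=> 0) => x; rewrite D0.
  by exists g => x /'surj_g[n _ <-]; exists n.
exists (gs_vector u); first exact: gs_orthosystem.
move=> x; apply/cvgn_rnormP => e e0.
have [y [xy Dy]] : (ball x e%:C%C) `&` D !=set0.
  by apply: Dd; [exists x; apply: ballxx; rewrite ltcR|exact: ball_open].
have [n nE] := uD _ Dy; exists n.+1 => m nm.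
have -> : orthosum (gs_vector u) m x - x = - ((x - u n) - orthosum (gs_vector u) m (x - u n)).
  by rewrite orthosumB (gs_vector_span _ nm) !opprB subrKA.
rewrite rnormN; apply: le_lt_trans (orthosum_dist_le (gs_orthosystem u) _ _) _.
by move: xy; rewrite -ball_normE/= nE rnormE ltcR.
Qed.

Section l2Z_orthonormal.
Variable R : realType.

Lemma sumZ_single (u : int -> R) n : (forall k, k != n -> u k = 0) -> sumZ u = u n.
Proof.
move=> u0; pose j := match n with Posz k | Negz k => k end.
apply/cvg_lim => //; apply: cvg_near_cst; exists j.+1 => // K /= jK.
change (\sum_(0 <= k < K) (u (Posz k) + u (Negz k)) = u n).
rewrite big_mkord (bigD1 (Ordinal jK))//= big1 ?addr0.
  by rewrite /j; case: (n) u0 => k u0;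
    [rewrite (u0 (Negz k))// addr0|rewrite (u0 (Posz k))// add0r].
move=> i; rewrite -val_eqE/= => ij; rewrite !u0 ?addr0//.
  by move: ij; rewrite /j; case: (n) => // k; apply: contra => /eqP[->].
by move: ij; rewrite /j; case: (n) => // k; apply: contra => /eqP[->].
Qed.

Lemma inner_l2Z_basis i j :
  inner (l2Z_basis R i) (l2Z_basis R j) = (i == j)%:R.
Proof.
have -> : inner (l2Z_basis R i) (l2Z_basis R j) =
    csumZ (fun n => (n == i)%:R * ((n == j)%:R : R[i])^*) by [].
rewrite /csumZ (@sumZ_single _ i); last by move=> k /negPf ->; rewrite mul0r.
rewrite (@sumZ_single _ i); last by move=> k /negPf ->; rewrite mul0r.
by rewrite eqxx mul1r; case: (i == j); rewrite ?conjC1 ?conjC0.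
Qed.

End l2Z_orthonormal.

(** * Operators on tensor products and matrix norms *)

Section tensor_theory.
Variables (R : realType) (H : hilbertType R) (m : nat).
Implicit Types (A B : 'M[R[i]]_m) (x y : hpow m H) (v w : 'cV[R[i]]_m).

Lemma tensor_op_linear (f : {linear H -> H}) A : linear (tensor_op f A).
Proof.
move=> a x y; apply/ffunP => i; rewrite !ffunE scaler_sumr -big_split/=.
apply: eq_bigr => j _; rewrite !ffunE linearP scalerDr !scalerA.
by rewrite [a * _]mulrC.
Qed.

Lemma inner_tensor_op (f : H -> H) A x y : inner (tensor_op f A x) y =
  \sum_(i < m) \sum_(j < m) A i j * inner (f (x j)) (y i).
Proof.
rewrite inner_hpow; apply: eq_bigr => i _; rewrite ffunE inner_suml.
by apply: eq_bigr => j _; rewrite innerZl.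
Qed.

Lemma tensor_linear (e : H) : linear (tensor e : 'cV[R[i]]_m -> hpow m H).
Proof. by move=> a v w; apply/ffunP => i; rewrite !ffunE !mxE scalerDl scalerA. Qed.

Lemma rnorm_tensor (e : H) v : inner e e = 1 -> rnorm (tensor e v) = euclid_norm v.
Proof.
move=> e1; rewrite /euclid_norm -[LHS]ger0_norm ?rnorm_ge0// -sqrtr_sqr.
congr Num.sqrt; rewrite rnorm_hpow; apply: eq_bigr => i _.
rewrite ffunE rnormZ exprMn -(Re_inner_rnorm e) e1.
by rewrite mulr1.
Qed.

(** A crude upper bound for the operator norm, used to have finite suprema and an explicit [C] in
    the resolvent estimate. *)
Definition mx_bound A : R := \sum_(i < m) \sum_(j < m) rnorm (A i j).

Lemma mx_bound_ge0 A : 0 <= mx_bound A.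
Proof. by do 2![apply: sumr_ge0 => ? _]; exact: rnorm_ge0. Qed.

Lemma tensor_op_le (f : H -> H) (c : R) A x : 0 <= c ->
  (forall h, rnorm (f h) <= c * rnorm h) ->
  rnorm (tensor_op f A x) <= mx_bound A * c * rnorm x.
Proof.
move=> c0 fc; apply: le_trans (ler_rnorm_hpow _) _.
rewrite -mulrA mulr_suml; apply: ler_sum => i _; rewrite ffunE.
apply: le_trans (ler_rnorm_sum _ _ _) _.
rewrite mulr_suml; apply: ler_sum => j _; rewrite rnormZ ler_wpM2l ?rnorm_ge0//.
by apply: le_trans (fc _) _; rewrite ler_wpM2l ?le_rnorm_coord.
Qed.

End tensor_theory.

Section matrix_norm.
Variables (R : realType) (m : nat).
Implicit Types (A B : 'M[R[i]]_m) (v w : 'cV[R[i]]_m).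

(** Tensoring with a unit vector embeds [C^m] isometrically in a Hilbert space, from which the
    properties of the Euclidean norm are inherited. *)
Let e0 : l2Z R := l2Z_basis R 0.

Let e0_unit : inner e0 e0 = 1.
Proof. by rewrite inner_l2Z_basis eqxx. Qed.

Let euclidE v : euclid_norm v = rnorm (tensor e0 v).
Proof. by rewrite rnorm_tensor. Qed.

Lemma euclid_norm_ge0 v : 0 <= euclid_norm v.
Proof. exact: sqrtr_ge0. Qed.

Lemma sqr_euclid_norm v : euclid_norm v ^+ 2 = \sum_(i < m) rnorm (v i 0) ^+ 2.
Proof. by rewrite sqr_sqrtr// sumr_ge0// => i _; exact: sqr_ge0. Qed.

Lemma ler_euclid_normD v w : euclid_norm (v + w) <= euclid_norm v + euclid_norm w.
Proof.
rewrite !euclidE (_ : tensor e0 (v + w) = tensor e0 v + tensor e0 w) ?ler_rnormD//.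
by have := tensor_linear e0 1 v w; rewrite !scale1r.
Qed.

Lemma euclid_normZ a v : euclid_norm (a *: v) = rnorm a * euclid_norm v.
Proof.
rewrite !euclidE -rnormZ; congr rnorm.
have := tensor_linear e0 a v 0; rewrite addr0 => ->.
by apply/ffunP => i; rewrite !ffunE mxE scale0r addr0.
Qed.

Lemma mul_euclid_norm_le A v : euclid_norm (A *m v) <= mx_bound A * euclid_norm v.
Proof.
rewrite !euclidE -[mx_bound A]mulr1 -(tensor_op_tensor (idfun : {linear l2Z R -> l2Z R})).
by apply: tensor_op_le => // x; rewrite mul1r.
Qed.

Lemma mxopnorm_has_ubound A : has_ubound
  [set euclid_norm (A *m v) | v in [set v : 'cV[R[i]]_m | euclid_norm v <= 1]].
Proof.
exists (mx_bound A) => _ [v /= v1 <-]; apply: le_trans (mul_euclid_norm_le _ _) _.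
by rewrite ler_piMr ?mx_bound_ge0.
Qed.

Lemma euclid_norm0 : euclid_norm (0 : 'cV[R[i]]_m) = 0.
Proof. by rewrite -(scale0r 0) euclid_normZ rnorm0 mul0r. Qed.

Lemma mxopnorm_ge0 A : 0 <= mxopnorm A.
Proof.
apply: ub_le_sup; first exact: mxopnorm_has_ubound.
by exists 0; rewrite /= ?mulmx0 euclid_norm0.
Qed.

Lemma le_mxopnorm A v : euclid_norm (A *m v) <= mxopnorm A * euclid_norm v.
Proof.
have [v0|v0] := eqVneq (euclid_norm v) 0.
  by have := mul_euclid_norm_le A v; rewrite v0 !mulr0.
have vn : 0 < euclid_norm v by rewrite lt_def v0 euclid_norm_ge0.
rewrite -ler_pdivrMr//; apply: ub_le_sup; first exact: mxopnorm_has_ubound.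
have rn : rnorm ((euclid_norm v)^-1%:C%C : R[i]) = (euclid_norm v)^-1.
  by rewrite rnorm_real ger0_norm ?invr_ge0 ?euclid_norm_ge0.
exists ((euclid_norm v)^-1%:C%C *: v).
  by rewrite /= euclid_normZ rn mulVf.
by rewrite -scalemxAr euclid_normZ rn mulrC.
Qed.

Lemma mxopnorm_le A (c : R) : 0 <= c ->
  (forall v, euclid_norm (A *m v) <= c * euclid_norm v) -> mxopnorm A <= c.
Proof.
move=> c0 Ac; apply: ge_sup.
  by exists (euclid_norm (A *m 0)), 0; rewrite /= ?euclid_norm0.
by move=> _ [v /= v1 <-]; apply: le_trans (Ac v) _; rewrite ler_piMr.
Qed.

Lemma ler_mxopnormD A B : mxopnorm (A + B) <= mxopnorm A + mxopnorm B.
Proof.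
apply: mxopnorm_le => [|v]; first by rewrite addr_ge0 ?mxopnorm_ge0.
rewrite mulmxDl mulrDl; apply: le_trans (ler_euclid_normD _ _) _.
by apply: lerD; exact: le_mxopnorm.
Qed.

Lemma mxopnormZ_le a A : mxopnorm (a *: A) <= rnorm a * mxopnorm A.
Proof.
apply: mxopnorm_le => [|v]; first by rewrite mulr_ge0 ?rnorm_ge0 ?mxopnorm_ge0.
by rewrite -scalemxAl euclid_normZ -mulrA ler_wpM2l ?rnorm_ge0 ?le_mxopnorm.
Qed.

Lemma mxopnorm0 : mxopnorm (0 : 'M[R[i]]_m) = 0.
Proof.
apply/eqP; rewrite eq_le mxopnorm_ge0 andbT; apply: mxopnorm_le => // v.
by rewrite mul0mx euclid_norm0 mul0r.
Qed.

Lemma ler_mxopnorm_sum (I : Type) (r : seq I) (F : I -> 'M[R[i]]_m) :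
  mxopnorm (\sum_(i <- r) F i) <= \sum_(i <- r) mxopnorm (F i).
Proof.
elim/big_rec2: _ => [|i u v _ h]; first by rewrite mxopnorm0.
by apply: le_trans (ler_mxopnormD _ _) _; rewrite lerD2l.
Qed.

(* Expanding the components of g in an orthonormal basis of their span turns
   1 (x) A into copies of A acting on the coefficient vectors. *)
Lemma tensor_op_le_mxopnorm (K : hilbertType R) A (g : hpow m K) :
  rnorm (tensor_op id A g) <= mxopnorm A * rnorm g.
Proof.
pose u n : K := if insub n is Some i then g i else 0.
have uE (j : 'I_m) : u j = g j by rewrite /u valK.
have fP := gs_orthosystem u; set f := gs_vector u in fP.
have gE j : orthosum f m (g j) = g j by rewrite -uE gs_vector_span.
have sqE (w : 'I_m -> K) : (forall i, orthosum f m (w i) = w i) ->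
    \sum_(i < m) rnorm (w i) ^+ 2 =
    \sum_(l < m) euclid_norm (\col_i inner (w i) (f l)) ^+ 2.
  move=> wE; under [RHS]eq_bigr do rewrite sqr_euclid_norm.
  rewrite exchange_big/=; apply: eq_bigr => i _.
  rewrite -[in LHS]wE rnorm_orthosum//; apply: eq_bigr => l _.
  by rewrite mxE.
rewrite -(@ler_pXn2r _ 2)// ?nnegrE ?rnorm_ge0 ?mulr_ge0 ?mxopnorm_ge0 ?rnorm_ge0//.
rewrite exprMn !rnorm_hpow (sqE g gE) (sqE (tensor_op id A g)); last first.
  move=> i; rewrite ffunE /orthosum.
  under eq_bigr do rewrite inner_suml scaler_suml.
  rewrite exchange_big/=; apply: eq_bigr => j _.
  rewrite -[in RHS]gE /orthosum scaler_sumr.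
  by apply: eq_bigr => l _; rewrite innerZl -scalerA.
rewrite mulr_sumr; apply: ler_sum => l _; rewrite -exprMn.
rewrite ler_pXn2r ?nnegrE ?euclid_norm_ge0 ?mulr_ge0 ?mxopnorm_ge0 ?euclid_norm_ge0//.
apply: le_trans (le_mxopnorm A _); rewrite le_eqVlt; apply/orP; left; apply/eqP.
congr euclid_norm; apply/matrixP => i k; rewrite !mxE ffunE inner_suml.
by apply: eq_bigr => j _; rewrite innerZl mxE.
Qed.

End matrix_norm.

Lemma cvg_exprn (C : numFieldType) (T : Type) (F : set_system T) (FF : Filter F)
  (f : T -> C) (l : C) n : f @ F --> l -> f x ^+ n @[x --> F] --> l ^+ n.
Proof.
move=> fl; elim: n => [|n IH].
  by rewrite expr0 (_ : (fun x => _) = fun=> 1); [exact: cvg_cst|apply/funext].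
rewrite exprS (_ : (fun x => _) = fun x => f x * f x ^+ n); first exact: cvgM.
by apply/funext => x; rewrite exprS.
Qed.

(** * Existence of the maximum over the unit circle *)

Section circle_maximum.
Variables (R : realType) (m d : nat) (A0 : 'M[R[i]]_m) (A : 'I_d -> 'M[R[i]]_m).

Let p (z : R[i]) := A0 + \sum_(k < d) z ^+ k.+1 *: A k.

Let mxopnorm_lip z w : `|mxopnorm (p z) - mxopnorm (p w)| <=
  \sum_(k < d) rnorm (z ^+ k.+1 - w ^+ k.+1) * mxopnorm (A k).
Proof.
have key a b : mxopnorm (p a) <= mxopnorm (p b) +
    \sum_(k < d) rnorm (a ^+ k.+1 - b ^+ k.+1) * mxopnorm (A k).
  have -> : p a = p b + \sum_(k < d) (a ^+ k.+1 - b ^+ k.+1) *: A k.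
    rewrite /p -addrA; congr (_ + _); rewrite -big_split/=.
    by apply: eq_bigr => k _; rewrite scalerBl addrC subrK.
  apply: le_trans (ler_mxopnormD _ _) _; rewrite lerD2l.
  apply: le_trans (ler_mxopnorm_sum _ _) _.
  by apply: ler_sum => k _; exact: mxopnormZ_le.
rewrite ler_norml; apply/andP; split; last by rewrite lerBlDl key.
rewrite lerBrDr addrC lerBlDr (le_trans (key w z))// lerD2l.
by apply: ler_sum => k _; rewrite rnorm_distC.
Qed.

(** For [s = 1] and [s = -1] these are the two closed half circles, parametrised by the real part;
    the extreme value theorem on [[-1, 1]] applies to each. *)
Let arc (s t : R) : R[i] := t%:C%C + s%:C%C * ('i%C * (Num.sqrt (1 - t ^+ 2))%:C%C).

Let arc_continuous s : continuous (arc s : R -> (R[i] : numFieldType)).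
Proof.
have realC : continuous (real_complex R : R -> (R[i] : numFieldType)).
  move=> x; apply/cvgrPdist_lt => e e0.
  have [r [-> r0]] : exists r : R, e = r%:C%C /\ 0 < r.
    by case: e e0 => a b; rewrite ltcE/= => /andP[/eqP -> ?]; exists a.
  have /cvgrPdist_lt/(_ r r0) : y @[y --> x] --> x by exact: cvg_id.
  by apply: filterS => y; rewrite -rmorphB/= rnormE rnorm_real ltcR.
move=> t; apply: cvgD; first exact: realC.
apply: cvgM; first exact: cvg_cst.
apply: cvgM; first exact: cvg_cst.
apply: (@cvg_comp _ _ _ (fun t => Num.sqrt (1 - t ^+ 2)) (real_complex R)); last exact: realC.
apply: (@cvg_comp _ _ _ (fun t : R => 1 - t ^+ 2) Num.sqrt); last exact: sqrt_continuous.
by apply: cvgB; [exact: cvg_cst|exact: exprn_continuous].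
Qed.

Let norm_arc_continuous s : continuous (fun t => mxopnorm (p (arc s t))).
Proof.
move=> t.
have powc n : (arc s t' ^+ n : (R[i] : numFieldType)) @[t' --> t] -->
    (arc s t ^+ n : (R[i] : numFieldType)).
  exact: (@cvg_exprn R[i] _ _ _ _ _ n (@arc_continuous s t)).
have cv : \sum_(k < d) rnorm (arc s t ^+ k.+1 - arc s t' ^+ k.+1) * mxopnorm (A k)
    @[t' --> t] --> \sum_(k < d) 0 * mxopnorm (A k).
  apply: (@cvg_big R 'I_d +%R 0 xpredT); first exact: add_continuous.
  move=> k _; apply: cvgM; last exact: cvg_cst.
  apply/cvgrPdist_lt => e e0.
  have eC : 0 < e%:C%C :> R[i] by rewrite ltcR.
  move: (powc k.+1) => /cvgrPdist_lt/(_ _ eC); apply: filterS => t'.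
  by rewrite rnormE ltcR sub0r normrN ger0_norm ?rnorm_ge0.
apply/cvgrPdist_lt => e e0; move/cvgrPdist_lt/(_ e e0) : cv; apply: filterS => t'.
rewrite [X in `|X - _|]big1 => [|k _]; last by rewrite mul0r.
rewrite sub0r normrN => /(le_lt_trans (ler_norm _)).
by apply: le_lt_trans; exact: mxopnorm_lip.
Qed.

Lemma circle_max_exists : exists M : R,
  is_max [set mxopnorm (p z) | z in [set z : R[i] | `|z| = 1]] M.
Proof.
have arcE s t : arc s t = (t +i* (s * Num.sqrt (1 - t ^+ 2)))%C.
  by apply/eqP; rewrite eq_complex /arc /=; apply/andP; split; apply/eqP; ring.
have arc_circle s t : s ^+ 2 = 1 -> t \in `[-1, 1] -> `|arc s t| = 1.
  move=> s1; rewrite in_itv/= => /andP[t1 t2].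
  have t21 : 0 <= 1 - t ^+ 2 by rewrite (_ : _ - _ = (1 - t) * (1 + t));
    [rewrite mulr_ge0//; lra|ring].
  rewrite rnormE; congr (_%:C)%C.
  apply/eqP; rewrite -(@eqrXn2 _ 2) ?rnorm_ge0// sqr_rnorm arcE /= expr1n.
  by rewrite exprMn s1 mul1r sqr_sqrtr//; apply/eqP; ring.
have circle_arc z : `|z| = 1 -> exists s, exists t,
    [/\ s ^+ 2 = 1, t \in `[-1, 1] & z = arc s t] /\ (s = 1 \/ s = -1).
  rewrite rnormE => /complexI z1.
  have := sqr_rnorm z; rewrite z1 expr1n; case: z {z1} => a b /= ab.
  have a1 : a \in `[-1, 1] by rewrite in_itv/=; apply/andP; split; nra.
  have [b0|b0] := leP 0 b.
    exists 1, a; split; last by left.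
    split=> //; first by rewrite expr1n.
    rewrite arcE mul1r; congr (_ +i* _)%C.
    by rewrite (_ : 1 - a ^+ 2 = b ^+ 2) ?sqrtr_sqr ?ger0_norm//; lra.
  exists (-1), a; split; last by right.
  split=> //; first by rewrite sqrrN expr1n.
  rewrite arcE mulN1r; congr (_ +i* _)%C.
  by rewrite (_ : 1 - a ^+ 2 = b ^+ 2) ?sqrtr_sqr ?ltr0_norm ?opprK//; lra.
have max_arc s : exists2 c, c \in `[-1, 1] &
    forall t, t \in `[-1, 1] -> mxopnorm (p (arc s t)) <= mxopnorm (p (arc s c)).
  apply: EVT_max; first lra.
  by apply: continuous_subspaceT => t; exact: norm_arc_continuous.
have [c1 c1I c1P] := max_arc 1; have [c2 c2I c2P] := max_arc (-1).
have o1 : (1 : R) ^+ 2 = 1 by rewrite expr1n.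
have o2 : (-1 : R) ^+ 2 = 1 by rewrite sqrrN expr1n.
pose M1 := mxopnorm (p (arc 1 c1)); pose M2 := mxopnorm (p (arc (-1) c2)).
exists (Num.max M1 M2); split.
  rewrite /Num.max; case: ifP => _.
    by exists (arc (-1) c2) => //=; exact: arc_circle.
  by exists (arc 1 c1) => //=; exact: arc_circle.
move=> _ [z /= /circle_arc[s [t [[s1 tI ->] [->|->]]]] <-].
  by apply: (le_trans (c1P _ tI)); rewrite -/M1; move: (M1) (M2) => a b; rewrite le_max lexx.
by apply: (le_trans (c2P _ tI)); rewrite -/M2; move: (M1) (M2) => a b; rewrite le_max lexx orbT.
Qed.

End circle_maximum.

(** * Roots of unity and the discrete Fourier transform *)

Section roots_of_unity.
Variable C : numClosedFieldType.

Lemma primitive_root_exists n : (0 < n)%N -> exists z : C, n.-primitive_root z.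
Proof.
pose p : {poly C} := 'X^n - 1; have [r Dp] := closed_field_poly_normal p.
move=> n_gt0; rewrite (monicP _) ?monicXnsubC// scale1r in Dp.
have rn1 : all n.-unity_root r by apply/allP=> z; rewrite -root_prod_XsubC -Dp.
have sz_r : (n < (size r).+1)%N.
  by rewrite -(size_prod_XsubC r id) -Dp size_XnsubC.
have [|z _ ?] := hasP (has_prim_root n_gt0 rn1 _ sz_r); last by exists z.
by rewrite -separable.separable_prod_XsubC -Dp separable_Xn_sub_1// pnatr_eq0 -lt0n.
Qed.

Lemma primitive_root_norm n (z : C) : n.-primitive_root z -> `|z| = 1.
Proof.
move=> zp; have n0 := prim_order_gt0 zp; apply/eqP.
rewrite -(@pexpr_eq1 _ _ n) ?normr_ge0//.
by rewrite -normrX (prim_expr_order zp) normr1.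
Qed.

(** A geometric sum whose ratio is an [n]-th root of unity, equal to 1 only if [s = t] because both
    exponents are below [n]. *)
Lemma sum_roots_of_unity n (z : C) s t : n.-primitive_root z ->
  (s < n)%N -> (t < n)%N ->
  \sum_(a < n) (z ^+ a) ^+ s * ((z ^+ a) ^+ t)^* = if s == t then n%:R else 0.
Proof.
move=> zp sn tn; have z1 := primitive_root_norm zp.
have n0 := prim_order_gt0 zp.
pose q := z ^+ s * (z ^+ t)^*.
have zt1 : z ^+ t * (z ^+ t)^* = 1 by rewrite -normCK normrX z1 !expr1n.
have -> : \sum_(a < n) (z ^+ a) ^+ s * ((z ^+ a) ^+ t)^* = \sum_(a < n) q ^+ a.
  apply: eq_bigr => a _; rewrite exprMn -!exprM [(a * s)%N]mulnC [(a * t)%N]mulnC.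
  by rewrite !exprM rmorphXn.
case: (eqVneq s t) => [st|st].
  rewrite /q st zt1; under eq_bigr do rewrite expr1n.
  by rewrite sumr_const card_ord.
have q1 : q != 1.
  apply: contra st => /eqP q1.
  have : z ^+ s == z ^+ t.
    by rewrite -[z ^+ s]mulr1 -zt1 [z ^+ t * _]mulrC mulrA -/q q1 mul1r.
  by rewrite (eq_prim_root_expr zp) !modn_small.
apply/eqP; have := subrX1 q n; rewrite exprMn -rmorphXn -!exprM.
rewrite [(s * n)%N]mulnC [(t * n)%N]mulnC !exprM (prim_expr_order zp) !expr1n rmorph1.
by rewrite mulr1 subrr => /esym/eqP; rewrite mulf_eq0 subr_eq0 (negPf q1).
Qed.

End roots_of_unity.

Section cyclic_dilation.
Variables (R : realType) (H K : hilbertType R) (d : nat) (T : 'I_d -> {linear H -> H}).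
Variables (J : {linear H -> K}) (U : {linear K -> K}).
Hypotheses (Ji : isometric_embedding J) (Ui : isometric_embedding U).
Hypothesis TU : forall k x y, inner (T k x) y = inner (iter k.+1 U (J x)) (J y).

Lemma iter_linear n : linear (iter n U).
Proof. by elim: n => [|n IH] a x y //=; rewrite IH linearP. Qed.

(* [V a x] is the normalised discrete Fourier transform of the finite orbit
   (U^(L-1-n) J x)_(n < L), zero-padded to length L + d to avoid wrap-around: the
   diagonal unitary diag(z) then plays the role of U up to the factor 1 - k/L. *)
Lemma cyclic_dilation L : (0 < L)%N ->
  exists P (z : 'I_P -> R[i]) (V : 'I_P -> {linear H -> K}),
  [/\ forall a, `|z a| = 1,
      forall x y, \sum_(a < P) inner (V a x) (V a y) = inner x y &
      forall (k : 'I_d) x y, \sum_(a < P) z a ^+ k.+1 * inner (V a x) (V a y) =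
        ((L - k.+1)%:R / L%:R) * inner (T k x) y].
Proof.
move=> L0; pose P := (L + d)%N; have P0 : (0 < P)%N by rewrite addn_gt0 L0.
have [w wp] := primitive_root_exists R[i] P0.
have w1 := primitive_root_norm wp.
(* [P] compensates the sum over the roots of unity and [L] the number of orbit vectors. *)
pose c : R[i] := (Num.sqrt (P%:R * L%:R)^-1)%:C%C.
(* The powers of [U] decrease with [n], so that pairing [n] on the left with [k + n] on the right
   leaves [U^k] on the left. *)
pose v (a : 'I_P) (x : H) := \sum_(n < L) (w ^+ a) ^+ n *: iter (L - n.+1) U (J x).
have vlin a : linear (fun x => c *: v a x).
  move=> b x y; rewrite /v !scaler_sumr -big_split/=; apply: eq_bigr => n _.
  rewrite linearP iter_linear !scalerDr !scalerA.
  by rewrite [_ * b]mulrC mulrA.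
have cc : c * c^* = (P%:R * L%:R)^-1.
  rewrite conjC_real -rmorphM/= -expr2 sqr_sqrtr ?invr_ge0 ?mulr_ge0 ?ler0n//.
  by rewrite fmorphV rmorphM/= !rmorph_nat.
have Uiter n a b : inner (iter n U a) (iter n U b) = inner a b.
  by elim: n => //= n IH; rewrite isometric_inner.
have key (k : nat) x y : (k <= d)%N ->
    \sum_(a < P) (w ^+ a) ^+ k * inner (c *: v a x) (c *: v a y) =
    ((L - k)%:R / L%:R) * inner (iter k U (J x)) (J y).
  move=> kd.
  transitivity ((P%:R * L%:R)^-1 * \sum_(n < L) \sum_(n' < L)
      (\sum_(a < P) (w ^+ a) ^+ (k + n) * ((w ^+ a) ^+ n')^*) *
      inner (iter (L - n.+1) U (J x)) (iter (L - n'.+1) U (J y))).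
    under [in RHS]eq_bigr do under eq_bigr do rewrite mulr_suml.
    under [in RHS]eq_bigr do rewrite exchange_big/=.
    rewrite exchange_big/= mulr_sumr; apply: eq_bigr => a _.
    rewrite innerZl innerZr [c * (_ * _)]mulrA cc mulrCA; congr (_ * _).
    rewrite inner_suml mulr_sumr; apply: eq_bigr => n _.
    rewrite inner_sumr mulr_sumr; apply: eq_bigr => n' _.
    by rewrite innerZl innerZr exprD !mulrA.
  (* Both [k + n] and [n'] are below [P = L + d], so orthogonality forces [n' = k + n] and not
     merely a congruence; this has a solution below [L] only for [n < L - k]. *)
  have row (n : 'I_L) : \sum_(n' < L)
      (\sum_(a < P) (w ^+ a) ^+ (k + n) * ((w ^+ a) ^+ n')^*) *
      inner (iter (L - n.+1) U (J x)) (iter (L - n'.+1) U (J y)) =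
      if (n < L - k)%N then P%:R * inner (iter k U (J x)) (J y) else 0.
    have nL := ltn_ord n.
    have sumE (n' : 'I_L) : \sum_(a < P) (w ^+ a) ^+ (k + n) * ((w ^+ a) ^+ n')^* =
        if (k + n)%N == n' then P%:R else 0.
      by apply: sum_roots_of_unity => //; have := ltn_ord n'; rewrite /P; lia.
    case: ifP => [nk|nk]; last first.
      apply: big1 => n' _; rewrite sumE ifF ?mul0r//.
      by apply/eqP => E; have := ltn_ord n'; lia.
    have knL : (k + n < L)%N by lia.
    rewrite (bigD1 (Ordinal knL))//= [X in _ + X]big1 ?addr0; last first.
      move=> n' n'E; rewrite sumE ifF ?mul0r//; apply: contraNF n'E => /eqP E.
      by apply/eqP/val_inj; rewrite /= E.
    have /= -> := sumE (Ordinal knL); rewrite eqxx; congr (_ * _).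
    by rewrite (_ : (L - n.+1 = (L - (k + n).+1) + k)%N) ?iterD ?Uiter//; lia.
  under [in LHS]eq_bigr do rewrite row.
  rewrite -big_mkcond/= -(big_ord_widen L (fun=> P%:R * inner (iter k U (J x)) (J y)))
    ?leq_subr// sumr_const_ord.
  by field; rewrite !pnatr_eq0 -!lt0n L0 P0.
exists P, (fun a => w ^+ a), (fun a => linear_of (vlin a)); split.
- by move=> a; rewrite normrX w1 expr1n.
- move=> x y; have := key 0%N x y (leq0n _); rewrite subn0 divff ?pnatr_eq0 -?lt0n//.
  rewrite mul1r isometric_inner// => <-; apply: eq_bigr => a _.
  by rewrite expr0 mul1r.
- by move=> k x y; rewrite TU; exact: key.
Qed.

End cyclic_dilation.

(** * The matrix inequality for a dilated tuple *)

Section matrix_von_neumann.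
Variables (R : realType) (H K : hilbertType R) (d : nat) (T : 'I_d -> {linear H -> H}).
Variables (J : {linear H -> K}) (U : {linear K -> K}).
Hypotheses (Ji : isometric_embedding J) (Ui : isometric_embedding U).
Hypothesis TU : forall k x y, inner (T k x) y = inner (iter k.+1 U (J x)) (J y).
Variables (m : nat) (A0 : 'M[R[i]]_m) (A : 'I_d -> 'M[R[i]]_m).

Let p (z : R[i]) := A0 + \sum_(k < d) z ^+ k.+1 *: A k.

Variable M : R.
Hypothesis pM : forall z : R[i], `|z| = 1 -> mxopnorm (p z) <= M.

Let M0 : 0 <= M.
Proof. by apply: le_trans (pM (normr1 _)); exact: mxopnorm_ge0. Qed.

(* The factor (L - k)/L comes from [cyclic_dilation] and tends to 1. *)
Let inner_approx L (x y : hpow m H) : (0 < L)%N ->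
  rnorm (inner (tensor_op id A0 x) y + \sum_(k < d)
    ((L - k.+1)%:R / L%:R) * inner (tensor_op (T k) (A k) x) y) <=
  M * rnorm x * rnorm y.
Proof.
move=> L0; have [P [z [V [z1 Viso VT]]]] := cyclic_dilation Ji Ui TU L0.
(* [g] is isometric, and block [a] of [D] is the matrix [p (z a)] acting on [K (x) C^m], of norm at
   most [M]. The form to be bounded is [<D (g x), g y>]. *)
pose g (x : hpow m H) : hpow P (hpow m K) := [ffun a => [ffun i => V a (x i)]].
have gn x' : rnorm (g x') = rnorm x'.
  apply/eqP; rewrite -(@eqrXn2 _ 2)// ?rnorm_ge0// !rnorm_hpow.
  under eq_bigr do rewrite ffunE rnorm_hpow.
  rewrite exchange_big/=; apply/eqP/eq_bigr => i _.
  rewrite -(Re_inner_rnorm (x' i)) -Viso raddf_sum; apply: eq_bigr => a _.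
  by rewrite ffunE -Re_inner_rnorm.
pose D (h : hpow P (hpow m K)) : hpow P (hpow m K) :=
  [ffun a => tensor_op id (p (z a)) (h a)].
have Dn h : rnorm (D h) <= M * rnorm h.
  rewrite -(@ler_pXn2r _ 2)// ?nnegrE ?rnorm_ge0 ?mulr_ge0 ?rnorm_ge0//.
  rewrite exprMn !rnorm_hpow mulr_sumr; apply: ler_sum => a _.
  rewrite -exprMn ler_pXn2r ?nnegrE ?rnorm_ge0 ?mulr_ge0 ?rnorm_ge0//.
  rewrite ffunE; apply: le_trans (tensor_op_le_mxopnorm _ _) _.
  by rewrite ler_wpM2r ?rnorm_ge0// pM.
suff -> : inner (tensor_op id A0 x) y + \sum_(k < d)
    ((L - k.+1)%:R / L%:R) * inner (tensor_op (T k) (A k) x) y = inner (D (g x)) (g y).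
  apply: le_trans (rnorm_inner _ _) _; rewrite gn ler_wpM2r ?rnorm_ge0//.
  by apply: le_trans (Dn _) _; rewrite gn.
rewrite [RHS]inner_hpow; under [RHS]eq_bigr do rewrite !ffunE inner_tensor_op.
rewrite [RHS]exchange_big/= inner_tensor_op.
under [X in _ + X]eq_bigr do rewrite inner_tensor_op mulr_sumr.
rewrite [X in _ + X]exchange_big/= -big_split/=; apply: eq_bigr => i _.
rewrite [RHS]exchange_big/=; under [X in _ + X]eq_bigr do rewrite mulr_sumr.
rewrite [X in _ + X]exchange_big/= -big_split/=; apply: eq_bigr => j _.
transitivity (\sum_(a < P) (A0 i j * inner (V a (x j)) (V a (y i)) +
    \sum_(k < d) A k i j * (z a ^+ k.+1 * inner (V a (x j)) (V a (y i))))).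
  rewrite big_split/= -mulr_sumr Viso; congr (_ + _).
  rewrite exchange_big/=; apply: eq_bigr => k _.
  by rewrite -mulr_sumr VT mulrCA.
apply: eq_bigr => a _; rewrite !ffunE /p !mxE mulrDl; congr (_ + _).
rewrite summxE mulr_suml; apply: eq_bigr => k _.
by rewrite mxE mulrA [A k i j * _]mulrC.
Qed.

(** Replacing [(L - k)/L] by 1 costs [k/L] in the term of [T_k], in total [C / L]; let [L] grow,
    then put [y = f x]. *)
Lemma matrix_von_neumann (x : hpow m H) :
  rnorm (tensor_op id A0 x + \sum_(k < d) tensor_op (T k) (A k) x) <= M * rnorm x.
Proof.
set f := (fun x : hpow m H => tensor_op id A0 x + \sum_(k < d) tensor_op (T k) (A k) x).
rewrite -/(f x).
have bound y : rnorm (inner (f x) y) <= M * rnorm x * rnorm y.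
  pose tau k := inner (tensor_op (T k) (A k) x) y.
  pose C := \sum_(k < d) k.+1%:R * rnorm (tau k).
  have C0 : 0 <= C by apply: sumr_ge0 => k _; rewrite mulr_ge0 ?rnorm_ge0.
  have approx L : (d <= L)%N -> (0 < L)%N ->
      rnorm (inner (f x) y) <= M * rnorm x * rnorm y + C / L%:R.
    move=> dL L0; have := inner_approx x y L0; set w := _ + _ => wM.
    rewrite -(subrK w (inner (f x) y)) addrC; apply: le_trans (ler_rnormD _ _) _.
    apply: lerD => //; rewrite /w /f innerDl inner_suml opprD addrACA subrr add0r.
    rewrite -sumrB; apply: le_trans (ler_rnorm_sum _ _ _) _.
    rewrite /C mulr_suml; apply: ler_sum => k _; rewrite -/(tau k).
    have -> : tau k - (L - k.+1)%:R / L%:R * tau k = (k.+1%:R / L%:R)%:C%C * tau k.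
      rewrite -[X in X - _]mul1r -mulrBl; congr (_ * _).
      rewrite natrB ?(leq_trans (ltn_ord k))// rmorphM/= fmorphV !rmorph_nat.
      by field; rewrite pnatr_eq0 -lt0n.
    by rewrite rnormM rnorm_real ger0_norm ?divr_ge0// mulrAC.
  apply/ler_addgt0Pr => e e0.
  (* [L >= d] makes [L - k] a true difference, and [L > C / e] makes the error at most [e]. *)
  pose L := maxn d (Num.truncn (C / e)).+1.
  have L0 : (0 < L)%N by rewrite /L leq_max orbT.
  apply: le_trans (approx L _ L0) _; first by rewrite leq_max leqnn.
  rewrite lerD2l ler_pdivrMr ?ltr0n// mulrC -ler_pdivrMr//.
  apply: le_trans (ltW (truncnS_gt _)) _; rewrite ler_nat /L leq_max.
  by rewrite leqnn orbT.
have := bound (f x); rewrite inner_rnorm rnorm_real ger0_norm ?sqr_ge0// expr2.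
have [->|n0] := eqVneq (rnorm (f x)) 0; first by rewrite mulr_ge0 ?rnorm_ge0.
by rewrite ler_pM2r// lt_def n0 rnorm_ge0.
Qed.

End matrix_von_neumann.

(** * From the matrix inequality to positivity *)

Section lower_triangular.
Variables (R : realType) (H : hilbertType R) (d : nat) (T : 'I_d -> {linear H -> H}).
Hypothesis T_bounded : forall k, bounded_op (T k).

(** This is the power [S^(k+1)] of the shift matrix; [toeplitz_lower] below is [F(T)]. *)
Definition subdiagonal (k : 'I_d) : 'M[R[i]]_d.+1 :=
  \matrix_(i, j) (i == j + k.+1 :> nat)%N%:R.

Definition toeplitz_lower (x : hpow d.+1 H) : hpow d.+1 H :=
  (2^-1)%:C%C *: x + \sum_(k < d) tensor_op (T k) (subdiagonal k) x.

Lemma inner_toeplitz_lower x : inner (toeplitz_op T x) x =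
  inner (toeplitz_lower x) x + (inner (toeplitz_lower x) x)^*.
Proof.
pose low (i j : 'I_d.+1) : R[i] :=
  if (j < i)%N then inner (toeplitz_coef T (inord (i - j)) (x j)) (x i) else 0.
have lowE : inner (toeplitz_lower x) x =
    (2^-1)%:C%C * inner x x + \sum_i \sum_j low i j.
  rewrite /toeplitz_lower innerDl innerZl inner_suml; congr (_ + _).
  under eq_bigr do rewrite inner_tensor_op.
  rewrite exchange_big/=; apply: eq_bigr => i _.
  rewrite exchange_big/=; apply: eq_bigr => j _.
  rewrite /low; case: ltnP => ji; last first.
    apply: big1 => k _; rewrite mxE (_ : (_ == _) = false) ?mul0r//.
    by apply/eqP; lia.
  have ijd : (i - j.+1 < d)%N by have := ltn_ord i; lia.
  rewrite (bigD1 (Ordinal ijd))//= [X in _ + X]big1 ?addr0.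
    rewrite mxE /= (_ : (_ == _) = true) ?mul1r; last by apply/eqP; lia.
    by rewrite -(toeplitz_coefS T (Ordinal ijd)) /= subnSK.
  move=> k kE; rewrite mxE (_ : (_ == _) = false) ?mul0r//.
  by apply: contraNF kE => /eqP E; apply/eqP/val_inj => /=; lia.
rewrite inner_toeplitz_op//.
transitivity (\sum_(i < d.+1) \sum_(j < d.+1)
    (low i j + (low j i)^* + (if i == j then inner (x i) (x i) else 0))).
  apply: eq_bigr => i _; apply: eq_bigr => j _.
  rewrite inner_toeplitz_entry// /low -val_eqE/=; case: (ltngtP i j) => ij.
  - by rewrite add0r addr0 -innerC.
  - by rewrite conjC0 !addr0.
  - rewrite (val_inj ij) subnn conjC0 !add0r (_ : inord 0 = ord0) ?toeplitz_coef0//.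
    by apply/val_inj; rewrite /= inordK.
under eq_bigr do rewrite !big_split/=.
have conjE (t : R) (u v : R[i]) : (t%:C%C * u + v)^* = t%:C%C * u^* + v^*.
  by rewrite rmorphD rmorphM/= conjC_real.
rewrite !big_split lowE conjE.
have -> : (inner x x)^* = inner x x by rewrite -innerC.
have -> : \sum_(i < d.+1) \sum_(j < d.+1) (if i == j then inner (x i) (x i) else 0) =
    inner x x.
  rewrite inner_hpow; apply: eq_bigr => i _.
  by rewrite (bigD1 i)//= eqxx big1 ?addr0// => j /negPf; rewrite eq_sym => ->.
have -> : \sum_(i < d.+1) \sum_(j < d.+1) (low j i)^* = (\sum_i \sum_j low i j)^*.
  by rewrite exchange_big/= rmorph_sum; apply: eq_bigr => i _; rewrite rmorph_sum.
move: (\sum_i _) (_^*) (inner x x) => a b c.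
have half : (2^-1)%:C%C + (2^-1)%:C%C = 1 :> R[i].
  by rewrite -rmorphD/= (_ : 2^-1 + 2^-1 = 1 :> R)//; field.
rewrite /= -[c in LHS]mul1r -half; ring.
Qed.

Lemma toeplitz_contractiveP :
  toeplitz_contractive T <-> forall x, 0 <= complex.Re (inner (toeplitz_lower x) x).
Proof.
have E x : inner (toeplitz_op T x) x = (2 * complex.Re (inner (toeplitz_lower x) x))%:C%C.
  rewrite inner_toeplitz_lower; case: (inner _ _) => a b.
  by apply/eqP; rewrite eq_complex/= subrr eqxx andbT; apply/eqP; ring.
split=> [Tc x|h x]; last by rewrite E ler0c mulr_ge0.
by have := Tc x; rewrite E ler0c pmulr_rge0.
Qed.

Lemma toeplitz_lower_le x : (forall k x, rnorm (T k x) <= rnorm x) ->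
  rnorm (toeplitz_lower x) <= (1 + \sum_k mx_bound (subdiagonal k)) * rnorm x.
Proof.
move=> T1; apply: le_trans (ler_rnormD _ _) _; rewrite mulrDl lerD//.
  rewrite rnormZ rnorm_real ger0_norm ?invr_ge0// ler_wpM2r ?rnorm_ge0//.
  by rewrite invf_le1// ler1n.
apply: le_trans (ler_rnorm_sum _ _ _) _; rewrite mulr_suml.
apply: ler_sum => k _; rewrite -[mx_bound _]mulr1; apply: tensor_op_le => // h.
by rewrite mul1r.
Qed.

(** These coefficients exhibit [t - F(T)] as a polynomial of the kind occurring in (b). *)
Lemma resolvent_lowerE (t : R) x :
  tensor_op id (t - 2^-1)%:C%:M%C x + \sum_(k < d) tensor_op (T k) (- subdiagonal k) x =
  t%:C%C *: x - toeplitz_lower x.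
Proof.
apply/ffunP => i; rewrite !ffunE !hpow_sum opprD.
have -> : \sum_(j < d.+1) ((t - 2^-1)%:C%:M%C : 'M[R[i]]_d.+1) i j *: x j =
    t%:C%C *: x i - (2^-1)%:C%C *: x i.
  rewrite (bigD1 i)//= big1 ?addr0.
    by rewrite mxE eqxx mulr1n rmorphB/= scalerBl.
  by move=> j /negPf ji; rewrite mxE eq_sym ji mulr0n scale0r.
rewrite addrA; congr (_ + _); rewrite -sumrN; apply: eq_bigr => k _.
rewrite !ffunE -sumrN; apply: eq_bigr => j _.
by rewrite !mxE scaleNr.
Qed.

Lemma rnorm_resolvent_lower (t : R) x :
  rnorm (t%:C%C *: x - toeplitz_lower x) ^+ 2 = t ^+ 2 * rnorm x ^+ 2 -
    2 * t * complex.Re (inner (toeplitz_lower x) x) + rnorm (toeplitz_lower x) ^+ 2.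
Proof.
rewrite rnormD_sqr rnormN rnormZ rnorm_real innerNr innerZl raddfN/= Re_realM.
rewrite (Re_innerC (toeplitz_lower x)) exprMn real_normK ?num_real//.
by move: (rnorm x ^+ 2) (rnorm _ ^+ 2) (complex.Re _) => a b c; ring.
Qed.

End lower_triangular.

Section matrix_side.
Variables (R : realType) (d : nat).

Lemma tensor_matrix_polynomial (H : hilbertType R) m (e : H) (z : R[i])
    (A0 : 'M[R[i]]_m) (A : 'I_d -> 'M[R[i]]_m) (v : 'cV[R[i]]_m) :
  tensor e ((A0 + \sum_(k < d) z ^+ k.+1 *: A k) *m v) =
  tensor_op id A0 (tensor e v) +
  \sum_(k < d) tensor_op (fun h => z ^+ k.+1 *: h) (A k) (tensor e v).
Proof.
apply/ffunP => i; rewrite hpowD hpow_sum !ffunE mulmxDl mulmx_suml mxE summxE.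
rewrite scalerDl; congr (_ + _).
  by rewrite mxE scaler_suml; apply: eq_bigr => j _; rewrite ffunE scalerA.
rewrite scaler_suml; apply: eq_bigr => k _.
rewrite ffunE -scalemxAl !mxE mulr_sumr scaler_suml; apply: eq_bigr => j _.
by rewrite ffunE !scalerA mulrCA mulrA.
Qed.

Let C : R := 1 + \sum_(k < d) mx_bound (subdiagonal R k).

(** The scalars [z^k] act on [l2Z] as powers of the isometry [z], so this tuple is
    Toeplitz-contractive and the cross term [- 2 t Re <F x, x>] is at most 0; [C] bounds [F].
    Vectors of [C^m] enter as [tensor] with a unit vector. *)
Lemma mxopnorm_resolvent (t : R) (z : R[i]) : 0 <= t -> `|z| = 1 ->
  mxopnorm ((t - 2^-1)%:C%:M%C + \sum_(k < d) z ^+ k.+1 *: - subdiagonal R k) <=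
  Num.sqrt (t ^+ 2 + C ^+ 2).
Proof.
move=> t0 z1; have zr : rnorm z = 1 by move: z1; rewrite rnormE => /complexI.
have zlin n : linear (fun h : l2Z R => z ^+ n *: h).
  by move=> a u v; rewrite scalerDr !scalerA [a * _]mulrC.
pose T (k : 'I_d) : {linear l2Z R -> l2Z R} := linear_of (zlin k.+1).
have T1 k x : rnorm (T k x) <= rnorm x.
  by rewrite /T /linear_of rnormZ rnormX zr expr1n mul1r.
have Tb k : bounded_op (T k).
  by apply/bounded_opP; exists 1 => // x; rewrite mul1r T1.
have Tc : toeplitz_contractive T.
  have z1lin : linear (fun h : l2Z R => z *: h) := zlin 1%N.
  apply: (@toeplitz_contractive_isometry _ _ _ _ _ _ idfun (linear_of z1lin)) => //.
    move=> x y; change (inner (z *: x) (z *: y) = inner x y).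
    by rewrite innerZl innerZr mulrA -normCK z1 expr1n mul1r.
  move=> k x y.
  change (inner (z ^+ k.+1 *: x) y = inner (iter k.+1 ( *:%R z) x) y).
  suff -> : iter k.+1 ( *:%R z) x = z ^+ k.+1 *: x by [].
  elim: k.+1 => [|n IH]; first by rewrite scale1r.
  by rewrite iterS IH scalerA exprS.
apply: mxopnorm_le => [|v]; first exact: sqrtr_ge0.
have e1 : inner (l2Z_basis R 0) (l2Z_basis R 0) = 1.
  by rewrite inner_l2Z_basis eqxx.
rewrite -!(rnorm_tensor _ e1) tensor_matrix_polynomial.
rewrite -(@ler_pXn2r _ 2)// ?nnegrE ?rnorm_ge0 ?mulr_ge0 ?sqrtr_ge0 ?rnorm_ge0//.
set x := tensor _ v; rewrite exprMn sqr_sqrtr ?addr_ge0 ?sqr_ge0//.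
rewrite (_ : _ + _ = t%:C%C *: x - toeplitz_lower T x); last first.
  exact: (resolvent_lowerE T).
rewrite rnorm_resolvent_lower [leRHS]mulrDl.
have := (toeplitz_contractiveP Tb).1 Tc x.
have : rnorm (toeplitz_lower T x) ^+ 2 <= C ^+ 2 * rnorm x ^+ 2.
  have C0 : 0 <= C by rewrite addr_ge0// sumr_ge0// => k _; exact: mx_bound_ge0.
  rewrite -exprMn ler_pXn2r ?nnegrE ?rnorm_ge0 ?mulr_ge0 ?rnorm_ge0//.
  exact: toeplitz_lower_le.
move: (complex.Re _) (rnorm (toeplitz_lower T x) ^+ 2) (C ^+ 2 * _) (t ^+ 2 * _) => a b c e.
by move=> bc a0; have := mulr_ge0 t0 a0; lra.
Qed.

End matrix_side.

Section matrix_inequality.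
Variables (R : realType) (H : hilbertType R) (d : nat) (T : 'I_d -> {linear H -> H}).
Hypothesis T_bounded : forall k, bounded_op (T k).

Let f m (A0 : 'M[R[i]]_m) (A : 'I_d -> 'M[R[i]]_m) (x : hpow m H) : hpow m H :=
  tensor_op id A0 x + \sum_(k < d) tensor_op (T k) (A k) x.

Lemma matrix_polynomial_linear m A0 A : linear (@f m A0 A).
Proof.
move=> a x y; rewrite /f (tensor_op_linear (idfun : {linear H -> H})).
under eq_bigr do rewrite tensor_op_linear.
by rewrite big_split/= -scaler_sumr scalerDr addrACA.
Qed.

Lemma matrix_polynomial_bounded m A0 A :
  bounded_op (linear_of (@matrix_polynomial_linear m A0 A)).
Proof.
have /choice[c cP] : forall k, exists c : R, 0 <= c /\
    forall x, rnorm (T k x) <= c * rnorm x.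
  by move=> k; have /bounded_opP[c ? ?] := T_bounded k; exists c.
apply/bounded_opP; exists (mx_bound A0 * 1 + \sum_k mx_bound (A k) * c k).
  rewrite addr_ge0 ?mulr_ge0 ?mx_bound_ge0// sumr_ge0// => k _.
  by rewrite mulr_ge0 ?mx_bound_ge0//; case: (cP k).
move=> x; rewrite /linear_of /f; apply: le_trans (ler_rnormD _ _) _.
rewrite mulrDl; apply: lerD; first by apply: tensor_op_le => // h; rewrite mul1r.
apply: le_trans (ler_rnorm_sum _ _ _) _; rewrite mulr_suml.
by apply: ler_sum => k _; have [c0 ck] := cP k; exact: tensor_op_le.
Qed.

(** Comparing the expansion of [|(t - F(T)) x|^2] with the bound [(t^2 + C^2) |x|^2] cancels
    [t^2 |x|^2] and bounds [- 2 t Re <F(T) x, x>] uniformly in [t]. *)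
Lemma toeplitz_contractive_of_matrix_inequality :
  (forall (A0 : 'M[R[i]]_d.+1) (A : 'I_d -> 'M[R[i]]_d.+1),
     exists2 z : R[i], `|z| = 1 &
       opnorm (f A0 A) <= mxopnorm (A0 + \sum_(k < d) z ^+ k.+1 *: A k)) ->
  toeplitz_contractive T.
Proof.
move=> h; apply/toeplitz_contractiveP => // x.
pose C : R := 1 + \sum_(k < d) mx_bound (subdiagonal R k).
rewrite leNgt; apply/negP => r0; set r := complex.Re _ in r0.
have key t : 0 <= t -> - (2 * t * r) <= C ^+ 2 * rnorm x ^+ 2.
  move=> t0; have [z z1] := h (t - 2^-1)%:C%:M%C (fun k => - subdiagonal R k).
  move=> /le_trans/(_ (mxopnorm_resolvent d t0 z1)) fC.
  have fx : rnorm (f (t - 2^-1)%:C%:M%C (fun k => - subdiagonal R k) x) <=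
      opnorm (f (t - 2^-1)%:C%:M%C (fun k => - subdiagonal R k)) * rnorm x.
    exact: (le_opnorm x (@matrix_polynomial_bounded _ _ _)).
  have := le_trans fx (ler_wpM2r (rnorm_ge0 x) fC); rewrite /f resolvent_lowerE.
  rewrite -(@ler_pXn2r _ 2)// ?nnegrE ?rnorm_ge0 ?mulr_ge0 ?sqrtr_ge0 ?rnorm_ge0//.
  rewrite exprMn sqr_sqrtr ?addr_ge0 ?sqr_ge0// rnorm_resolvent_lower -/r -/C.
  have := sqr_ge0 (rnorm (toeplitz_lower T x)).
  rewrite [(_ + C ^+ 2) * _]mulrDl.
  by move: (t ^+ 2 * _) (2 * t * r) (C ^+ 2 * _) (_ ^+ 2) => *; lra.
set q := C ^+ 2 * _ in key; have q0 : 0 <= q by rewrite mulr_ge0 ?sqr_ge0.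
(* At this [t] the inequality [key] reads [q + 1 <= q]. *)
have t0 : 0 <= (q + 1) / (- (2 * r)) by rewrite divr_ge0 ?addr_ge0//; lra.
have := key _ t0; rewrite (_ : - _ = q + 1); first by lra.
by field; lra.
Qed.

End matrix_inequality.

Lemma rnormB_sqr (R : realType) (V : hilbertType R) (x y : V) : rnorm (x - y) ^+ 2 =
  rnorm x ^+ 2 + rnorm y ^+ 2 - 2 * complex.Re (inner x y).
Proof.
rewrite rnormD_sqr rnormN innerNr raddfN/=.
by move: (complex.Re _) => a; rewrite mulrN.
Qed.

Lemma norm_isometry (R : realType) (V W : hilbertType R) (f : {linear V -> W}) :
  (forall x, rnorm (f x) = rnorm x) -> isometric_embedding f.
Proof.
move=> fn.
have re x y : complex.Re (inner (f x) (f y)) = complex.Re (inner x y).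
  have := fn (x + y) => /(congr1 (fun t => t ^+ 2)).
  rewrite linearD !rnormD_sqr !fn; move: (complex.Re _) (complex.Re _) => a b.
  by move: (rnorm _ ^+ 2) (rnorm _ ^+ 2) => p q; lra.
move=> x y; have := re x ('i%C *: y); have := re x y.
rewrite linearZ/= !innerZr; case: (inner (f x) (f y)) => a b.
case: (inner x y) => p q /= -> h; congr (_ +i* _)%C; lra.
Qed.

(** * The bilateral shift is isometric *)

Section shift_isometry.
Variable R : realType.

Lemma rnorm_l2Z (f : l2Z R) : rnorm f ^+ 2 = sumZ (fun n => rnorm (f n) ^+ 2).
Proof.
rewrite -Re_inner_rnorm.
have -> : complex.Re (inner f f) = sumZ (fun n => complex.Re (f n * (f n)^*)) by [].
congr sumZ; apply/funext => n.
by rewrite -normCK rnormE -rmorphXn.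
Qed.

(** Shifting changes a partial sum by two boundary terms only. Each is squeezed between 0 and a
    grouped term of the convergent series, hence tends to 0. *)
Lemma sumZ_pred (u : int -> R) : (forall n, 0 <= u n) -> cvgn (Defs.seriesZ u) ->
  sumZ (fun n => u (n - 1)) = sumZ u.
Proof.
move=> u0 cu.
have NP k : Negz k - 1 = Negz k.+1 by rewrite !NegzE -opprD -PoszD addn1.
have PP k : Posz k.+1 - 1 = Posz k by rewrite -addn1 PoszD addrK.
have predE K : Defs.seriesZ (fun n => u (n - 1)) K.+1 =
    Defs.seriesZ u K.+1 + u (Negz K.+1) - u (Posz K).
  elim: K => [|K IH].
    have Z0 : Posz 0 - 1 = Negz 0 by [].
    by rewrite /Defs.seriesZ !seriesSr /series/= !big_geq// NP Z0 !add0r; ring.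
  have S w : Defs.seriesZ w K.+2 = Defs.seriesZ w K.+1 + (w (Posz K.+1) + w (Negz K.+1)).
    by rewrite /Defs.seriesZ seriesSr.
  by rewrite !S IH NP PP; ring.
have t0 : (fun k => u (Posz k) + u (Negz k)) @ \oo --> 0 by exact: cvg_series_cvg_0.
have P0 : (fun k => u (Posz k)) @ \oo --> 0.
  apply: (squeeze_cvgr _ (cvg_cst 0) t0).
  by apply: nearW => k; rewrite u0 lerDl u0.
have N0 : (fun k => u (Negz k)) @ \oo --> 0.
  apply: (squeeze_cvgr _ (cvg_cst 0) t0).
  by apply: nearW => k; rewrite u0 lerDr u0.
apply/cvg_lim => //; rewrite -cvg_shiftS.
rewrite (_ : (fun n => _) = fun K => Defs.seriesZ u K.+1 + u (Negz K.+1) - u (Posz K)); last first.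
  exact/funext.
rewrite -[sumZ u]addr0 -[_ + 0]subr0; apply: cvgB => //; apply: cvgD.
  by rewrite (cvg_shiftS (Defs.seriesZ u)).
by rewrite (cvg_shiftS (fun k => u (Negz k))).
Qed.

Lemma bilateral_shift_isometric : isometric_embedding (@bilateral_shift R).
Proof.
apply: norm_isometry => f; apply/eqP; rewrite -(@eqrXn2 _ 2) ?rnorm_ge0// !rnorm_l2Z.
apply/eqP; apply: (@sumZ_pred (fun n => rnorm (f n) ^+ 2)); last exact: l2ZP.
by move=> n; exact: sqr_ge0.
Qed.

Lemma iter_shift_basis k n :
  iter k (@bilateral_shift R) (l2Z_basis R n) = l2Z_basis R (n + k%:Z).
Proof.
elim: k => [|k IH]; first by rewrite addr0.
by rewrite iterS IH bilateral_shift_basis -addrA -PoszD addn1.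
Qed.

End shift_isometry.

Lemma cvgn_sum (C : numFieldType) (I : finType) (F : I -> nat -> C) (l : I -> C) :
  (forall c, F c @ \oo --> l c) -> \sum_c F c n @[n --> \oo] --> \sum_c l c.
Proof.
by move=> Fl; apply: (@cvg_big C I +%R 0 xpredT) => //; exact: add_continuous.
Qed.

(** * Approximating a diagonal unitary by the bilateral shift *)

Section shift_embedding.
Variables (R : realType) (H : hilbertType R) (f : nat -> H).
Hypotheses (fP : orthosystem f) (f_total : forall x, orthosum f n x @[n --> \oo] --> x).
Variables (I : finType) (X : I -> {linear H -> H}) (z : I -> R[i]).
Hypotheses (X_iso : forall x y, \sum_c inner (X c x) (X c y) = inner x y)
  (z_circle : forall c, `|z c| = 1).
Variables (d N : nat).
Hypothesis N_gt0 : (0 < N)%N.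

Let W : {linear l2Z R -> l2Z R} := @bilateral_shift R.

(* The blocks have length N + d, so that a vector supported in the first N entries
   of a block stays in that block when shifted by at most d. *)
Let pos (l : nat) (c : I) (s : nat) : nat := ((l * #|I| + enum_rank c) * (N + d) + s)%N.

Let pos_inj l c s l' c' s' : (s < N + d)%N -> (s' < N + d)%N ->
  pos l c s = pos l' c' s' -> [/\ l = l', c = c' & s = s'].
Proof.
move=> sN sN'; rewrite /pos => E.
have q0 : (0 < N + d)%N by rewrite addn_gt0 N_gt0.
have E1 := congr1 (divn^~ (N + d)%N) E; have E2 := congr1 (modn^~ (N + d)%N) E.
rewrite /= !divnMDl// !divn_small// !addn0 in E1.
rewrite /= !modnMDl !modn_small// in E2.
have I0 : (0 < #|I|)%N by apply/card_gt0P; exists c.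
have E3 := congr1 (divn^~ #|I|) E1; have E4 := congr1 (modn^~ #|I|) E1.
rewrite /= !divnMDl// !divn_small// !addn0 in E3.
rewrite /= !modnMDl !modn_small// in E4.
by split=> //; apply/enum_rank_inj/val_inj.
Qed.

(** A unit vector and approximate eigenvector of [W] for [z c]: moving the coefficients
    [(z c)^* ^+ r] one place up multiplies them by [z c], except at the two ends of the block. *)
Let b (l : nat) (c : I) : l2Z R := (Num.sqrt N%:R^-1)%:C%C *:
  \sum_(r < N) (z c)^* ^+ r *: l2Z_basis R (pos l c r).

Let iter_W n : linear (iter n W) := iter_linear W n.

Let inner_b k l c l' c' : (k <= d)%N -> inner (iter k W (b l c)) (b l' c') =
  if (l == l') && (c == c') then ((N - k)%:R / N%:R) * z c ^+ k else 0.
Proof.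
move=> kd; have kN (r : 'I_N) : (r + k < N + d)%N by have := ltn_ord r; lia.
have rN (r : 'I_N) : (r < N + d)%N by have := ltn_ord r; lia.
have -> : iter k W (b l c) = (Num.sqrt N%:R^-1)%:C%C *:
    \sum_(r < N) (z c)^* ^+ r *: l2Z_basis R (pos l c (r + k)).
  rewrite /b -[iter k W _]/(linear_of (@iter_W k) _) linearZ/= linear_sum/=.
  congr (_ *: _); apply: eq_bigr => r _; rewrite linearZ/=; congr (_ *: _).
  by rewrite /linear_of iter_shift_basis -PoszD /pos addnA.
rewrite /b innerZl innerZr conjC_real mulrA -rmorphM -expr2 sqr_sqrtr ?invr_ge0//.
rewrite inner_suml; under eq_bigr do rewrite innerZl inner_sumr.
have innerE (r r' : 'I_N) : inner (l2Z_basis R (pos l c (r + k)))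
    ((z c')^* ^+ r' *: l2Z_basis R (pos l' c' r')) =
    if [&& l == l', c == c' & (r + k == r')%N] then z c' ^+ r' else 0.
  rewrite innerZr inner_l2Z_basis rmorphXn/= conjCK.
  case: ifP => [/and3P[/eqP -> /eqP -> /eqP ->]|h]; first by rewrite eqxx mulr1.
  case: eqP => [[/pos_inj]|_]; last by rewrite mulr0.
  by case=> // ll cc rr; move: h; rewrite ll cc rr !eqxx.
under eq_bigr do under eq_bigr do rewrite innerE.
case: (eqVneq l l') => [ll|_] /=; last first.
  by rewrite big1 ?mulr0// => r _; rewrite big1 ?mulr0.
case: (eqVneq c c') => [<-|_] /=; last first.
  by rewrite big1 ?mulr0// => r _; rewrite big1 ?mulr0.
have row (r : 'I_N) : (z c)^* ^+ r * (\sum_(r' < N) if (r + k == r')%N then z c ^+ r' else 0) =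
    if (r < N - k)%N then z c ^+ k else 0.
  case: ifP => rk; last first.
    rewrite [X in _ * X]big1 ?mulr0// => r' _; rewrite ifF//.
    by apply/eqP => E; have := ltn_ord r'; lia.
  have rkN : (r + k < N)%N by lia.
  rewrite (bigD1 (Ordinal rkN))//= eqxx [X in _ + X]big1 ?addr0.
    rewrite exprD mulrA -exprMn [_^* * _]mulrC -normCK z_circle !expr1n.
    by rewrite mul1r.
  move=> r' r'E; rewrite ifF//; apply: contraNF r'E => /eqP E.
  by apply/eqP/val_inj; rewrite /= E.
under eq_bigr do rewrite row.
rewrite -big_mkcond/= -(big_ord_widen N (fun=> z c ^+ k)) ?leq_subr// sumr_const_ord.
by rewrite fmorphV rmorph_nat mulrA; congr (_ * _); rewrite mulrC.
Qed.

(** The coordinate of [X c x] along [f l] is carried by the block [(l, c)], on which [W] is nearly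
    multiplication by [z c]; the embedding is the limit in [M]. *)
Let v M (x : H) : l2Z R := \sum_(l < M) \sum_c inner (X c x) (f l) *: b l c.

(** By orthogonality of the blocks the shorter truncation decides. Unequal truncations serve the
    Cauchy estimate, equal ones the passage to the limit. *)
Let inner_v k m n x y : (k <= d)%N -> (m <= n)%N ->
  inner (iter k W (v m x)) (v n y) =
  ((N - k)%:R / N%:R) * \sum_c z c ^+ k * inner (orthosum f m (X c x)) (X c y).
Proof.
move=> kd mn.
have -> : iter k W (v m x) = \sum_(l < m) \sum_c inner (X c x) (f l) *: iter k W (b l c).
  rewrite /v -[iter k W _]/(linear_of (@iter_W k) _) linear_sum; apply: eq_bigr => l _.
  by rewrite linear_sum; apply: eq_bigr => c _; rewrite linearZ.
rewrite inner_suml; under eq_bigr do rewrite inner_suml.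
transitivity (\sum_(l < m) \sum_c inner (X c x) (f l) *
    (((N - k)%:R / N%:R * z c ^+ k) * inner (f l) (X c y))).
  apply: eq_bigr => l _; apply: eq_bigr => c _; rewrite innerZl; congr (_ * _).
  have ln : (l < n)%N := leq_trans (ltn_ord l) mn.
  rewrite /v inner_sumr (bigD1 (Ordinal ln))//= [X in _ + X]big1 ?addr0; last first.
    move=> l' l'E; rewrite inner_sumr big1// => c' _; rewrite innerZr inner_b//.
    rewrite ifF ?mulr0//; apply: contraNF l'E => /andP[/eqP E _].
    by apply/eqP/val_inj; rewrite /= E.
  rewrite inner_sumr (bigD1 c)//= [X in _ + X]big1 ?addr0; last first.
    move=> c' /negPf c'E; rewrite innerZr inner_b// eq_sym c'E andbF mulr0//.
  by rewrite innerZr inner_b// !eqxx/= mulrC -innerC.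
rewrite exchange_big/= mulr_sumr; apply: eq_bigr => c _.
rewrite inner_orthosum !mulr_sumr; apply: eq_bigr => l _.
by rewrite mulrCA !mulrA.
Qed.

Let inner_v0 m n x : (m <= n)%N ->
  inner (v m x) (v n x) = (\sum_c rnorm (orthosum f m (X c x)) ^+ 2)%:C%C.
Proof.
move=> mn; have := inner_v x x (leq0n d) mn; rewrite /= subn0 => ->.
rewrite divff ?pnatr_eq0 -?lt0n// mul1r rmorph_sum; apply: eq_bigr => c _.
by rewrite expr0 mul1r -(inner_orthosum_proj fP) inner_rnorm.
Qed.

(** By [inner_v0] the cross term equals [|v m x|^2], so [|v n x - v m x|^2] is an increment of the
    sequence [|v n x|^2], which converges. *)
Let v_cvg x : exists l : l2Z R, v n x @[n --> \oo] --> l.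
Proof.
apply: (@cvgn_dominated _ _ _ (fun n => \sum_c rnorm (orthosum f n (X c x)) ^+ 2)).
  apply/cvg_ex; exists (\sum_c rnorm (X c x) ^+ 2).
  apply: (@cvg_big R I +%R 0 xpredT); first exact: add_continuous.
  move=> c _; have cv := cvgn_rnorm (@f_total (X c x)).
  rewrite expr2 (_ : (fun n => _) =
    (fun n => rnorm (orthosum f n (X c x)) * rnorm (orthosum f n (X c x)))) ?cvgM//.
  exact: (cvgM cv cv).
move=> m n mn; rewrite rnormB_sqr (Re_innerC (v m x) (v n x)).
rewrite -(Re_inner_rnorm (v n x)) -(Re_inner_rnorm (v m x)) !inner_v0//.
rewrite -[complex.Re _]/(\sum_c rnorm (orthosum f n (X c x)) ^+ 2).
rewrite -[complex.Re _]/(\sum_c rnorm (orthosum f m (X c x)) ^+ 2).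
by move: (\sum_c _) (\sum_c _) => p q; lra.
Qed.

Lemma shift_embedding : exists V : {linear H -> l2Z R}, isometric_embedding V /\
  forall k x y, (k <= d)%N -> inner (iter k (@bilateral_shift R) (V x)) (V y) =
    ((N - k)%:R / N%:R) * \sum_c z c ^+ k * inner (X c x) (X c y).
Proof.
have [V Vlim] := choice v_cvg.
have vlin M : linear (v M).
  move=> a x y; rewrite /v scaler_sumr -big_split/=; apply: eq_bigr => l _.
  rewrite scaler_sumr -big_split/=; apply: eq_bigr => c _.
  by rewrite (linearP (X c)) innerDl innerZl scalerDl -scalerA.
have Vlin : linear V.
  move=> a x y; apply: (cvgn_unique (Vlim _)).
  rewrite (_ : (fun n => _) = (fun n => a *: v n x + v n y)).
    by apply: cvgD => //; apply: cvgZ => //; exact: cvg_cst.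
  by apply/funext => n; rewrite vlin.
have key k x y : (k <= d)%N -> inner (iter k (@bilateral_shift R) (V x)) (V y) =
    ((N - k)%:R / N%:R) * \sum_c z c ^+ k * inner (X c x) (X c y).
  move=> kd; apply: (@cvgn_unique _ _ (fun n => inner (iter k W (v n x)) (v n y))).
    apply: cvgn_inner => //.
    apply: (@cvgn_bounded_op _ _ _ (linear_of (@iter_W k))) => //.
    apply/bounded_opP; exists 1 => // u; rewrite mul1r /linear_of.
    have Wi : isometric_embedding W := @bilateral_shift_isometric R.
    elim: k {kd} => //= k IH; apply: le_trans IH.
    by rewrite (isometric_rnorm _ Wi).
  rewrite (_ : (fun n => _) = fun n => ((N - k)%:R / N%:R) *
      \sum_c z c ^+ k * inner (orthosum f n (X c x)) (X c y)); last first.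
    by apply/funext => n; rewrite inner_v.
  apply: cvgM; first exact: cvg_cst.
  apply: (@cvgn_sum R[i] I (fun c n => z c ^+ k * inner (orthosum f n (X c x)) (X c y))).
  move=> c; apply: cvgM; first exact: cvg_cst.
  by apply: cvgn_inner => //; exact: cvg_cst.
exists (linear_of Vlin); split => // x y.
have := key 0%N x y (leq0n d); rewrite subn0 divff ?pnatr_eq0 -?lt0n// mul1r.
by under [X in _ = X -> _]eq_bigr do rewrite expr0 mul1r; rewrite X_iso.
Qed.

End shift_embedding.

(** * The equivalences *)

Section equivalences.
Variables (R : realType) (H : hilbertType R) (d : nat) (T : 'I_d -> {linear H -> H}).
Hypothesis T_bounded : forall k, bounded_op (T k).

Lemma unitary_isometric (K : hilbertType R) (U : {linear K -> K}) :
  unitary U -> isometric_embedding U.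
Proof. by move=> [Ub UK _] x y; have := adjointP Ub x (U y); rewrite UK. Qed.

Lemma toeplitz_contractive_dilation (K : hilbertType R) (J : {linear H -> K})
    (U : {linear K -> K}) : isometric_embedding J -> unitary U ->
  (forall k : 'I_d, dilation J (iter k.+1 U) (T k)) -> toeplitz_contractive T.
Proof.
move=> Ji Uu TU; apply: (toeplitz_contractive_isometry T_bounded Ji).
  exact: unitary_isometric Uu.
by move=> k; apply/(dilationP _ _ Ji).
Qed.

Lemma matrix_inequality : toeplitz_contractive T ->
  forall m (A0 : 'M[R[i]]_m) (A : 'I_d -> 'M[R[i]]_m) (M : R),
  (forall z : R[i], `|z| = 1 ->
    mxopnorm (A0 + \sum_(k < d) z ^+ k.+1 *: A k) <= M) ->
  opnorm (fun x : hpow m H =>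
    tensor_op id A0 x + \sum_(k < d) tensor_op (T k) (A k) x) <= M.
Proof.
move=> Tc m A0 A M AM; have [J [U [Ji Uu TU]]] := toeplitz_unitary_dilation T_bounded Tc.
apply: (@opnorm_le _ _ _ (linear_of (matrix_polynomial_linear T A0 A))).
  by apply: le_trans (AM 1 (normr1 _)); exact: mxopnorm_ge0.
exact: (matrix_von_neumann Ji (unitary_isometric Uu) TU).
Qed.

Lemma shift_compression_approx : separable H -> toeplitz_contractive T ->
  forall e : R, 0 < e -> exists2 V : {linear H -> l2Z R}, isometric_embedding V &
    forall k : 'I_d, opnorm (fun x : H =>
      T k x - adjoint V (iter k.+1 (@bilateral_shift R) (V x))) < e.
Proof.
move=> Hs Tc e e0.
have [f fP f_total] := separable_parseval Hs.
have [J [U [Ji Uu TU]]] := toeplitz_unitary_dilation T_bounded Tc.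
have Ui := unitary_isometric Uu.
have T1 k x : rnorm (T k x) <= rnorm x.
  have := rnorm_inner (iter k.+1 U (J x)) (J (T k x)).
  rewrite -TU inner_rnorm rnorm_real ger0_norm ?sqr_ge0// expr2.
  have Un n y : rnorm (iter n U y) = rnorm y.
    by elim: n => //= n IH; rewrite isometric_rnorm.
  rewrite Un !(isometric_rnorm _ Ji).
  have [t0|t0] := leP (rnorm (T k x)) 0.
    by move=> _; exact: le_trans t0 (rnorm_ge0 x).
  by rewrite ler_pM2r.
(* Serves as orbit length and as block length. Each approximation contributes a factor
   [r = 1 - k/n], and [1 - r^2 <= 2 k/n <= 2 d/n < e]. *)
pose n := maxn d.+1 (Num.truncn (2 * d%:R / e)).+1.
have n0 : (0 < n)%N by rewrite leq_max.
have ne : 2 * d%:R / n%:R < e.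
  rewrite ltr_pdivrMr ?ltr0n// [e * _]mulrC -ltr_pdivrMr//.
  apply: lt_le_trans (truncnS_gt _) _; rewrite ler_nat leq_max.
  by rewrite leqnn orbT.
have [P [z [Y [z1 Yiso YT]]]] := cyclic_dilation Ji Ui TU n0.
(* The dilation space is a sum of [2 (d + 1)] copies of [H]; splitting each [Y a] into coordinates
   gives operators on [H], all with the root [z a]. *)
pose I : finType := ('I_P * 'I_2 * 'I_d.+1)%type.
have Xlin (c : I) : linear (fun x => Y c.1.1 x c.1.2 c.2).
  by move=> a x y; rewrite linearP !hpowD !hpowZ.
pose X (c : I) : {linear H -> H} := linear_of (Xlin c).
have XY (w : 'I_P -> R[i]) x y : \sum_(c : I) w c.1.1 * inner (X c x) (X c y) =
    \sum_(a < P) w a * inner (Y a x) (Y a y).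
  rewrite -(pair_bigA _ (fun q j => w q.1 * inner (X (q, j) x) (X (q, j) y)))/=.
  rewrite -(pair_bigA _ (fun a i => \sum_j w a * inner (X (a, i, j) x) (X (a, i, j) y)))/=.
  apply: eq_bigr => a _; rewrite inner_hpow mulr_sumr; apply: eq_bigr => i _.
  by rewrite inner_hpow mulr_sumr.
have [||V [Vi VW]] := @shift_embedding _ _ f fP f_total I X (fun c => z c.1.1) _ _ d n n0.
- move=> x y; have := XY (fun=> 1) x y.
  under eq_bigr do rewrite mul1r; move=> ->.
  by under eq_bigr do rewrite mul1r.
- by move=> c.
exists V => // k; have Vb := isometric_bounded Vi.
pose r : R := (n - k.+1)%:R / n%:R.
have SE x : adjoint V (iter k.+1 (@bilateral_shift R) (V x)) = (r * r)%:C%C *: T k x.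
  apply: inner_inj => y; rewrite inner_adjointl// VW ?ltn_ord// innerZl.
  rewrite (XY (fun a => z a ^+ k.+1)) YT mulrA; congr (_ * _).
  by rewrite rmorphM /r rmorphM fmorphV !rmorph_nat.
apply: le_lt_trans ne.
have dlin : linear (fun x => T k x - (r * r)%:C%C *: T k x).
  move=> a x y; rewrite linearP scalerDr opprD addrACA !scalerA [_ * a]mulrC.
  by rewrite -scalerA -scalerBr.
rewrite (_ : (fun x => _) = linear_of dlin); last by apply/funext => x; rewrite SE.
apply: opnorm_le => [|x]; first by rewrite divr_ge0 ?mulr_ge0.
change (rnorm (T k x - (r * r)%:C%C *: T k x) <= 2 * d%:R / n%:R * rnorm x).
have -> : T k x - (r * r)%:C%C *: T k x = (1 - r * r)%:C%C *: T k x.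
  by rewrite rmorphB/= rmorph1 scalerBl scale1r.
have kn : (k.+1 <= n)%N by rewrite leq_max ltnW// ltnS ltn_ord.
have rE : r = 1 - k.+1%:R / n%:R.
  by rewrite /r natrB//; field; rewrite pnatr_eq0 -lt0n.
have kd : k.+1%:R / n%:R <= d%:R / n%:R :> R.
  by rewrite ler_pM2r ?invr_gt0 ?ltr0n// ler_nat ltn_ord.
have k0 : 0 <= k.+1%:R / n%:R :> R by rewrite divr_ge0.
have k1 : k.+1%:R / n%:R <= 1 :> R by rewrite ler_pdivrMr ?ltr0n// mul1r ler_nat.
have r2 : 0 <= 1 - r * r <= 2 * d%:R / n%:R.
  rewrite rE -mulrA; move: (_ / _) (_ / _) kd k0 k1 => p q pq p0 p1.
  by apply/andP; split; nra.
case/andP: r2 => r20 r2d.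
rewrite rnormZ rnorm_real ger0_norm//.
by apply: le_trans (ler_wpM2l r20 (T1 k x)) _; rewrite ler_wpM2r ?rnorm_ge0.
Qed.

Lemma toeplitz_contractive_shift_compression :
  (forall e : R, 0 < e -> exists2 V : {linear H -> l2Z R}, isometric_embedding V &
    forall k : 'I_d, opnorm (fun x : H =>
      T k x - adjoint V (iter k.+1 (@bilateral_shift R) (V x))) < e) ->
  toeplitz_contractive T.
Proof.
move=> h; apply: toeplitz_contractive_approx => // e e0.
have [V Vi VT] := h e e0; have Vb := isometric_bounded Vi.
have Wi := @bilateral_shift_isometric R.
have Slin (k : 'I_d) :
    linear (fun x => adjoint V (iter k.+1 (@bilateral_shift R) (V x))).
  by move=> a x y; rewrite linearP iter_linear adjoint_linear.
have Wn k x : rnorm (iter k (@bilateral_shift R) x) = rnorm x.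
  by elim: k => //= k IH; rewrite isometric_rnorm.
have Sb k : bounded_op (linear_of (Slin k)).
  apply/bounded_opP; exists 1 => // x; rewrite /linear_of.
  apply: le_trans (@adjoint_le _ _ _ V 1 _ _ _) _ => //.
    by move=> y; rewrite mul1r isometric_rnorm.
  by rewrite !mul1r Wn isometric_rnorm.
exists (fun k => linear_of (Slin k)); split => //.
  apply: (toeplitz_contractive_isometry Sb Vi Wi) => k x y.
  by rewrite /linear_of inner_adjointl.
move=> k x; have dlin : linear (fun x => T k x - linear_of (Slin k) x).
  move=> a u v; rewrite (linearP (T k)).
  by rewrite (linearP (linear_of (Slin k) : {linear H -> H})) opprD addrACA -scalerBr.
have db : bounded_op (linear_of dlin).
  have /bounded_opP[c c0 cT] := T_bounded k; have /bounded_opP[c' c'0 cS] := Sb k.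
  apply/bounded_opP; exists (c + c'); first exact: addr_ge0.
  move=> u; change (rnorm (T k u - linear_of (Slin k) u) <= (c + c') * rnorm u).
  rewrite mulrDl; apply: le_trans (ler_rnormB _ _) _.
  exact: lerD (cT u) (cS u).
apply: le_trans (le_opnorm x db) _; rewrite ler_wpM2r ?rnorm_ge0//.
exact: ltW (VT k).
Qed.

End equivalences.

Theorem theorem3p1 (R : realType) (H : hilbertType R) (d : nat)
    (T : 'I_d -> {linear H -> H}) (T_bounded : forall k, bounded_op (T k)) :
  [/\ (toeplitz_contractive T <->
       forall (m : nat) (A0 : 'M[R[i]]_m) (A : 'I_d -> 'M[R[i]]_m), (0 < m)%N ->
         exists2 M : R,
           is_max [set mxopnorm (A0 + \sum_(k < d) z ^+ k.+1 *: A k)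
                    | z in [set z : R[i] | `|z| = 1]] M &
           opnorm (fun x : hpow m H =>
             tensor_op id A0 x + \sum_(k < d) tensor_op (T k) (A k) x) <= M),
      (toeplitz_contractive T <->
       exists (K : hilbertType R) (J : {linear H -> K}) (U : {linear K -> K}),
         [/\ isometric_embedding J, unitary U
           & forall k : 'I_d, dilation J (iter k.+1 U) (T k)]),
      (separable H ->
       (toeplitz_contractive T <->
        forall e : R, 0 < e ->
          exists2 V : {linear H -> l2Z R}, isometric_embedding V &
            forall k : 'I_d,
              opnorm (fun x : H =>
                T k x - adjoint V (iter k.+1 (@bilateral_shift R) (V x))) < e))
    & (finite_dim H -> toeplitz_contractive T ->
       exists (K : hilbertType R) (J : {linear H -> K}) (U : {linear K -> K}),
         [/\ finite_dim K, isometric_embedding J, unitary U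
           & forall k : 'I_d, dilation J (iter k.+1 U) (T k)])].
Proof.
split.
- split=> [Tc m A0 A m0|h].
    have [M Mmax] := circle_max_exists A0 A.
    exists M => //; apply: matrix_inequality => // z z1.
    by apply: Mmax.2; exists z.
  apply: toeplitz_contractive_of_matrix_inequality => // A0 A.
  by have [M [[z z1 zM] _] TM] := h _ A0 A isT; exists z => //; rewrite zM.
- split=> [Tc|[K [J [U [Ji Uu TU]]]]].
    have [J [U [Ji Uu TU]]] := toeplitz_unitary_dilation T_bounded Tc.
    exists (hpow 2 (hpow d.+1 H)), J, U; split=> // k.
    by apply/(dilationP _ _ Ji); exact: TU.
  exact: (toeplitz_contractive_dilation T_bounded Ji Uu TU).
- move=> Hs; split; first exact: shift_compression_approx.
  exact: toeplitz_contractive_shift_compression.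
- move=> Hf Tc; have [J [U [Ji Uu TU]]] := toeplitz_unitary_dilation T_bounded Tc.
  exists (hpow 2 (hpow d.+1 H)), J, U; split=> // [|k].
    by do 2!apply: finite_dim_hpow.
  by apply/(dilationP _ _ Ji); exact: TU.
Qed.
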